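(* Let $\Omega_x\subset\mathbb R^3$, $\Omega_\xi\subset\mathbb R^2$ be open and $\varphi\in C^\infty(\Omega_x\times\Omega_\xi;\mathbb R)$. Put $P(x,\xi)=\nabla_x\varphi(x,\xi)$ and $A(x,\xi)=\partial_\xi P(x,\xi)$. Assume $\operatorname{rank}A=2$ and that, for each fixed $x$, the surface $\{P(x,\xi):\xi\in\Omega_\xi\}$ has definite second fundamental form. For an amplitude $b(x,\xi,\nu)$ define $$T^b_\nu h(x)=\nu\int e^{i\nu\varphi(x,\xi)}b(x,\xi,\nu)h(\xi)\,d\xi .$$ Then every point $(x_0,\xi_0)\in\Omega_x\times\Omega_\xi$ has a sufficiently small compact neighborhood (patch) such that, for all amplitudes $b_1,b_2$ supported in this patch and belonging to a bounded $C^\infty$ order-zero family, there is a constant $C$ with $$\|T^{b_1}_\alpha f\;T^{b_2}_\beta g\|_{L^2(\mathbb R^3)}\le C\alpha^{1/2}\|f\|_{L^2(\mathbb R^2)}\|g\|_{L^2(\mathbb R^2)}$$ for all $1\le\alpha\le\beta$ and all $f,g\in L^2(\mathbb R^2)$.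
   Context: A bounded $C^\infty$ order-zero family of amplitudes $b(x,\xi,\nu)$, $\nu\ge1$, means: smooth in $(x,\xi)$, with every $(x,\xi)$-derivative bounded uniformly in $\nu\ge1$. The constant $C$ is independent of $\alpha,\beta,f,g$. *)

(* Defs.v *)
From HB Require Import structures.
From mathcomp Require Import all_boot all_order all_algebra.
From mathcomp Require Import all_classical all_reals all_analysis.
From mathcomp Require Import complex.

Set Implicit Arguments.
Unset Strict Implicit.
Unset Printing Implicit Defensive.

Import Order.TTheory GRing.Theory Num.Theory.
Import numFieldNormedType.Exports.
Import ComplexField.

Local Open Scope classical_set_scope.
Local Open Scope ring_scope.

(* [R^2] and [R^3] are iterated products, which carry both the normed module
   structure used for derivatives and the product of the Lebesgue measures. *)
Definition leb2 (R : realType) :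
    {measure set (measurableTypeR R * measurableTypeR R) -> \bar R} :=
  (@lebesgue_measure R \x @lebesgue_measure R)%E.

Definition leb3 (R : realType) :
    {measure set (measurableTypeR R * measurableTypeR R * measurableTypeR R)
       -> \bar R} :=
  (leb2 R \x @lebesgue_measure R)%E.

Notation R2 R := (R * R)%type.
Notation R3 R := (R * R * R)%type.

Definition e2 (R : realType) (j : 'I_2) : R2 R :=
  ((j == 0)%:R, (j == 1)%:R).

Definition e3 (R : realType) (i : 'I_3) : R3 R :=
  ((i == 0)%:R, (i == 1)%:R, (i == 2%:R)%:R).

Section Smooth.
Context {R : realType} {V : normedModType R}.

Definition iterD (vs : seq V) (f : V -> R) : V -> R :=
  foldr (fun v (g : V -> R) => 'D_v g) f vs.

Definition smooth_on (U : set V) (f : V -> R) : Prop :=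
  forall vs p, U p ->
    {for p, continuous (iterD vs f)} /\ (forall v, derivable (iterD vs f) p v).

(* Smoothness is required on the whole space: amplitudes supported in a compact
   subset of the domain of the phase are extended by zero. *)
Definition bounded_order_zero (b : R -> V -> R[i]) : Prop :=
  (forall nu, 1 <= nu ->
     smooth_on setT (fun p => complex.Re (b nu p)) /\
     smooth_on setT (fun p => complex.Im (b nu p))) /\
  (forall vs, exists M : R, forall nu p, 1 <= nu ->
     `|iterD vs (fun q => complex.Re (b nu q)) p| <= M /\
     `|iterD vs (fun q => complex.Im (b nu q)) p| <= M).

Definition supported_in (K : set V) (b : R -> V -> R[i]) : Prop :=
  forall nu, 1 <= nu -> closure [set p | b nu p != 0] `<=` K.

End Smooth.

Section Surface.
Context {R : realType}.

Definition dot n (u v : 'rV[R]_n) : R := (u *m v^T) 0 0.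

(* Indices are taken modulo 3. *)
Definition cross (u v : 'rV[R]_3) : 'rV[R]_3 :=
  \row_(k < 3) (u 0 (k + 1) * v 0 (k + 2%:R) - u 0 (k + 2%:R) * v 0 (k + 1)).

Definition tangent (S : R2 R -> 'rV[R]_3) (j : 'I_2) (xi : R2 R) : 'rV[R]_3 :=
  'D_(e2 R j) S xi.

Definition unit_normal (S : R2 R -> 'rV[R]_3) (xi : R2 R) : 'rV[R]_3 :=
  let n := cross (tangent S 0 xi) (tangent S 1 xi) in
  (Num.sqrt (dot n n))^-1 *: n.

(* The matrix of the second fundamental form in the basis of coordinate tangent
   vectors. *)
Definition second_fundamental_form (S : R2 R -> 'rV[R]_3) (xi : R2 R) :
    'M[R]_2 :=
  \matrix_(j, k) dot ('D_(e2 R j) (tangent S k) xi) (unit_normal S xi).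

Definition definite_form n (B : 'M[R]_n) : Prop :=
  (forall v : 'rV[R]_n, v != 0 -> 0 < (v *m B *m v^T) 0 0) \/
  (forall v : 'rV[R]_n, v != 0 -> (v *m B *m v^T) 0 0 < 0).

End Surface.

Section Phase.
Context {R : realType}.

Definition gradx (phi : R3 R * R2 R -> R) (x : R3 R) (xi : R2 R) : 'rV[R]_3 :=
  \row_(i < 3) 'D_(e3 R i) (fun y => phi (y, xi)) x.

Definition mixed_hessian (phi : R3 R * R2 R -> R) (x : R3 R) (xi : R2 R) :
    'M[R]_(3, 2) :=
  \matrix_(i < 3, j < 2) ('D_(e2 R j) (gradx phi x) xi) 0 i.

End Phase.

Section Operator.
Context {R : realType}.

Definition cis (t : R) : R[i] := (cos t +i* sin t)%C.

Section Integral.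
Context {d : measure_display} {T : measurableType d}.
Variable mu : {measure set T -> \bar R}.

Definition Cintegral (F : T -> R[i]) : R[i] :=
  (Rintegral mu setT (fun t => complex.Re (F t)) +i*
   Rintegral mu setT (fun t => complex.Im (F t)))%C.

Definition L2norm (F : T -> R[i]) : \bar R :=
  Lnorm mu 2%:E (fun t => (Normc.normc (F t))%:E).

(* Membership in [L^2]: the real and imaginary parts are Borel measurable (every
   class in [L^2] has such a representative) and the norm is finite. *)
Definition inL2 (F : T -> R[i]) : Prop :=
  [/\ measurable_fun setT (fun t => complex.Re (F t) : measurableTypeR R),
      measurable_fun setT (fun t => complex.Im (F t) : measurableTypeR R)
    & (L2norm F < +oo)%E].

End Integral.

Definition osc_op (phi : R3 R * R2 R -> R) (b : R -> R3 R * R2 R -> R[i])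
    (nu : R) (h : R2 R -> R[i]) (x : R3 R) : R[i] :=
  nu%:C%C * Cintegral (leb2 R)
    (fun xi => cis (nu * phi (x, xi)) * b nu (x, xi) * h xi).

End Operator.

(* Main.v *)
(** After splitting amplitudes and functions into real and imaginary parts, write
the frequencies of [f] and [g] as [eta + t (1, u)] and [eta], with Jacobian [|t|].
Cauchy-Schwarz in the slope [u] with weight [1 + u^2] freezes [u]; for fixed [u] and
fixed sign of [t], Schur's test applies to the operator in [z = (eta, t)].

The phase [a phi(x, eta + t (1, u)) + b phi(x, eta)] behaves like two bodies of masses
[a] and [b]: expanding it at the centre of mass [w = eta + a/(a+b) t (1, u)] cancels
the terms linear in [t].  Hence, with [m = ab/(a+b)] the reduced mass and
[P = nabla_x phi], the [x]-gradient of the phase difference between [z] and [z'] is,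
up to a small relative error, the combination of [d_1 P], [d_2 P] and
[(d_1 + u d_2)^2 P / (1 + u^2)] with coefficients [(a+b) (w' - w)] and
[m/2 (1 + u^2) (t'^2 - t^2)].  Definiteness of the second fundamental form makes these
three vectors independent, uniformly in [u], so that on a small patch one coordinate
of the gradient dominates, and six integrations by parts along that axis bound the
kernel.  The Schur integral contributes [1 / ((a+b)^2 m)], and
[(ab)^2 / ((a+b)^2 m) <= a] up to a constant. *)

Require Import Defs.
From HB Require Import structures.
From mathcomp Require Import all_boot all_order all_algebra.
From mathcomp Require Import all_classical all_reals all_analysis.
From mathcomp Require Import measurable_realfun complex ring lra.

Import Order.TTheory GRing.Theory Num.Theory.
Import numFieldNormedType.Exports.
Import ComplexField.

Local Open Scope classical_set_scope.
Local Open Scope ring_scope.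

Set Implicit Arguments.
Unset Strict Implicit.
Unset Printing Implicit Defensive.

(** The product of the two operators integrates over four frequency variables, one too many for
    decay coming from three space variables; the slope [u] is the variable given up. For fixed [u]
    the other three are matched with three directions of [x]: two for the centre of mass and one for
    [t ^+ 2]. To leading order the phase sees [t] only through its square, so the sign of [t] has to
    be fixed, and the Jacobian |t| is what turns dt into d(t^2)/2.

    The weight 1 + u^2 is dictated by the kernel: the coefficient of t'^2 - t^2 carries this factor,
    so Schur's constant is proportional to 1 / (1 + u^2), which pays for the weight in
    Cauchy-Schwarz. The number six comes from comparing the kernel with a product of three factors 1
    / (1 + y^2).

    No constant may depend on the masses, the slope, the frequencies or the line of integration;
    hence the integrations by parts are done for families over an arbitrary index type. As (a+b)^2 m
    = (a+b) a b, the squared prefactors of the operators leave (a b)^2 / ((a+b) a b) = m <= a. *)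

Lemma le_of_eq d (T : porderType d) (x y : T) : x = y -> (x <= y)%O.
Proof. by move=> ->. Qed.

(** * Derivative rules on the line and a perturbed quadratic form *)

Section RealDerivatives.
Context {R : realType}.
Implicit Types (f g : R -> R) (x a b c : R).

Lemma is_deriveDf f g x a b : is_derive x 1 f a -> is_derive x 1 g b ->
  is_derive x 1 (fun r => f r + g r) (a + b).
Proof. exact: is_deriveD. Qed.

Lemma is_deriveBf f g x a b : is_derive x 1 f a -> is_derive x 1 g b ->
  is_derive x 1 (fun r => f r - g r) (a - b).
Proof. exact: is_deriveB. Qed.

Lemma is_deriveMf f g x a b : is_derive x 1 f a -> is_derive x 1 g b ->
  is_derive x 1 (fun r => f r * g r) (f x * b + g x * a).
Proof. exact: is_deriveM. Qed.

Lemma is_derive_scale f x a c : is_derive x 1 f a -> is_derive x 1 (fun r => c * f r) (c * a).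
Proof. exact: is_deriveZ. Qed.

Lemma is_derive_lin x c : is_derive x 1 (fun r => c * r) c.
Proof.
rewrite -[X in is_derive _ _ _ X](mulr1 c).
exact: (is_derive_scale c (is_derive_id _ _)).
Qed.

(** Since [sg ^+ 2 = 1], the directions (1, u) and -(1, u) give the same form. The entrywise errors
    add up to e (1 + |u|)^2, and (1 + |u|)^2 <= 2 (1 + u^2). *)
Lemma quadratic_form_approx (sg u e x11 x12 x21 x22 A11 A12 A21 A22 : R) :
  sg ^+ 2 = 1 -> 0 <= e -> `|x11 - A11| <= e -> `|x12 - A12| <= e ->
  `|x21 - A21| <= e -> `|x22 - A22| <= e ->
  `|sg * (sg * x11 + sg * u * x12) + sg * u * (sg * x21 + sg * u * x22) -
    (A11 + u * (A12 + A21) + u ^+ 2 * A22)| <= 2 * e * (1 + u ^+ 2).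
Proof.
move=> sg2 e0 B11 B12 B21 B22.
have -> : sg * (sg * x11 + sg * u * x12) + sg * u * (sg * x21 + sg * u * x22) -
    (A11 + u * (A12 + A21) + u ^+ 2 * A22) =
    (x11 - A11) + u * (x12 - A12) + u * (x21 - A21) + u ^+ 2 * (x22 - A22) +
    (sg ^+ 2 - 1) * (x11 + u * x12 + u * x21 + u ^+ 2 * x22) by ring.
rewrite sg2 subrr mul0r addr0.
do 3 (apply: le_trans (ler_normD _ _) _; rewrite -lerBrDr).
rewrite !normrM.
have h1 : `|u| * `|x12 - A12| <= `|u| * e by rewrite ler_wpM2l.
have h2 : `|u| * `|x21 - A21| <= `|u| * e by rewrite ler_wpM2l.
have h4 : `|u| * `|u| = u ^+ 2 by rewrite -expr2 real_normK// num_real.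
have h3 : `|u| * `|u| * `|x22 - A22| <= u ^+ 2 * e by rewrite h4 ler_wpM2l ?sqr_ge0.
have h5 : 2 * (`|u| * e) <= (1 + u ^+ 2) * e.
  by rewrite mulrA ler_wpM2r// -h4; have := sqr_ge0 (`|u| - 1); lra.
by lra.
Qed.

End RealDerivatives.

(** * Directional derivatives and the two-body expansion *)

Section Calculus.
Context {R : realType} {V : normedModType R}.
Implicit Types (f g : V -> R) (p v w : V) (U : set V).

Lemma is_derive_line f p v (s : R) : derivable f (p + s *: v) v ->
  is_derive s 1 (fun r : R => f (p + r *: v)) ('D_v f (p + s *: v)).
Proof.
move=> df.
have E : (fun h : R => h^-1 *: (((fun r : R => f (p + r *: v)) \o shift s) (h *: 1)
       - (fun r : R => f (p + r *: v)) s)) =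
   (fun h : R => h^-1 *: ((f \o shift (p + s *: v)) (h *: v) - f (p + s *: v))).
  apply/funext => h /=; congr (_ *: (f _ - _)).
  by rewrite -[h *: 1]/(h * 1) mulr1 scalerDl addrCA.
by split; rewrite /derivable /derive E.
Qed.

Lemma mvt_line f p v :
  (forall s : R, 0 <= s <= 1 -> derivable f (p + s *: v) v) ->
  exists2 s : R, 0 <= s <= 1 & f (p + v) - f p = 'D_v f (p + s *: v).
Proof.
move=> df.
have d s : s \in `[(0:R), 1] -> is_derive s 1 (fun r : R => f (p + r *: v)) ('D_v f (p + s *: v)).
  by rewrite in_itv /= => /df; exact: is_derive_line.
have c : {within `[(0:R), 1], continuous (fun r : R => f (p + r *: v))}.
  apply: derivable_within_continuous => x xI.
  exact: (@ex_derive _ _ _ _ _ _ _ (d x xI)).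
have d' (s : R) : s \in `](0:R), 1[ -> is_derive s 1 (fun r : R => f (p + r *: v)) ('D_v f (p + s *: v)).
  by move=> /subset_itv_oo_cc; exact: d.
have [s sI e] := @MVT_segment R _ (fun r : R => 'D_v f (p + r *: v)) 0 1 ler01 d' c.
exists s; first by move: sI; rewrite in_itv.
by move: e; rewrite scale1r scale0r addr0 subr0 mulr1.
Qed.

Lemma smooth_on_derive U f v : smooth_on U f -> smooth_on U ('D_v f).
Proof.
move=> sf vs p Up; have := sf (rcons vs v) p Up.
by rewrite /Defs.iterD foldr_rcons.
Qed.

Lemma smooth_on_derivable U f p v : smooth_on U f -> U p -> derivable f p v.
Proof. by move=> sf Up; have [_] := sf [::] p Up; exact. Qed.

Lemma smooth_on_continuous U f p : smooth_on U f -> U p -> {for p, continuous f}.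
Proof. by move=> sf Up; have [] := sf [::] p Up. Qed.

Lemma is_derive_dir f p v (d : R) :
  is_derive (0 : R) 1 (fun r : R => f (p + r *: v)) d -> is_derive p v f d.
Proof.
move=> [df <-].
have E : (fun h : R => h^-1 *: (((fun r : R => f (p + r *: v)) \o shift 0) (h *: 1)
       - (fun r : R => f (p + r *: v)) 0)) =
   (fun h : R => h^-1 *: ((f \o shift p) (h *: v) - f p)).
  apply/funext => h /=; rewrite scale0r addr0; congr (_ *: (f _ - _)).
    by rewrite -[h *: 1]/(h * 1) mulr1 addrC.
  by rewrite addr0.
by move: df; rewrite /derivable /derive E.
Qed.

Lemma is_derive_dirZ f p (a : R) v : derivable f p v ->
  is_derive p (a *: v) f (a * 'D_v f p).
Proof.
move=> df; apply: is_derive_dir.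
have -> : (fun r : R => f (p + r *: (a *: v))) = (fun r : R => f (p + r *: v)) \o (fun r => a * r).
  by apply/funext => r /=; rewrite scalerA mulrC.
rewrite mulrC; apply: is_derive1_comp.
  have := @is_derive_line f p v 0.
  by rewrite mulr0 scale0r addr0; apply.
exact: is_derive_lin.
Qed.

(** Smoothness is phrased with directional derivatives, and these are not automatically additive in
    the direction. The increment along h (v + w) is split at p + h v; the mean value theorem turns
    the second piece into h times ['D_w f] at a nearby point, and continuity of ['D_w f] at p
    finishes. *)
Lemma is_derive_dirD U f p v w : open U -> U p ->
  (forall q, U q -> derivable f q w) -> {for p, continuous ('D_w f)} ->
  derivable f p v -> is_derive p (v + w) f ('D_v f p + 'D_w f p).
Proof.
move=> oU Up dw cw dv.
suff H : (fun h : R => h^-1 *: ((f \o shift p) (h *: (v + w)) - f p)) @ 0^' --> ('D_v f p + 'D_w f p).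
  by split; [apply/cvg_ex; eexists; exact: H | exact/cvg_lim].
apply/cvgrPdist_lt => e e0.
have e2 : 0 < e / 2 by rewrite divr_gt0.
have /cvgrPdist_lt/(_ _ e2) cw' := cw.
have : \forall q \near p, U q /\ `|'D_w f p - 'D_w f q| < e / 2.
  by near=> q; split; near: q => //; exact: open_nbhs_nbhs.
move/nbhs_ballP => [d /= d0 Hd].
have /cvgrPdist_lt/(_ _ e2) Hv : (fun h : R => h^-1 *: ((f \o shift p) (h *: v) - f p)) @ 0^' --> 'D_v f p.
  exact: dv.
have vwp : 0 < `|v| + `|w| + 1 by rewrite ltr_wpDl// addr_ge0.
have k0 : 0 < d / (`|v| + `|w| + 1) by rewrite divr_gt0.
near=> h.
have h0 : h != 0 by near: h; exact: nbhs_dnbhs_neq.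
have hd : `|h| * (`|v| + `|w|) < d.
  have hk : `|h| < d / (`|v| + `|w| + 1) by near: h; exact: dnbhs0_lt.
  move: hk; rewrite ltr_pdivlMr//; apply: le_lt_trans.
  by rewrite ler_wpM2l// lerDl.
have Hb (s : R) : 0 <= s <= 1 -> U (h *: v + p + s *: (h *: w)) /\
   `|'D_w f p - 'D_w f (h *: v + p + s *: (h *: w))| < e / 2.
  move=> /andP[s0 s1]; apply: Hd; rewrite -ball_normE /ball_ /=.
  rewrite addrAC opprD addrCA subrr addr0 normrN.
  apply: le_lt_trans (ler_normD _ _) _; apply: le_lt_trans hd.
  rewrite !normrZ mulrDr lerD2l (ger0_norm s0).
  by rewrite ler_piMl// mulr_ge0.
have [s sI es] : exists2 s : R, 0 <= s <= 1 & f (h *: v + p + h *: w) - f (h *: v + p) =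
    'D_(h *: w) f (h *: v + p + s *: (h *: w)).
  apply: mvt_line => s sI; have [Us _] := Hb _ sI.
  exact: (@ex_derive _ _ _ _ _ _ _ (@is_derive_dirZ f _ h w (dw _ Us))).
have [Us Ds] := Hb _ sI.
have ev := @derive_val _ _ _ _ _ _ _ (@is_derive_dirZ f _ h w (dw _ Us)).
have -> : h *: (v + w) + p = h *: v + p + h *: w by rewrite scalerDr addrAC.
rewrite -(subrK (f (h *: v + p)) (f (h *: v + p + h *: w))) es ev.
rewrite [X in `|X|](_ : _ = ('D_v f p - h^-1 *: ((f \o shift p) (h *: v) - f p)) +
  ('D_w f p - 'D_w f (h *: v + p + s *: (h *: w)))); last first.
  rewrite /=; move: ('D_w f (_ + _)) ('D_v f p) ('D_w f p) (f (h *: v + p)) (f p).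
  by move=> x1 x2 x3 x4 x5; rewrite -![_ *: _]/(_ * _); field.
apply: le_lt_trans (ler_normD _ _) _.
rewrite [e]splitr ltrD//.
by near: h; exact: Hv.
Unshelve. all: by end_near.
Qed.

Lemma derive_dirD U f p v w (a b : R) : open U -> smooth_on U f -> U p ->
  'D_(a *: v + b *: w) f p = a * 'D_v f p + b * 'D_w f p.
Proof.
move=> oU sf Up.
have dz q c z : U q -> is_derive q (c *: z) f (c * 'D_z f q).
  by move=> Uq; apply: is_derive_dirZ; exact: smooth_on_derivable sf Uq.
have Ez q c z : U q -> 'D_(c *: z) f q = c * 'D_z f q.
  by move=> Uq; exact: (@derive_val _ _ _ _ _ _ _ (dz q c z Uq)).
rewrite -!Ez//; apply: (@derive_val _ _ _ _ _ _ _ _).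
apply: (@is_derive_dirD U) => //.
- by move=> q Uq; exact: smooth_on_derivable sf Uq.
- by apply: (smooth_on_continuous _ Up); exact: smooth_on_derive.
- exact: smooth_on_derivable sf Up.
Qed.

(* [m = ab/(a+b)] is the reduced mass of two particles of masses [a], [b] with
   center of mass at [w] and relative position [t *: E]. *)
Lemma two_body_radial U f w E (a b t t' A e : R) : open U -> smooth_on U f ->
  0 < a -> 0 < b -> 0 < t -> t < t' ->
  (forall s, - (a / (a + b) * t') <= s <= b / (a + b) * t' ->
    U (w + s *: E) /\ `|'D_E ('D_E f) (w + s *: E) - A| <= e) ->
  forall F : R -> R,
  F = (fun r => a * f (w + (b / (a + b) * r) *: E) + b * f (w - (a / (a + b) * r) *: E)) ->
  `|F t' - F t - a * b / (a + b) / 2 * (t' ^+ 2 - t ^+ 2) * A| <=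
  e * (a * b / (a + b) / 2 * `|t' ^+ 2 - t ^+ 2|).
Proof.
move=> oU sf a0 b0 t0 tt' HU F FE.
have ab0 : 0 < a + b by rewrite addr_gt0.
set a' := a / (a + b); set b' := b / (a + b).
have a'0 : 0 < a' by rewrite divr_gt0.
have b'0 : 0 < b' by rewrite divr_gt0.
have UE s : - (a' * t') <= s <= b' * t' -> U (w + s *: E) by move=> /HU[].
(* Derivative of [F]: the inner factors give a b' = b a' = ab/(a+b), so only a difference of two
   first derivatives remains. This is where the choice of the centre of mass enters. *)
pose dF r := a * b / (a + b) * ('D_E f (w + (b' * r) *: E) - 'D_E f (w - (a' * r) *: E)).
have t'0 : 0 < t' by exact: lt_trans tt'.
have rI (r : R) : 0 <= r <= t' ->
    (- (a' * t') <= b' * r <= b' * t') /\ (- (a' * t') <= - (a' * r) <= b' * t').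
  move=> /andP[r0 rt]; rewrite lerN2 !ler_pM2l// rt andbT /=; split.
    by rewrite (@le_trans _ _ 0)// ?oppr_le0 mulr_ge0// ltW.
  by rewrite (@le_trans _ _ 0)// ?oppr_le0 mulr_ge0// ltW.
have dFP (r : R) : 0 <= r <= t' -> is_derive r 1 F (dF r).
  move=> /rI[r1 r2].
  have comp c : U (w + (c * r) *: E) ->
      is_derive r 1 (fun r => f (w + (c * r) *: E)) ('D_E f (w + (c * r) *: E) * c).
    move=> Uc; have D1 := is_derive_line (smooth_on_derivable (v := E) sf Uc).
    have D2 : is_derive r 1 (fun r => c * r) c by exact: is_derive_lin.
    exact: (@is_derive1_comp _ (fun x => f (w + x *: E)) (fun r => c * r) r _ _ D1 D2).
  have C1 := comp b' (UE _ r1).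
  have C2 : is_derive r 1 (fun r => f (w - (a' * r) *: E)) (- ('D_E f (w - (a' * r) *: E) * a')).
    have := comp (- a'); rewrite mulNr => /(_ (UE _ r2)).
    rewrite mulrN; under eq_fun do rewrite mulNr scaleNr.
    by rewrite scaleNr.
  rewrite FE; have := is_deriveD (is_deriveZ a C1) (is_deriveZ b C2).
  suff -> : a *: ('D_E f (w + (b' * r) *: E) * b') + b *: - ('D_E f (w - (a' * r) *: E) * a') = dF r by [].
  rewrite /dF; move: ('D_E f _) ('D_E f _) => x1 x2.
  by rewrite /a' /b' -![_ *: _]/(_ * _); field; lra.
pose g (r : R) := r ^+ 2 / 2.
have dg (r : R) : is_derive r 1 g r.
  have := is_derive_scale (2^-1) (is_deriveMf (is_derive_id r 1) (is_derive_id r 1)).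
  have -> : (fun r => 2^-1 * (id r * id r)) = g.
    by apply/funext => x; rewrite /g expr2 mulrC.
  by rewrite (_ : 2^-1 * _ = r)//=; field.
have inI r : r \in `[t, t'] -> 0 <= r <= t'.
  by rewrite in_itv /= => /andP[/(le_trans (ltW t0)) -> ->].
have cF : {within `[t, t'], continuous F}.
  apply: derivable_within_continuous => r /inI rr.
  exact: (@ex_derive _ _ _ _ _ _ _ (dFP r rr)).
have cg : {within `[t, t'], continuous g}.
  apply: derivable_within_continuous => r _.
  exact: (@ex_derive _ _ _ _ _ _ _ (dg r)).
have d1 (r : R) : r \in `]t, t'[ -> is_derive r 1 F (dF r).
  by move=> /subset_itv_oo_cc /inI /dFP.
have d2 (r : R) : r \in `]t, t'[ -> is_derive r 1 g (id r) by move=> _; exact: dg.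
have d3 (r : R) : r \in `]t, t'[ -> id r != 0.
  by rewrite in_itv /= => /andP[tr _]; rewrite gt_eqF// (lt_trans t0).
(* Cauchy's form of the mean value theorem, against r^2/2: [dF] vanishes at r = 0, so F'(c)/c is
   comparable with a second derivative. *)
have [c cI ec] := cauchy_MVT tt' cF cg d1 d2 d3.
have /inI cI' := subset_itv_oo_cc cI.
have c0 : 0 < c by move: cI; rewrite in_itv /= => /andP[tr _]; rewrite (lt_trans t0).
have gtt : g t' - g t != 0.
  rewrite /g -mulrBl mulf_neq0// ?invr_neq0// ?pnatr_eq0//.
  by rewrite subr_eq0 gt_eqF// ltr_pXn2r// nnegrE ltW.
(* As a' + b' = 1, the two particles are [c *: E] apart; a second mean value theorem on the segment
   joining them produces the factor c and a value of ['D_E ('D_E f)]. *)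
have [s sI es] : exists2 s : R, 0 <= s <= 1 &
    'D_E f (w - (a' * c) *: E + c *: E) - 'D_E f (w - (a' * c) *: E) =
    'D_(c *: E) ('D_E f) (w - (a' * c) *: E + s *: (c *: E)).
  apply: (@mvt_line ('D_E f) (w - (a' * c) *: E) (c *: E)) => s /andP[s0 s1].
  suff Us : U (w - (a' * c) *: E + s *: (c *: E)).
    exact: (smooth_on_derivable (v := c *: E) (smooth_on_derive E sf) Us).
  rewrite scalerA -addrA -scaleNr -scalerDl; apply: UE.
  have [/andP[h1 h2] /andP[h3 h4]] := rI _ cI'.
  have e1 : a' + b' = 1 by rewrite /a' /b'; field; lra.
  have : 0 <= s * c by rewrite mulr_ge0// ltW.
  have : s * c <= c by rewrite ler_piMl// ltW.
  have -> : b' * t' = t' - a' * t' by rewrite (_ : b' = 1 - a'); [ring | lra].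
  move: h2 h3; have -> : b' * t' = t' - a' * t' by rewrite (_ : b' = 1 - a'); [ring | lra].
  have -> : b' * c = c - a' * c by rewrite (_ : b' = 1 - a'); [ring | lra].
  by move=> *; lra.
move: es; rewrite scalerA -addrA -scaleNr -!scalerDl.
have -> : - (a' * c) + c = b' * c by rewrite /a' /b'; field; lra.
have sI2 : - (a' * t') <= - (a' * c) + s * c <= b' * t'.
  have [/andP[h1 h2] /andP[h3 h4]] := rI _ cI'.
  have e1 : a' + b' = 1 by rewrite /a' /b'; field; lra.
  have [s0 s1] := andP sI.
  have h5 : 0 <= s * c by rewrite mulr_ge0// ltW.
  have h6 : s * c <= c by rewrite ler_piMl// ltW.
  have h7 : b' * c = c - a' * c by rewrite (_ : b' = 1 - a'); [ring | lra].
  by lra.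
have [Us As] := HU _ sI2.
rewrite -[w + _ *: E + (s * c) *: E]addrA -scalerDl.
rewrite (@derive_val _ _ _ _ _ _ _ (is_derive_dirZ c (smooth_on_derivable (v := E) (smooth_on_derive E sf) Us))).
move=> es.
have eF : F t' - F t = a * b / (a + b) * 'D_E ('D_E f) (w + (- (a' * c) + s * c) *: E) * (g t' - g t).
  rewrite -[LHS](divfK gtt) -ec /=; congr (_ * _); rewrite /dF -scaleNr es.
  move: ('D_E _ _) => D; field; lra.
rewrite eF /g; move: As; move: ('D_E _ _) => D As.
have mp : 0 <= a * b / (a + b) / 2 by rewrite !mulr_ge0// ?invr_ge0// ltW.
rewrite (_ : _ - _ = (a * b / (a + b) / 2 * (t' ^+ 2 - t ^+ 2)) * (D - A)); last by field; lra.
rewrite normrM mulrC (normrM (_ / 2)) (ger0_norm mp).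
by rewrite ler_wpM2r// mulr_ge0.
Qed.

(** The two mixed derivatives are kept apart, which dispenses with the symmetry of second
    derivatives; only their sum matters later. *)
Lemma derive_derive_dir U f p v w (a b : R) : open U -> smooth_on U f -> U p ->
  'D_(a *: v + b *: w) ('D_(a *: v + b *: w) f) p =
  a * (a * 'D_v ('D_v f) p + b * 'D_v ('D_w f) p) +
  b * (a * 'D_w ('D_v f) p + b * 'D_w ('D_w f) p).
Proof.
move=> oU sf Up.
have eq z : 'D_z ('D_(a *: v + b *: w) f) p = a * 'D_z ('D_v f) p + b * 'D_z ('D_w f) p.
  have d1 := derivableP (smooth_on_derivable (v := z) (smooth_on_derive v sf) Up).
  have d2 := derivableP (smooth_on_derivable (v := z) (smooth_on_derive w sf) Up).
  rewrite (@near_eq_derive _ _ _ _ (a \*: 'D_v f + b \*: 'D_w f)).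
    exact: (@derive_val _ _ _ _ _ _ _ (is_deriveD (is_deriveZ a d1) (is_deriveZ b d2))).
  near=> q; apply: (derive_dirD _ _ _ _ oU sf).
  by near: q; exact: open_nbhs_nbhs.
have sE := smooth_on_derive (a *: v + b *: w) sf.
have D := derive_dirD v w a b oU sE Up.
apply: etrans D _; congr (_ * _ + _ * _); exact: eq.
Unshelve. all: by end_near.
Qed.

(** The path goes along [E1] and then along [E2], with the mean value theorem on each leg. *)
Lemma increment_approx U f q E1 E2 (d1 d2 A1 A2 e : R) : smooth_on U f ->
  (forall s, 0 <= s <= 1 -> [/\ U (q + s *: (d1 *: E1)),
      U (q + d1 *: E1 + s *: (d2 *: E2)),
      `|'D_E1 f (q + s *: (d1 *: E1)) - A1| <= e &
      `|'D_E2 f (q + d1 *: E1 + s *: (d2 *: E2)) - A2| <= e]) ->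
  `|f (q + d1 *: E1 + d2 *: E2) - f q - (A1 * d1 + A2 * d2)| <= e * (`|d1| + `|d2|).
Proof.
move=> sf H.
have [s sI es] := mvt_line (fun s (sI : 0 <= s <= 1) =>
  let: And4 U1 _ _ _ := H s sI in smooth_on_derivable (v := d1 *: E1) sf U1).
have [s' sI' es'] := mvt_line (fun s (sI : 0 <= s <= 1) =>
  let: And4 _ U1 _ _ := H s sI in smooth_on_derivable (v := d2 *: E2) sf U1).
have [U1 _ B1 _] := H _ sI; have [_ U2 _ B2] := H _ sI'.
rewrite (@derive_val _ _ _ _ _ _ _ (is_derive_dirZ d1 (smooth_on_derivable sf U1))) in es.
rewrite (@derive_val _ _ _ _ _ _ _ (is_derive_dirZ d2 (smooth_on_derivable sf U2))) in es'.
have gen (x1 x2 y1 y2 y3 : R) : y3 - y2 = d1 * x1 -> y1 - y3 = d2 * x2 ->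
    `|x1 - A1| <= e -> `|x2 - A2| <= e ->
    `|y1 - y2 - (A1 * d1 + A2 * d2)| <= e * (`|d1| + `|d2|).
  move=> e1 e2 C1 C2.
  have -> : y1 - y2 - (A1 * d1 + A2 * d2) = (x1 - A1) * d1 + (x2 - A2) * d2 by lra.
  apply: le_trans (ler_normD _ _) _.
  by rewrite !normrM mulrDr lerD// ler_wpM2r.
exact: gen es es' B1 B2.
Qed.

Lemma segment_ball (p0 z v : V) (r x : R) : `|z - p0| <= r -> `|z + v - p0| <= r ->
  0 <= x <= 1 -> `|z + x *: v - p0| <= r.
Proof.
move=> h1 h2 /andP[x0 x1].
have -> : z + x *: v - p0 = (1 - x) *: (z - p0) + x *: (z + v - p0).
  rewrite [z + v - p0]addrAC (scalerDr x) addrA -scalerDl subrK scale1r.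
  by rewrite addrAC.
apply: le_trans (ler_normD _ _) _; rewrite !normrZ !ger0_norm ?subr_ge0//.
have -> : r = (1 - x) * r + x * r by ring.
by rewrite lerD// ler_wpM2l// subr_ge0.
Qed.

(** The passage between the two configurations is split in two: the relative position changes from t
    to t' with the centre of mass fixed at w, which gives the quadratic term; then the centre of
    mass is translated with t' fixed, which gives the linear terms. The intermediate particles may
    leave the ball of radius r, but the centre stays in it by convexity and the relative vector has
    length at most 2 r, whence the radius 3 r in the hypothesis on derivatives. *)
Lemma two_body_expansion U f p0 (r e : R) E1 E2 (A1 A2 A11 A12 A21 A22 : R)
    (a b t t' sg u d1 d2 : R) w E :
  open U -> smooth_on U f -> 0 < a -> 0 < b -> 0 < t -> 0 < t' ->
  sg ^+ 2 = 1 -> E = sg *: E1 + (sg * u) *: E2 ->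
  (forall p, `|p - p0| <= 3 * r -> U p /\
    [/\ `|'D_E1 f p - A1| <= e, `|'D_E2 f p - A2| <= e,
        `|'D_E1 ('D_E1 f) p - A11| <= e, `|'D_E1 ('D_E2 f) p - A12| <= e &
        `|'D_E2 ('D_E1 f) p - A21| <= e /\ `|'D_E2 ('D_E2 f) p - A22| <= e]) ->
  `|w + (b / (a + b) * t) *: E - p0| <= r ->
  `|w - (a / (a + b) * t) *: E - p0| <= r ->
  `|w + d1 *: E1 + d2 *: E2 + (b / (a + b) * t') *: E - p0| <= r ->
  `|w + d1 *: E1 + d2 *: E2 - (a / (a + b) * t') *: E - p0| <= r ->
  `|w + d1 *: E1 - p0| <= r ->
  `|a * f (w + d1 *: E1 + d2 *: E2 + (b / (a + b) * t') *: E) +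
    b * f (w + d1 *: E1 + d2 *: E2 - (a / (a + b) * t') *: E) -
    (a * f (w + (b / (a + b) * t) *: E) + b * f (w - (a / (a + b) * t) *: E)) -
    ((a + b) * (A1 * d1 + A2 * d2) +
     a * b / (a + b) / 2 * (t' ^+ 2 - t ^+ 2) * (A11 + u * (A12 + A21) + u ^+ 2 * A22))|
  <= e * ((a + b) * (`|d1| + `|d2|) + a * b / (a + b) * `|t' ^+ 2 - t ^+ 2| * (1 + u ^+ 2)).
Proof.
move=> oU sf a0 b0 t0 t'0 sg2 EE HB W1 W2 W3 W4 W5.
have ab0 : 0 < a + b by rewrite addr_gt0.
set a' := a / (a + b) in W1 W2 W3 W4 *; set b' := b / (a + b) in W1 W2 W3 W4 *.
have a'0 : 0 < a' by rewrite divr_gt0.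
have b'0 : 0 < b' by rewrite divr_gt0.
have ab1 : a' + b' = 1 by rewrite /a' /b'; field; lra.
have r0 : 0 <= r by exact: le_trans W5.
have e0 : 0 <= e.
  have : `|p0 - p0| <= 3 * r by rewrite subrr normr0 mulr_ge0.
  by move=> /HB[_ [h _ _ _ _]]; exact: le_trans h.
(* The relative vector is the difference of the two positions, and the centre of mass is their
   convex combination. *)
have tE z s : 0 < s -> `|z + (b' * s) *: E - p0| <= r -> `|z - (a' * s) *: E - p0| <= r ->
    s * `|E| <= 2 * r /\ `|z - p0| <= r.
  move=> s0 h1 h2; split.
    rewrite -[s]gtr0_norm// -normrZ.
    have -> : s *: E = (z + (b' * s) *: E - p0) - (z - (a' * s) *: E - p0).
      rewrite [- (z - _ - p0)]opprB addrA subrK opprD opprK addrACA subrr add0r.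
      by rewrite -scalerDl -mulrDl [b' + _]addrC ab1 mul1r.
    by apply: le_trans (ler_normB _ _) _; lra.
  have -> : z - p0 = a' *: (z + (b' * s) *: E - p0) + b' *: (z - (a' * s) *: E - p0).
    rewrite -!addrA !scalerDr addrACA -scalerDl ab1 scale1r; congr (_ + _).
    rewrite addrACA -scalerDl ab1 scale1r scalerN !scalerA.
    by rewrite (_ : a' * (b' * s) = b' * (a' * s)) ?subrr ?add0r//; ring.
  apply: le_trans (ler_normD _ _) _.
  rewrite (normrZ a') (normrZ b') (gtr0_norm a'0) (gtr0_norm b'0).
  have -> : r = a' * r + b' * r by rewrite -mulrDl ab1 mul1r.
  by rewrite lerD// ler_wpM2l// ltW.
have [tE1 Wp] := tE _ _ t0 W1 W2; have [tE2 Wp'] := tE _ _ t'0 W3 W4.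
have near3 z s (x : R) : `|z - p0| <= r -> s * `|E| <= 2 * r -> - s <= x <= s ->
    `|z + x *: E - p0| <= 3 * r.
  move=> hz hs; rewrite -ler_norml => hx.
  rewrite addrAC; apply: le_trans (ler_normD _ _) _; rewrite normrZ.
  have : `|x| * `|E| <= s * `|E| by rewrite ler_wpM2r.
  by lra.
pose F z s := a * f (z + (b' * s) *: E) + b * f (z - (a' * s) *: E).
have radial s s' : 0 < s -> s < s' -> s' * `|E| <= 2 * r ->
  `|F w s' - F w s - a * b / (a + b) / 2 * (s' ^+ 2 - s ^+ 2) * (A11 + u * (A12 + A21) + u ^+ 2 * A22)| <=
  e * (a * b / (a + b) * `|s' ^+ 2 - s ^+ 2| * (1 + u ^+ 2)).
  move=> s0 ss' sE.
  have s'0 : 0 < s' by exact: lt_trans ss'.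
  have := @two_body_radial U f w E a b s s' (A11 + u * (A12 + A21) + u ^+ 2 * A22)
    (2 * e * (1 + u ^+ 2)) oU sf a0 b0 s0 ss' _ (F w) erefl.
  move=> /(_ _)/le_trans; apply; last by apply: le_of_eq; field; lra.
  move=> x xI.
  have xs : - s' <= x <= s'.
    have h1 : a' * s' <= s' by rewrite ler_piMl// ltW//; lra.
    have h2 : b' * s' <= s' by rewrite ler_piMl// ltW//; lra.
    by case/andP: xI => h3 h4; apply/andP; split; rewrite -/a' -/b' in h3 h4; lra.
  have [Ux [_ _ B11 B12 [B21 B22]]] := HB _ (near3 _ _ _ Wp sE xs).
  split => //; rewrite EE (derive_derive_dir E1 E2 sg (sg * u) oU sf); last by rewrite -EE.
  rewrite -EE.
  exact: quadratic_form_approx.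
have radial' : `|F w t' - F w t - a * b / (a + b) / 2 * (t' ^+ 2 - t ^+ 2) * (A11 + u * (A12 + A21) + u ^+ 2 * A22)| <=
  e * (a * b / (a + b) * `|t' ^+ 2 - t ^+ 2| * (1 + u ^+ 2)).
  have [tt'|tt'|->] := ltgtP t t'.
  - exact: radial.
  - have h := radial _ _ t'0 tt' tE1; rewrite (distrC (t ^+ 2)) in h.
    by rewrite -[X in X <= _]normrN; apply: le_trans h; apply: le_of_eq; congr (`|_|); ring.
  - by rewrite !subrr mulr0 mul0r subrr !normr0 mulr0 mul0r mulr0.
(* Both particles move by the same vector. The corner of the path is [w + d1 *: E1], whose position
   is a separate hypothesis because it belongs to neither configuration. *)
have trans x : - t' <= x <= t' ->
  `|f (w + d1 *: E1 + d2 *: E2 + x *: E) - f (w + x *: E) - (A1 * d1 + A2 * d2)| <= e * (`|d1| + `|d2|).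
  move=> xt.
  have -> : w + d1 *: E1 + d2 *: E2 + x *: E = w + x *: E + d1 *: E1 + d2 *: E2.
    by rewrite addrAC [w + d1 *: E1 + x *: E]addrAC.
  apply: (increment_approx sf) => s sI.
  have n1 := near3 _ _ _ (segment_ball Wp W5 sI) tE2 xt.
  have n2 := near3 _ _ _ (segment_ball W5 Wp' sI) tE2 xt.
  have [U1 [B1 _ _ _ _]] := HB _ n1; have [U2 [_ B2 _ _ _]] := HB _ n2.
  have q1 : w + x *: E + s *: (d1 *: E1) = w + s *: (d1 *: E1) + x *: E by rewrite addrAC.
  have q2 : w + x *: E + d1 *: E1 + s *: (d2 *: E2) = w + d1 *: E1 + s *: (d2 *: E2) + x *: E.
    by rewrite [w + x *: E + _]addrAC [LHS]addrAC.
  by rewrite q1 q2; split.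
have x1 : - t' <= b' * t' <= t'.
  by have : b' * t' <= t' by [rewrite ler_piMl// ltW//; lra]; have : 0 < b' * t' by [rewrite mulr_gt0]; lra.
have x2 : - t' <= - (a' * t') <= t'.
  by have : a' * t' <= t' by [rewrite ler_piMl// ltW//; lra]; have : 0 < a' * t' by [rewrite mulr_gt0]; lra.
have T1 := trans _ x1; have T2 := trans _ x2; rewrite !scaleNr in T2.
move: T1 T2 radial'; rewrite /F.
move: (f (_ + _)) (f (_ - _)) (f (w + (b' * t') *: E)) (f (w - (a' * t') *: E)) (f (w + (b' * t) *: E)) (f (w - (a' * t) *: E)).
move=> y1 y2 y3 y4 y5 y6 T1 T2 T3.
set M := (a * b / (a + b) / 2 * _ * _) in T3 *.
have -> : a * y1 + b * y2 - (a * y5 + b * y6) - ((a + b) * (A1 * d1 + A2 * d2) + M) =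
  a * (y1 - y3 - (A1 * d1 + A2 * d2)) + b * (y2 - y4 - (A1 * d1 + A2 * d2)) + (a * y3 + b * y4 - (a * y5 + b * y6) - M) by ring.
apply: le_trans (ler_normD _ _) _; rewrite (mulrDr e) lerD//.
apply: le_trans (ler_normD _ _) _; rewrite !normrM (gtr0_norm a0) (gtr0_norm b0).
by rewrite (mulrCA e) (mulrDl a) lerD// ler_wpM2l// ltW.
Qed.

End Calculus.

(** * Families of functions with derivatives bounded uniformly in an index *)

Section BoundedFamilies.
Context {R : realType} {I : Type}.
Variable D : set R.
Implicit Types (f g : I -> R -> R).

(** One constant per order serves all indices. The index will later carry every parameter of the
    oscillatory integral, so that no estimate depends on them. *)
Fixpoint bounded_family (n : nat) f : Prop :=
  (exists M : R, forall i x, D x -> `|f i x| <= M) /\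
  match n with
  | 0%N => True
  | m.+1 => exists2 f' : I -> R -> R,
      forall i x, D x -> is_derive x 1 (f i) (f' i x) & bounded_family m f'
  end.

Lemma bounded_family_le n f : bounded_family n f ->
  exists M : R, forall i x, D x -> `|f i x| <= M.
Proof. by case: n => [|n] []. Qed.

Lemma bounded_familyS n f : bounded_family n.+1 f -> bounded_family n f.
Proof.
elim: n f => [|n IH] f [fM [f' df bf']]; first by split.
by split => //; exists f' => //; exact: IH.
Qed.

Lemma bounded_family1 n f : bounded_family n.+1 f -> bounded_family 1 f.
Proof. by elim: n => // n IH /bounded_familyS. Qed.

Lemma bounded_familyD n f g : bounded_family n f -> bounded_family n g ->
  bounded_family n (fun i x => f i x + g i x).
Proof.
have bD f1 g1 : (exists M : R, forall i x, D x -> `|f1 i x| <= M) ->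
    (exists M : R, forall i x, D x -> `|g1 i x| <= M) ->
    exists M : R, forall i x, D x -> `|f1 i x + g1 i x| <= M.
  move=> [M HM] [N HN]; exists (M + N) => i x Dx.
  by rewrite (le_trans (ler_normD _ _))// lerD ?HM ?HN.
elim: n f g => [|n IH] f g.
  by move=> [bf _] [bg _]; split => //; exact: bD.
move=> [bf [f' df bf']] [bg [g' dg bg']]; split; first exact: bD.
exists (fun i x => f' i x + g' i x); last exact: IH.
by move=> i x Dx; apply: is_deriveDf; [exact: df|exact: dg].
Qed.

Lemma bounded_familyM n f g : bounded_family n f -> bounded_family n g ->
  bounded_family n (fun i x => f i x * g i x).
Proof.
have bM f1 g1 : (exists M : R, forall i x, D x -> `|f1 i x| <= M) ->
    (exists M : R, forall i x, D x -> `|g1 i x| <= M) ->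
    exists M : R, forall i x, D x -> `|f1 i x * g1 i x| <= M.
  move=> [M HM] [N HN]; exists (M * N) => i x Dx.
  by rewrite normrM ler_pM// ?HM ?HN.
elim: n f g => [|n IH] f g.
  by move=> [bf _] [bg _]; split => //; exact: bM.
move=> bf0 bg0; move: (bf0) (bg0) => [bf [f' df bf']] [bg [g' dg bg']].
split; first exact: bM.
exists (fun i x => f i x * g' i x + g i x * f' i x).
  by move=> i x Dx; apply: is_deriveMf; [exact: df|exact: dg].
by apply: bounded_familyD; apply: IH => //; exact: bounded_familyS.
Qed.

Lemma bounded_familyN n f : bounded_family n f ->
  bounded_family n (fun i x => - f i x).
Proof.
elim: n f => [|n IH] f; move=> [[M HM] H]; split;
  try by exists M => i x Dx; rewrite normrN HM.
  by [].
case: H => f' df bf'; exists (fun i x => - f' i x); last exact: IH.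
by move=> i x Dx; apply: is_deriveN; exact: df.
Qed.

(** The derivative of 1/f is -f' (1/f)^2, so the induction closes under products; the lower bound
    [c] is needed only for the order-zero estimate. *)
Lemma bounded_familyV n f (c : R) : 0 < c -> (forall i x, D x -> c <= `|f i x|) ->
  bounded_family n f -> bounded_family n (fun i x => (f i x)^-1).
Proof.
move=> c0 fc.
have bV : exists M : R, forall i x, D x -> `|(f i x)^-1| <= M.
  exists c^-1 => i x Dx; rewrite normfV lef_pV2 ?fc// posrE//.
  exact: lt_le_trans (fc _ _ Dx).
elim: n => [|n IH] bf; first by split.
have [_ [f' df bf']] := bf.
split => //; exists (fun i x => - f' i x * ((f i x)^-1 * (f i x)^-1)); last first.
  apply: bounded_familyM; first exact: bounded_familyN.
  by apply: bounded_familyM; apply: IH; exact: bounded_familyS.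
move=> i x Dx.
have fn0 : f i x != 0 by rewrite -normr_gt0 (lt_le_trans c0)// fc.
have := is_deriveV fn0 (df i x Dx).
by rewrite -[_ *: _]/(_ * _) !mulNr [in f' i x * _]mulrC -invfM -expr2.
Qed.

End BoundedFamilies.

(** * Non-stationary phase in one variable *)

Section NonStationaryPhase.
Context {R : realType} {I : Type}.
Variables (A B a b a0 b0 : R) (La : I -> R) (th rho : I -> R -> R) (c : R).
Hypotheses (Aa : A < a) (ab : a < b) (bB : b < B) (aa0 : a < a0) (b0b : b0 < b) (c0 : 0 < c).
Let D : set R := [set` `]A, B[ ].
Hypothesis dth : forall i x, D x -> is_derive x 1 (th i) (La i * rho i x).
Hypothesis rho_ge : forall i x, D x -> c <= `|rho i x|.
Hypothesis rho_bd : forall n, bounded_family D n rho.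
Notation mu := (@lebesgue_measure R).

Let abD x : x \in `[a, b] -> D x.
Proof.
rewrite /D /= !in_itv /= => /andP[ax xb].
by rewrite (lt_le_trans Aa ax) (le_lt_trans xb bB).
Qed.

Lemma bounded_family_continuous (f : I -> R -> R) : bounded_family D 1 f ->
  forall i, {within `[a, b], continuous (f i)}.
Proof.
move=> [_ [f' df _]] i; apply: derivable_within_continuous => x /abD Dx.
exact: (@ex_derive _ _ _ _ _ _ _ (df i x Dx)).
Qed.

(** Each integration by parts divides the amplitude by [rho], differentiates it, and gains one
    factor 1 / [La i]. The boundary terms vanish because the amplitude lives on [a0, b0] inside ]a,
    b[; the larger interval ]A, B[ makes all derivatives two-sided at a and b. One derivative more
    than N is asked for since the case N = 0 still needs a continuous integrand. *)
Lemma nonstationary_phase N (f : I -> R -> R) :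
  bounded_family D N.+1 f ->
  (forall i x, D x -> x \notin `[a0, b0] -> f i x = 0) ->
  exists C : R, forall i, 0 < La i ->
    `|\int[mu]_(x in `[a, b]) (cos (th i x) * f i x)| <= C * La i ^- N /\
    `|\int[mu]_(x in `[a, b]) (sin (th i x) * f i x)| <= C * La i ^- N.
Proof.
have cM (f1 f2 : R -> R) : {within `[a, b], continuous f1} -> {within `[a, b], continuous f2} ->
    {within `[a, b], continuous (fun x => f1 x * f2 x)}.
  by move=> c1 c2 x; apply: continuousM; [exact: c1|exact: c2].
have cth i : {within `[a, b], continuous (th i)}.
  apply: derivable_within_continuous => x /abD Dx.
  exact: (@ex_derive _ _ _ _ _ _ _ (dth i Dx)).
have ccos i : {within `[a, b], continuous (fun x => cos (th i x))}.
  by move=> x; apply: continuous_comp; [exact: cth|exact: continuous_cos].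
have csin i : {within `[a, b], continuous (fun x => sin (th i x))}.
  by move=> x; apply: continuous_comp; [exact: cth|exact: continuous_sin].
elim: N f => [|N IH] f bf f0.
  have [M HM] := bounded_family_le bf.
  exists (M * (b - a)) => i _; rewrite expr0 invr1 mulr1.
  have cf := @bounded_family_continuous _ bf i.
  have est (g : R -> R) : {within `[a, b], continuous g} -> (forall x, `|g x| <= 1) ->
      `|\int[mu]_(x in `[a, b]) (g x * f i x)| <= M * (b - a).
    move=> cg g1.
    have ig : mu.-integrable `[a, b] (EFin \o (fun x => g x * f i x)).
      apply: continuous_compact_integrable; first exact: segment_compact.
      by move=> x; apply: continuousM; [exact: cg|exact: cf].
    apply: le_trans (le_normr_Rintegral _ ig) _ => //.
    have -> : M * (b - a) = \int[mu]_(x in `[a, b]) M.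
      by rewrite Rintegral_cst//= lebesgue_measure_itv/= lte_fin ab.
    apply: le_Rintegral => //.
    - exact: integrable_norm.
    - by apply: continuous_compact_integrable; [exact: segment_compact|move=> x; exact: cst_continuous].
    - move=> x xab; rewrite normrM -[M]mul1r ler_pM// ?g1// HM//; exact: abD.
  split; [apply: (est (fun x => cos (th i x))) | apply: (est (fun x => sin (th i x)))] => // x.
    by rewrite ler_norml cos_geN1 cos_le1.
  by rewrite ler_norml sin_geN1 sin_le1.
have rn0 i x : D x -> rho i x != 0.
  by move=> Dx; rewrite -normr_gt0 (lt_le_trans c0)// rho_ge.
(* cos th times f equals h / La times the derivative of sin th, and similarly with sin and -cos. *)
pose h i x := f i x * (rho i x)^-1.
have bh : bounded_family D N.+2 h.
  by apply: bounded_familyM => //; exact: bounded_familyV c0 rho_ge (rho_bd _).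
have [_ [h' dh bh']] := bh.
have h0 i x : D x -> x \notin `[a0, b0] -> h i x = 0.
  by move=> Dx /f0; rewrite /h => -> //; rewrite mul0r.
(* Lying outside the closed interval is an open condition, so [h i] is zero near such a point and
   the support passes to the derivative. *)
have h'0 i x : D x -> x \notin `[a0, b0] -> h' i x = 0.
  move=> Dx xab; have := dh i x Dx; have -> : h' i x = 'D_1 (h i) x.
    by rewrite (@derive_val _ _ _ _ _ _ _ (dh i x Dx)).
  move=> _; rewrite (@near_eq_derive _ _ _ _ (cst 0)) ?derive_cst//.
  have : \forall y \near x, D y /\ ~ `[a0, b0]%classic y.
    have o1 : open D by exact: interval_open.
    have o2 : open (~` `[a0, b0]%classic) by apply: closed_openC; exact: interval_closed.
    by near=> y; split; near: y; apply: open_nbhs_nbhs; split => //=; apply/negP.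
  apply: filterS => y [Dy yab]; rewrite h0//.
  by apply/negP.
have [C HC] := IH h' bh' h'0.
exists C => i L0.
have [HC1 HC2] := HC i L0.
have dh1 := bounded_familyS bh.
have ch : {within `[a, b], continuous (h i)}.
  by apply: bounded_family_continuous; exact: bounded_family1 dh1.
have ch' : {within `[a, b], continuous (h' i)}.
  by apply: bounded_family_continuous; exact: (@bounded_family1 _ _ _ N h' bh').
have crho := @bounded_family_continuous _ (rho_bd 1) i.
have Dab x : x \in `]a, b[ -> D x by move=> /subset_itv_oo_cc /abD.
have bd : D a /\ D b by split; apply: abD; rewrite in_itv /= lexx ltW.
have ha : h i a = 0.
  by apply: h0; [case: bd|rewrite in_itv /= leNgt aa0].
have hb : h i b = 0.
  by apply: h0; [case: bd|rewrite in_itv /= [b <= b0]leNgt b0b andbF].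
have dcos x : D x -> is_derive x 1 (fun x => - cos (th i x)) (sin (th i x) * (La i * rho i x)).
  move=> Dx; rewrite -[sin _]opprK mulNr; apply: is_deriveN.
  exact: (@is_derive1_comp _ cos (th i) _ _ _ (is_derive_cos _) (dth i Dx)).
have dsin x : D x -> is_derive x 1 (fun x => sin (th i x)) (cos (th i x) * (La i * rho i x)).
  move=> Dx.
  exact: (@is_derive1_comp _ sin (th i) _ _ _ (is_derive_sin _) (dth i Dx)).
have LR (f1 f1' : R -> R) : (forall x, D x -> is_derive x 1 f1 (f1' x)) ->
    derivable_oo_LRcontinuous f1 a b /\ {in `]a, b[, derive1 f1 =1 f1'}.
  move=> df1; split; last first.
    by move=> x /Dab Dx; rewrite derive1E (@derive_val _ _ _ _ _ _ _ (df1 x Dx)).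
  have cf1 x : D x -> {for x, continuous f1}.
    move=> Dx; apply: differentiable_continuous; apply/derivable1_diffP.
    exact: (@ex_derive _ _ _ _ _ _ _ (df1 x Dx)).
  split.
  - by move=> x /Dab Dx; exact: (@ex_derive _ _ _ _ _ _ _ (df1 x Dx)).
  - by apply: cvg_at_right_filter; apply: cf1; case: bd.
  - by apply: cvg_at_left_filter; apply: cf1; case: bd.
have [hLR hE] := LR _ _ (dh i).
have key (g G : R -> R) : {within `[a, b], continuous g} ->
   (forall x, D x -> is_derive x 1 G (g x * (La i * rho i x))) ->
   `|\int[mu]_(x in `[a, b]) (h' i x * G x)| <= C * La i ^- N ->
   `|\int[mu]_(x in `[a, b]) (g x * f i x)| <= C * La i ^- N.+1.
  move=> cg dG HG.
  have [GLR GE] := LR _ _ dG.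
  have cgr : {within `[a, b], continuous (fun x => g x * (La i * rho i x))}.
    apply: (cM) => //; apply: (cM) => // x; exact: cst_continuous.
  have := Rintegration_by_parts ab ch' hLR hE cgr GLR GE.
  rewrite ha hb !mul0r subrr sub0r => E.
  have -> : \int[mu]_(x in `[a, b]) (g x * f i x) =
     (La i)^-1 * \int[mu]_(x in `[a, b]) (h i x * (g x * (La i * rho i x))).
    rewrite -RintegralZl//; last first.
      apply: continuous_compact_integrable; first exact: segment_compact.
      by move=> x; apply: continuousM; [exact: ch|exact: cgr].
    apply: eq_Rintegral => x; rewrite inE/= => /abD Dx.
    rewrite /h; field; rewrite rn0//= gt_eqF//.
  have Li : 0 <= (La i)^-1 by rewrite invr_ge0 ltW.
  by rewrite E normrM normrN exprS invfM [C * _]mulrCA (ger0_norm Li) ler_wpM2l.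
split.
- apply: (key (fun x => cos (th i x)) (fun x => sin (th i x))) => //.
  by under eq_Rintegral do rewrite mulrC.
- apply: (key (fun x => sin (th i x)) (fun x => - cos (th i x))) => //.
  under eq_Rintegral do rewrite mulrN mulrC -mulN1r.
  rewrite RintegralZl ?mulN1r ?normrN//.
  apply: continuous_compact_integrable; first exact: segment_compact.
  by move=> x; apply: continuousM; [exact: ccos|exact: ch'].
Unshelve. all: by end_near.
Qed.

End NonStationaryPhase.

(** * Measurability of Caratheodory functions, and of continuous functions on products *)

Section Caratheodory.
Context {R : realType} d (T : measurableType d).

(** The second variable is rounded down to a multiple of 1/(n+1). The resulting function is a
    countable patchwork of functions of the first variable, hence measurable, and by continuity in
    the second variable it converges to f. *)
Lemma caratheodory_measurable (f : T * R -> R) :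
  (forall y, measurable_fun setT (fun t => f (t, y))) ->
  (forall t, continuous (fun y => f (t, y))) -> measurable_fun setT f.
Proof.
move=> mf cf.
pose q (n : nat) (y : R) : R := (Num.floor (n.+1%:R * y))%:~R / n.+1%:R.
have qcvg y : (fun n => q n y) @ \oo --> y.
  apply/cvgrPdist_lt => e e0.
  near=> n.
  have n0 : 0 < n.+1%:R :> R by rewrite ltr0n.
  have /andP[h1 h2] : (Num.floor (n.+1%:R * y))%:~R <= n.+1%:R * y < (Num.floor (n.+1%:R * y))%:~R + 1.
    by have := floor_itv (n.+1%:R * y); rewrite intrD.
  rewrite /q ger0_norm; last by rewrite subr_ge0 ler_pdivrMr// [y * _]mulrC.
  have h3 : n.+1%:R^-1 < e by near: n; exact: near_infty_natSinv_lt (PosNum e0).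
  have h4 : y < ((Num.floor (n.+1%:R * y))%:~R + 1) / n.+1%:R by rewrite ltr_pdivlMr// mulrC.
  by rewrite mulrDl mul1r in h4; rewrite ltrBlDl (lt_trans h4)// ltrD2l.
apply: (@measurable_realfun.measurable_fun_cvg _ _ _ _ (fun n p => f (p.1, q n p.2))); last first.
  move=> [t y] _ /= A nA; exact: (qcvg y _ (cf t y A nA)).
move=> n _ B mB; rewrite setTI.
have -> : (fun p => f (p.1, q n p.2)) @^-1` B =
   \bigcup_(k : int) (((fun t => f (t, k%:~R / n.+1%:R)) @^-1` B) `*`
      [set y : R | k%:~R <= n.+1%:R * y < k%:~R + 1]).
  apply/seteqP; split => [[t y] /= By|[t y] [k _ [/= Bt ky]]].
    exists (Num.floor (n.+1%:R * y)) => //; split => //=.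
    by have := floor_itv (n.+1%:R * y); rewrite intrD.
  rewrite /= /q; suff -> : Num.floor (n.+1%:R * y) = k by [].
  by apply: floor_def; rewrite intrD.
apply: countable_bigcupT_measurable => [|k].
  exact: countableP.
apply: measurableX; first by rewrite -[X in measurable X]setTI; exact: mf.
have n0 : 0 < n.+1%:R :> R by rewrite ltr0n.
rewrite (_ : [set y | _] = `[k%:~R / n.+1%:R, (k%:~R + 1) / n.+1%:R[%classic)//.
by apply/seteqP; split => y /=; rewrite in_itv /= ler_pdivrMr// ltr_pdivlMr// mulrC.
Unshelve. all: by end_near.
Qed.

End Caratheodory.

Section ContinuousMeasurable.
Context {R : realType}.

Lemma continuous_pairl (T1 T2 : topologicalType) (y : T2) :
  continuous (fun t : T1 => (t, y)).
Proof.
move=> x A [[B C] [/= Bx Cy] BC].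
apply: filterS Bx => t Bt; apply: BC; split => //=; exact: nbhs_singleton.
Qed.

Lemma continuous_pairr (T1 T2 : topologicalType) (x : T1) :
  continuous (fun t : T2 => (x, t)).
Proof.
move=> y A [[B C] [/= Bx Cy] BC].
apply: filterS Cy => t Ct; apply: BC; split => //=; exact: nbhs_singleton.
Qed.

Lemma continuous_sectionl (T1 T2 T3 : topologicalType) (f : T1 * T2 -> T3) y :
  continuous f -> continuous (fun t => f (t, y)).
Proof.
by move=> cf x A nA; exact: (continuous_pairl (cf (x, y) A nA)).
Qed.

Lemma continuous_sectionr (T1 T2 T3 : topologicalType) (f : T1 * T2 -> T3) x :
  continuous f -> continuous (fun t => f (x, t)).
Proof.
by move=> cf y A nA; exact: (continuous_pairr (cf (x, y) A nA)).
Qed.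

Lemma continuous_measurable_R2 (f : R2 R -> R) : continuous f ->
  measurable_fun [set: measurableTypeR R * measurableTypeR R] f.
Proof.
move=> cf; apply: (@caratheodory_measurable R _ (measurableTypeR R)) => [y|t].
  by apply: measurable_realfun.continuous_measurable_fun; exact: continuous_sectionl.
exact: continuous_sectionr.
Qed.

Lemma continuous_measurable_R3 (f : R3 R -> R) : continuous f ->
  measurable_fun [set: measurableTypeR R * measurableTypeR R * measurableTypeR R] f.
Proof.
move=> cf; apply: (@caratheodory_measurable R _ (measurableTypeR R * measurableTypeR R)%type) => [y|t].
  by apply: continuous_measurable_R2; exact: continuous_sectionl.
exact: continuous_sectionr.
Qed.

(** The last two real coordinates are added one at a time by the Caratheodory lemma; this requires
    reassociating the product, which is undone by a measurable map at the end. *)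
Lemma continuous_measurable_R3R2 (f : R3 R * R2 R -> R) : continuous f ->
  measurable_fun [set: (measurableTypeR R * measurableTypeR R * measurableTypeR R) *
     (measurableTypeR R * measurableTypeR R)] f.
Proof.
move=> cf.
pose MR := measurableTypeR R.
have m4 : forall y, measurable_fun [set: (MR * MR * MR) * MR] (fun p => f (p.1, (p.2, y))).
  move=> y.
  apply: (@caratheodory_measurable R _ (MR * MR * MR)%type) => [z|t] /=.
    by apply: continuous_measurable_R3; exact: continuous_sectionl.
  apply: (@continuous_sectionl _ _ _ (fun z => f (t, z))); exact: continuous_sectionr.
have m5 : measurable_fun [set: (MR * MR * MR) * MR * MR] (fun p => f (p.1.1, (p.1.2, p.2))).
  apply: (@caratheodory_measurable R _ ((MR * MR * MR) * MR)%type) => [z|t] /=; first exact: m4.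
  apply: (@continuous_sectionr _ _ _ (fun z => f (t.1, z))); exact: continuous_sectionr.
have ma : measurable_fun [set: (MR * MR * MR) * (MR * MR)] (fun p => ((p.1, p.2.1), p.2.2)).
  apply: measurable_fun_pair; last exact: (measurableT_comp measurable_snd measurable_snd).
  by apply: measurable_fun_pair => //; exact: (measurableT_comp measurable_fst measurable_snd).
have -> : f = (fun p => f (p.1.1, (p.1.2, p.2))) \o (fun p => ((p.1, p.2.1), p.2.2)).
  by apply/funext => -[x [y z]].
exact: measurableT_comp m5 ma.
Qed.

End ContinuousMeasurable.

(** * Affine substitutions in the Lebesgue integral *)

Section AffineChange.
Context {R : realType}.
Notation mu := (@lebesgue_measure R).
Notation MR := (measurableTypeR R).

Let affine (c e : R) : MR -> MR := fun x => c * x + e.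

Let maffine (c e : R) : measurable_fun [set: MR] (affine c e).
Proof.
by apply: measurable_funD; [apply: measurable_funM; [exact: measurable_cst|exact: measurable_id]|exact: measurable_cst].
Qed.

(** By uniqueness of the Lebesgue measure it suffices to compare on the intervals ]a, b]. For
    negative c the preimage is closed on the left and open on the right, which has the same
    length. *)
Lemma lebesgue_affine (c e : R) (A : set MR) : c != 0 -> measurable A ->
  mu A = (`|c|%:E * pushforward mu (affine c e) A)%E.
Proof.
move=> c0 mA.
pose k : {nonneg R} := NngNum (normr_ge0 c).
have -> : (`|c|%:E * pushforward mu (affine c e) A)%E =
   mscale k (pushforward mu (affine c e)) A by [].
apply: lebesgue_measure_unique => //= _ [[a b]] _ <- /=.
rewrite /mscale /= -[pushforward _ _ _]/(mu (affine c e @^-1` `]a, b])) lebesgue_measure_itv/= lte_fin.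
have [cp|cn] := ltP 0 c.
  have -> : affine c e @^-1` `]a, b] = `](a - e) / c, (b - e) / c]%classic.
    apply/seteqP; split => x /=; rewrite !in_itv /= ltr_pdivrMr// ler_pdivlMr// /affine;
    by rewrite ltrBlDr lerBrDr mulrC.
  rewrite lebesgue_measure_itv/= lte_fin ltr_pM2r ?invr_gt0// ltrD2r.
  case: ifPn => _; last by rewrite mule0.
  rewrite -!EFinB -EFinM gtr0_norm//; congr EFin; field.
  by rewrite gt_eqF.
have {}cn : c < 0 by rewrite lt_def cn eq_sym c0.
have -> : affine c e @^-1` `]a, b] = `[(b - e) / c, (a - e) / c[%classic.
  apply/seteqP; split => x /=; rewrite !in_itv /= ltr_ndivlMr// ler_ndivrMr// /affine;
  by rewrite lerBrDr ltrBlDr [c * x]mulrC andbC.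
rewrite lebesgue_measure_itv/= lte_fin ltr_nM2r ?invr_lt0// ltrD2r.
case: ifPn => _; last by rewrite mule0.
rewrite -!EFinB -EFinM ltr0_norm//; congr EFin; field.
by rewrite lt_eqF.
Qed.

Lemma ge0_integral_affine (c e : R) (f : MR -> \bar R) : c != 0 ->
  measurable_fun setT f -> (forall x, 0 <= f x)%E ->
  (\int[mu]_x f x = `|c|%:E * \int[mu]_x f (c * x + e)%R)%E.
Proof.
move=> c0 mf f0.
pose k : {nonneg R} := NngNum (normr_ge0 c).
rewrite (@eq_measure_integral _ _ _ _ (mscale k (pushforward mu (affine c e)))); last first.
  by move=> A mA _; exact: lebesgue_affine.
rewrite ge0_integral_mscale//; congr (_ * _)%E.
by rewrite ge0_integral_pushforward//; exact: maffine.
Qed.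

End AffineChange.

(** * Product measures, parametric integrals and tensor products *)

Section SigmaFiniteProduct.
Context d1 d2 (T1 : measurableType d1) (T2 : measurableType d2) (R : realType).
Variables (m1 : {sigma_finite_measure set T1 -> \bar R}) (m2 : {sigma_finite_measure set T2 -> \bar R}).

(** The product measure under a name of its own, so that it carries a sigma-finite structure and
    products can be iterated. *)
Definition sprod : set (T1 * T2) -> \bar R := (m1 \x m2)%E.

HB.instance Definition _ := Measure.copy sprod (m1 \x m2)%E.

Lemma sprod_sigma_finite : sigma_finite setT sprod.
Proof.
have /sigma_finiteP[F [F_cover F_mono F_fin]] := sigma_finiteT m1.
have /sigma_finiteP[G [G_cover G_mono G_fin]] := sigma_finiteT m2.
exists (fun n => F n `*` G n) => [|n].
  apply/esym/seteqP; split => // -[x y] _.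
  have [i _ Fx] : (\bigcup_i F i) x by rewrite -F_cover.
  have [j _ Gy] : (\bigcup_j G j) y by rewrite -G_cover.
  have /subsetPset Fij := F_mono _ _ (leq_maxl i j).
  have /subsetPset Gij := G_mono _ _ (leq_maxr i j).
  by exists (maxn i j) => //; split; [exact: Fij|exact: Gij].
have [mF Ffin] := F_fin n; have [mG Gfin] := G_fin n.
split; first exact: measurableX.
by rewrite /sprod product_measure1E// lte_mul_pinfty// ge0_fin_numE.
Qed.

HB.instance Definition _ := Measure_isSigmaFinite.Build _ _ _ sprod sprod_sigma_finite.
End SigmaFiniteProduct.

Section Measures.
Context {R : realType}.
Notation MR := (measurableTypeR R).
Definition lam2 : {sigma_finite_measure set (MR * MR)%type -> \bar R} :=
  sprod (@lebesgue_measure R) (@lebesgue_measure R).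
Definition lam3 : {sigma_finite_measure set (MR * MR * MR)%type -> \bar R} :=
  sprod lam2 (@lebesgue_measure R).
End Measures.

Section Parametric.
Context d1 d2 (X : measurableType d1) (Y : measurableType d2) (R : realType).
Variables (mu : {sigma_finite_measure set X -> \bar R})
          (nu : {sigma_finite_measure set Y -> \bar R}).

Lemma measurable_Rintegral (f : X * Y -> R) : measurable_fun setT f ->
  measurable_fun setT (fun x => \int[nu]_y f (x, y)).
Proof.
move=> mf.
have mF : measurable_fun setT (fun x => \int[nu]_y (f (x, y))%:E)%E.
  have mE : measurable_fun setT (EFin \o f) by apply/measurable_EFinP.
  have -> : (fun x => \int[nu]_y (f (x, y))%:E)%E =
     (fun x => fubini_F nu (EFin \o f)^\+%E x - fubini_F nu (EFin \o f)^\-%E x)%E.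
    apply/funext => x; rewrite integralE /= /fubini_F.
    by congr (_ - _)%E; apply: eq_integral => y _; rewrite ?funeposE ?funenegE.
  apply: emeasurable_funB; apply: measurable_fun_fubini_tonelli_F => //.
  - exact: measurable_funepos.
  - exact: measurable_funeneg.
exact: (measurableT_comp (fine_measurable measurableT) mF).
Qed.

Lemma integrable_tensor (f : X -> R) (g : Y -> R) :
  mu.-integrable setT (EFin \o f) -> nu.-integrable setT (EFin \o g) ->
  (sprod mu nu).-integrable setT (EFin \o (fun p => f p.1 * g p.2)) /\
  (\int[sprod mu nu]_p (f p.1 * g p.2)%:E =
   ((\int[mu]_x f x) * (\int[nu]_y g y))%:E)%E.
Proof.
move=> intf intg.
have mf : measurable_fun setT f by apply/measurable_EFinP; exact: measurable_int intf.
have mg : measurable_fun setT g by apply/measurable_EFinP; exact: measurable_int intg.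
have m : measurable_fun setT (EFin \o (fun p : X * Y => f p.1 * g p.2)).
  apply/measurable_EFinP; apply: measurable_funM.
    exact: (measurableT_comp mf measurable_fst).
  exact: (measurableT_comp mg measurable_snd).
have i : (sprod mu nu).-integrable setT (EFin \o (fun p => f p.1 * g p.2)).
  apply/(integrable12ltyP mu nu m) => /=.
  under eq_integral => x _.
    under eq_integral do rewrite normrM EFinM.
    rewrite ge0_integralZl//; last by apply/measurable_EFinP; exact: measurableT_comp.
    over.
  rewrite ge0_integralZr//.
  - have /integrableP[_ h1] := intf; have /integrableP[_ h2] := intg.
    by rewrite lte_mul_pinfty// ?integral_ge0// ge0_fin_numE// integral_ge0.
  - by apply/measurable_EFinP; exact: measurableT_comp.
  - exact: integral_ge0.
split => //.
rewrite /sprod -integral12_prod_meas1// /fubini_F /=.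
under eq_integral => x _.
  under eq_integral do rewrite EFinM.
  rewrite integralZl//.
  over.
have gE : (\int[nu]_y (g y)%:E = (\int[nu]_y g y)%:E)%E.
  by rewrite /Rintegral fineK//; exact: integrable_fin_num.
have fE : (\int[mu]_y (f y)%:E = (\int[mu]_y f y)%:E)%E.
  by rewrite /Rintegral fineK//; exact: integrable_fin_num.
by rewrite gE integralZr// fE EFinM.
Qed.

End Parametric.

(** * Integrals of functions supported in a box *)

Section BoxIntegrals.
Context {R : realType}.

Lemma integrable_bounded_supp d (T : measurableType d) (m : {measure set T -> \bar R})
    (G : T -> R) (A : set T) (c : R) : measurable A -> (m A < +oo)%E ->
  measurable_fun setT G -> (forall x, `|G x| <= c) -> (forall x, ~ A x -> G x = 0) ->
  m.-integrable setT (EFin \o G).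
Proof.
move=> mA fA mG Gc G0.
have mI : measurable_fun setT (fun x => (c * \1_A x)%:E).
  by apply/measurable_EFinP; apply: measurable_funM => //; exact: measurable_indic.
have i : m.-integrable setT (fun x => (c * \1_A x)%:E).
  have i1 : m.-integrable setT (EFin \o \1_A).
    apply/integrableP; split; first by apply/measurable_EFinP; exact: measurable_indic.
    have -> : (\int[m]_x `|(EFin \o \1_A) x| = \int[m]_x (\1_A x)%:E)%E.
      by apply: eq_integral => x _ /=; rewrite ger0_norm// indicE.
    by rewrite integral_indic// setIT.
  by have := integrableZl measurableT c i1.
apply: (le_integrable _ _ _ i) => //; first exact/measurable_EFinP.
move=> x _ /=; rewrite lee_fin indicE.
have [Ax|Ax] := pselect (A x).
  by rewrite mem_set// mulr1; apply: le_trans (Gc x) _; exact: ler_norm.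
by rewrite (G0 x Ax) normr0.
Qed.

(** Pointwise |h| <= h^2 + 1_D, so finite [tau]-mass of D turns square integrability into
    integrability. *)
Lemma L2_integrable d (T : measurableType d) (m : {measure set T -> \bar R})
    (D : set T) (tau h : T -> R) : measurable D -> measurable_fun setT tau ->
  (forall z, 0 <= tau z) -> (\int[m]_(z in D) (tau z)%:E < +oo)%E ->
  measurable_fun setT h -> (forall z, h z != 0 -> D z) ->
  (\int[m]_z (h z ^+ 2 * tau z)%:E < +oo)%E ->
  m.-integrable setT (EFin \o (fun z => h z * tau z)).
Proof.
move=> mD mtau tau0 tau_fin mh hD hfin.
have mDt : measurable_fun setT (fun z => \1_D z * tau z).
  by apply: measurable_funM => //; exact: measurable_indic.
have mht : measurable_fun setT (fun z => h z ^+ 2 * tau z).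
  by apply: measurable_funM => //; exact: measurable_funX.
have mhtau : measurable_fun setT (fun z => h z * tau z) by exact: measurable_funM.
have le z : `|h z * tau z| <= h z ^+ 2 * tau z + \1_D z * tau z.
  rewrite normrM (ger0_norm (tau0 z)) -mulrDl ler_wpM2r//.
  have [->|/hD Dz] := eqVneq (h z) 0.
    by rewrite normr0 expr0n/= add0r indicE; case: (_ \in _).
  rewrite indicE mem_set//= -real_normK ?num_real//.
  by have := sqr_ge0 (`|h z| - 1); have := normr_ge0 (h z); nra.
apply/integrableP; split; first exact/measurable_EFinP.
apply: le_lt_trans (_ : (\int[m]_z (h z ^+ 2 * tau z + \1_D z * tau z)%:E < +oo)%E).
  apply: ge0_le_integral => //.
  - by apply/measurable_EFinP; exact: measurableT_comp.
  - by apply/measurable_EFinP; exact: measurable_funD.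
  - by move=> z _; rewrite lee_fin.
under eq_integral do rewrite EFinD.
rewrite ge0_integralD//.
- have E : (\int[m]_(z in D) (tau z)%:E = \int[m]_z (\1_D z * tau z)%:E)%E.
    rewrite integral_mkcond; apply: eq_integral => z _; rewrite patchE indicE.
    by case: (z \in D); rewrite ?mul1r ?mul0r.
  by apply: lte_add_pinfty => //; rewrite -E.
- by move=> z _; rewrite lee_fin mulr_ge0 ?sqr_ge0//.
- exact/measurable_EFinP.
- by move=> z _; rewrite lee_fin mulr_ge0// indicE; case: (_ \in _).
- exact/measurable_EFinP.
Qed.

Lemma Rintegral_bounded_supp d (T : measurableType d) (m : {measure set T -> \bar R})
    (G : T -> R) (A : set T) (c V : R) : 0 <= c -> measurable A -> m A = V%:E ->
  measurable_fun setT G -> (forall x, `|G x| <= c) -> (forall x, ~ A x -> G x = 0) ->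
  `|\int[m]_x G x| <= c * V.
Proof.
move=> c0 mA VA mG Gc G0.
have fA : (m A < +oo)%E by rewrite VA ltry.
have i := integrable_bounded_supp mA fA mG Gc G0.
rewrite -lee_fin (EFin_normr_Rintegral measurableT i).
apply: le_trans (le_abse_integral _ measurableT (measurable_int _ i)) _.
have mI : measurable_fun setT (fun x => (\1_A x)%:E : \bar R).
  by apply/measurable_EFinP; exact: measurable_indic.
apply: (@le_trans _ _ (\int[m]_x (c%:E * (\1_A x)%:E))%E).
  apply: ge0_le_integral => //.
  - by apply/measurable_EFinP; exact: measurableT_comp.
  - exact: measurable_funeM.
  move=> x _ /=; rewrite lee_fin indicE.
  have [Ax|Ax] := pselect (A x); first by rewrite mem_set// mulr1.
  by rewrite (G0 x Ax) normr0 mulr_ge0.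
rewrite ge0_integralZl//.
by rewrite integral_indic// setIT VA EFinM.
Qed.

Lemma Rintegral_fubini12 d1 d2 (T1 : measurableType d1) (T2 : measurableType d2)
    (m1 : {sigma_finite_measure set T1 -> \bar R}) (m2 : {sigma_finite_measure set T2 -> \bar R})
    (F : T1 * T2 -> R) : (sprod m1 m2).-integrable setT (EFin \o F) ->
  (forall x, m2.-integrable setT (EFin \o (fun y => F (x, y)))) ->
  \int[sprod m1 m2]_p F p = \int[m1]_x \int[m2]_y F (x, y).
Proof.
move=> i ix; rewrite /Rintegral -(integral12_prod_meas1 i); congr fine.
apply: eq_integral => x _; rewrite fineK//; exact: integrable_fin_num (ix x).
Qed.

Lemma Rintegral_fubini21 d1 d2 (T1 : measurableType d1) (T2 : measurableType d2)
    (m1 : {sigma_finite_measure set T1 -> \bar R}) (m2 : {sigma_finite_measure set T2 -> \bar R})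
    (F : T1 * T2 -> R) : (sprod m1 m2).-integrable setT (EFin \o F) ->
  (forall y, m1.-integrable setT (EFin \o (fun x => F (x, y)))) ->
  \int[sprod m1 m2]_p F p = \int[m2]_y \int[m1]_x F (x, y).
Proof.
move=> i iy; rewrite /Rintegral -(integral21_prod_meas1 i); congr fine.
apply: eq_integral => y _; rewrite fineK//; exact: integrable_fin_num (iy y).
Qed.

Notation mu := (@lebesgue_measure R).
Notation MR := (measurableTypeR R).
Notation M2 := (MR * MR)%type.
Notation M3 := (MR * MR * MR)%type.

Lemma pairD (S T : zmodType) (x x' : S) (y y' : T) : (x, y) + (x', y') = (x + x', y + y').
Proof. by []. Qed.

Definition coord3 (y : R3 R) (a : 'I_3) : R := [:: y.1.1; y.1.2; y.2]`_a.

Lemma coord3D (y y' : R3 R) a : coord3 (y + y') a = coord3 y a + coord3 y' a.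
Proof. by rewrite /coord3; case: a => -[|[|[|//]]] i. Qed.

Lemma coord3Z (k : R) (y : R3 R) a : coord3 (k *: y) a = k * coord3 y a.
Proof. by rewrite /coord3; case: a => -[|[|[|//]]] i. Qed.

Lemma coord3_e3 a b : coord3 (e3 R a) b = (a == b)%:R.
Proof. by rewrite /coord3 /e3; case: a => -[|[|[|//]]] i; case: b => -[|[|[|//]]] j. Qed.

Lemma coord3_le (y : R3 R) a : `|coord3 y a| <= `|y|.
Proof.
rewrite /coord3 !prod_normE; case: a => -[|[|[|//]]] i /=; rewrite !le_max lexx ?orbT//.
Qed.

Lemma norm3_le (y : R3 R) (r : R) : (forall a, `|coord3 y a| <= r) -> `|y| <= r.
Proof.
move=> h; rewrite !prod_normE !ge_max.
by rewrite (h (@Ordinal 3 0 isT)) (h (@Ordinal 3 1 isT)) (h (@Ordinal 3 2 isT)).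
Qed.

Lemma norm_e3 a : `|e3 R a| <= 1.
Proof. by apply: norm3_le => b; rewrite coord3_e3; case: (a == b); rewrite ?normr1 ?normr0. Qed.

Section Box.
Variables (x0 : R3 R) (r : R).
Hypothesis r0 : 0 < r.

Definition seg (k : R) : set MR := `[k - r, k + r].
Definition box2 : set M2 := seg x0.1.1 `*` seg x0.1.2.
Definition box3 : set M3 := box2 `*` seg x0.2.

Lemma measurable_box2 : measurable box2. Proof. by apply: measurableX; exact: measurable_itv. Qed.

Lemma measurable_box3 : measurable box3.
Proof. by apply: measurableX; [exact: measurable_box2|exact: measurable_itv]. Qed.

Lemma lebesgue_seg k : mu (seg k) = (2 * r)%:E.
Proof.
rewrite /seg lebesgue_measure_itv /= lte_fin.
by rewrite ltrD2l gtrN// -EFinB; congr (_%:E); ring.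
Qed.

Lemma seg_fin k : (mu (seg k) < +oo)%E. Proof. by rewrite lebesgue_seg ltry. Qed.

Lemma lam2_box2 : lam2 box2 = ((2 * r) * (2 * r))%:E.
Proof.
rewrite EFinM -{1}(lebesgue_seg x0.1.1) -(lebesgue_seg x0.1.2).
by apply: product_measure1E; exact: measurable_itv.
Qed.

Lemma lam3_box3 : lam3 box3 = ((2 * r) * (2 * r) * (2 * r))%:E.
Proof.
rewrite EFinM -lam2_box2 -(lebesgue_seg x0.2).
by apply: product_measure1E; [exact: measurable_box2|exact: measurable_itv].
Qed.

Lemma box2_fin : (lam2 box2 < +oo)%E.
Proof. by rewrite lam2_box2 ltry. Qed.

Lemma box3_fin : (lam3 box3 < +oo)%E.
Proof. by rewrite lam3_box3 ltry. Qed.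

Lemma box3P x : `|x - x0| <= r -> box3 x.
Proof.
rewrite !prod_normE !ge_max !ler_norml /= => /andP[/andP[/andP[a b] /andP[c d]] /andP[e f]].
by split; [split|]; rewrite /seg /= in_itv /=; apply/andP; split; lra.
Qed.

Lemma box2P (e : M2) : `|e - x0.1| <= r <-> box2 e.
Proof.
rewrite prod_normE ge_max !ler_distl /box2 /seg /setX /= !in_itv /=.
by split => [/andP[]|[-> ->]].
Qed.

Lemma box2_L2_integrable (h : M2 -> R) : measurable_fun setT h ->
  (forall e, h e != 0 -> `|e - x0.1| <= r) ->
  (\int[lam2]_e (h e ^+ 2)%:E < +oo)%E -> lam2.-integrable setT (EFin \o h).
Proof.
move=> mh hs hfin.
have := @L2_integrable _ _ lam2 box2 (cst 1) h measurable_box2 _ _ _ mh.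
rewrite (_ : (fun z => h z * cst 1 z) = h); last by apply/funext => z; rewrite mulr1.
apply => //.
- by rewrite /= (integral_cst lam2 measurable_box2 1%:E) mul1e; exact: box2_fin.
- by move=> e /hs/box2P.
- by under eq_integral do rewrite mulr1.
Qed.

(** Fubini with the chosen axis innermost: each line contributes at most [e], and the lines that
    meet the box form a square of side 2 r. Base points are normalised to have coordinate zero on
    the axis, so that [v] is the true coordinate. *)
Lemma integral_axis_le (F : M3 -> R) (B e : R) a : measurable_fun setT F ->
  (forall x, `|F x| <= B) -> (forall x, F x != 0 -> `|x - x0| <= r) ->
  (forall y : R3 R, coord3 y a = 0 -> `|\int[mu]_v F (y + v *: e3 R a)| <= e) ->
  `|\int[lam3]_x F x| <= e * ((2 * r) * (2 * r)).
Proof.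
move=> mF FB Fs Fe.
have F0 x : ~ box3 x -> F x = 0.
  by move=> nx; apply: contra_notP nx => /eqP/Fs/box3P.
have i3 : (sprod lam2 mu).-integrable setT (EFin \o F).
  exact: (integrable_bounded_supp measurable_box3 box3_fin mF FB F0).
have ix e' : mu.-integrable setT (EFin \o (fun v => F (e', v))).
  apply: (@integrable_bounded_supp _ _ mu _ (seg x0.2) B).
  - exact: measurable_itv.
  - exact: seg_fin.
  - exact: (@measurable_fun_pair2 _ _ _ _ _ _ F e').
  - by [].
  - by move=> v nv; apply: F0 => -[].
have m1 v : measurable_fun setT (fun e' : M2 => F (e', v)).
  exact: (@measurable_fun_pair1 _ _ _ _ _ _ F v).
have F02 e' v : ~ box2 e' -> F (e', v) = 0 by move=> ne; apply: F0 => -[].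
have iy v : (sprod mu mu).-integrable setT (EFin \o (fun e' => F (e', v))).
  apply: (@integrable_bounded_supp _ _ (sprod mu mu) _ box2 B) => //.
  - exact: measurable_box2.
  - exact: box2_fin.
  - by move=> e'; exact: F02.
have swap : \int[lam3]_x F x = \int[mu]_v \int[sprod mu mu]_e' F (e', v).
  exact: (Rintegral_fubini21 i3 iy).
have mH : measurable_fun setT (fun v : MR => \int[sprod mu mu]_e' F (e', v)).
  have ms : measurable_fun setT (fun p : MR * M2 => F (p.2, p.1)).
    apply: (measurableT_comp mF).
    by apply: measurable_fun_pair; [exact: measurable_snd|exact: measurable_fst].
  exact: (@measurable_Rintegral _ _ MR M2 R (sprod mu mu) (fun p => F (p.2, p.1)) ms).
have e0 : 0 <= e.
  by apply: le_trans (Fe 0 _); rewrite ?normr_ge0// /coord3; case: a {Fe} => -[|[|[|//]]].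
have r2 : 0 <= 2 * r by rewrite mulr_ge0// ltW.
(* For the first two axes the third coordinate is the outermost variable and accounts for one factor
   2 r. *)
have ih : (forall v, `|\int[sprod mu mu]_e' F (e', v)| <= e * (2 * r)) ->
    `|\int[lam3]_x F x| <= e * ((2 * r) * (2 * r)).
  move=> h; rewrite swap mulrA.
  apply: (@Rintegral_bounded_supp _ _ mu _ (seg x0.2) (e * (2 * r)) (2 * r)) => //.
  + exact: mulr_ge0.
  + exact: measurable_itv.
  + exact: lebesgue_seg.
  + move=> v nv; rewrite /Rintegral (_ : (\int[_]_e' _)%E = 0)//.
    by apply: integral0_eq => e' _; rewrite F0// => -[].
have m2 v e1 : measurable_fun setT (fun e2 : MR => F (e1, e2, v)).
  exact: (@measurable_fun_pair2 _ _ _ _ _ _ _ e1 (m1 v)).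
have m3 v e2 : measurable_fun setT (fun e1 : MR => F (e1, e2, v)).
  exact: (@measurable_fun_pair1 _ _ _ _ _ _ _ e2 (m1 v)).
have i1 v e1 : mu.-integrable setT (EFin \o (fun e2 => F (e1, e2, v))).
  apply: (@integrable_bounded_supp _ _ mu _ (seg x0.1.2) B) => //.
  - exact: measurable_itv.
  - exact: seg_fin.
  - by move=> e2 ne; apply: F02 => -[].
have i2 v e2 : mu.-integrable setT (EFin \o (fun e1 => F (e1, e2, v))).
  apply: (@integrable_bounded_supp _ _ mu _ (seg x0.1.1) B) => //.
  - exact: measurable_itv.
  - exact: seg_fin.
  - by move=> e1 ne; apply: F02 => -[].
have eZ (v : R) a' : v *: e3 R a' = (v * (a' == 0)%:R, v * (a' == 1)%:R, v * (a' == 2%:R)%:R) by [].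
case: a Fe => -[|[|[|//]]] i Fe.
- apply: ih => v; rewrite (Rintegral_fubini21 (iy v) (i2 v)).
  apply: (@Rintegral_bounded_supp _ _ mu _ (seg x0.1.2) e (2 * r)) => //.
  + exact: measurable_itv.
  + exact: lebesgue_seg.
  + apply: (@measurable_Rintegral _ _ MR MR R mu (fun p => F (p.2, p.1, v))).
    apply: (measurableT_comp (m1 v)).
    by apply: measurable_fun_pair; [exact: measurable_snd|exact: measurable_fst].
  + move=> e2; have := Fe (0, e2, v) erefl.
    by under eq_Rintegral do rewrite eZ /= !pairD /= mulr1 !mulr0 add0r !addr0.
  + move=> e2 ne; rewrite /Rintegral (_ : (\int[_]_e' _)%E = 0)//.
    by apply: integral0_eq => e' _; rewrite F02// => -[].
- apply: ih => v; rewrite (Rintegral_fubini12 (iy v) (i1 v)).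
  apply: (@Rintegral_bounded_supp _ _ mu _ (seg x0.1.1) e (2 * r)) => //.
  + exact: measurable_itv.
  + exact: lebesgue_seg.
  + exact: (@measurable_Rintegral _ _ MR MR R mu (fun p => F (p, v)) (m1 v)).
  + move=> e1; have := Fe (e1, 0, v) erefl.
    by under eq_Rintegral do rewrite eZ /= !pairD /= mulr1 !mulr0 add0r !addr0.
  + move=> e1 ne; rewrite /Rintegral (_ : (\int[_]_e' _)%E = 0)//.
    by apply: integral0_eq => e' _; rewrite F02// => -[].
- rewrite (Rintegral_fubini12 i3 ix).
  apply: (Rintegral_bounded_supp e0 measurable_box2 lam2_box2).
  + exact: (@measurable_Rintegral _ _ M2 MR R mu F mF).
  + move=> e'; have := Fe (e', 0) erefl.
    by under eq_Rintegral do rewrite eZ /= !pairD /= mulr1 !mulr0 add0r !addr0.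
  + move=> e' ne; rewrite /Rintegral (_ : (\int[_]_e' _)%E = 0)//.
    by apply: integral0_eq => v _; rewrite F02.
Qed.

End Box.
End BoxIntegrals.

(** * Schur's test with a weight in place of the kernel *)

Section Schur.
Context d1 d2 (X : measurableType d1) (Z : measurableType d2) (R : realType).
Variables (mu : {sigma_finite_measure set X -> \bar R})
          (rho : {sigma_finite_measure set Z -> \bar R}).
Variables (k1 k2 : X * Z -> R) (G tau : Z -> R) (X0 : set X) (Z0 : set Z)
          (W : Z * Z -> R) (B M : R).
Hypotheses (mk1 : measurable_fun setT k1) (mk2 : measurable_fun setT k2)
  (mG : measurable_fun setT G) (mtau : measurable_fun setT tau)
  (mX0 : measurable X0) (mZ0 : measurable Z0) (mW : measurable_fun setT W)
  (X0fin : (mu X0 < +oo)%E)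
  (tau_ge0 : forall z, 0 <= tau z) (tau_fin : (\int[rho]_(z in Z0) (tau z)%:E < +oo)%E)
  (G0 : forall z, G z != 0 -> Z0 z)
  (kB : forall x z, `|k1 (x, z)| <= B /\ `|k2 (x, z)| <= B)
  (k0 : forall x z, ~ X0 x -> k1 (x, z) = 0 /\ k2 (x, z) = 0)
  (W_ge0 : forall p, 0 <= W p) (W_sym : forall z z', W (z, z') = W (z', z))
  (M_gt0 : 0 < M)
  (KW : forall z z', G z * tau z != 0 -> G z' * tau z' != 0 ->
    `|\int[mu]_x (k1 (x, z) * k1 (x, z') + k2 (x, z) * k2 (x, z'))| <= W (z, z'))
  (WM : forall z, (\int[rho]_z' (W (z, z') * tau z')%:E <= M%:E)%E).

Let g z := G z * tau z.
Let S1 x := \int[rho]_z (k1 (x, z) * g z).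
Let S2 x := \int[rho]_z (k2 (x, z) * g z).

Let Q : \bar R := (\int[rho]_z ((G z) ^+ 2 * tau z)%:E)%E.

Let mg : measurable_fun setT g. Proof. exact: measurable_funM. Qed.

Let intg : (Q < +oo)%E -> rho.-integrable setT (EFin \o g).
Proof. by move=> Qfin; exact: (L2_integrable mZ0 mtau tau_ge0 tau_fin mG G0 Qfin). Qed.

Let intX0 : mu.-integrable setT (EFin \o \1_X0).
Proof.
apply: (@integrable_bounded_supp _ _ _ mu \1_X0 X0 1) => //.
- by move=> x; rewrite indicE; case: (_ \in _); rewrite ?normr1 ?normr0.
- by move=> x nX; rewrite indicE memNset.
Qed.

Let H (j : X * Z -> R) (p : X * (Z * Z)) : R := j (p.1, p.2.1) * j (p.1, p.2.2) * (g p.2.1 * g p.2.2).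

Let mH j : measurable_fun setT j -> measurable_fun setT (H j).
Proof.
move=> mj.
have m1 : measurable_fun setT (fun p : X * (Z * Z) => (p.1, p.2.1)).
  apply: measurable_fun_pair; first exact: measurable_fst.
  exact: (measurableT_comp measurable_fst measurable_snd).
have m2 : measurable_fun setT (fun p : X * (Z * Z) => (p.1, p.2.2)).
  apply: measurable_fun_pair; first exact: measurable_fst.
  exact: (measurableT_comp measurable_snd measurable_snd).
apply: measurable_funM; apply: measurable_funM.
- exact: (measurableT_comp mj m1).
- exact: (measurableT_comp mj m2).
- exact: (measurableT_comp mg (measurableT_comp measurable_fst measurable_snd)).
- exact: (measurableT_comp mg (measurableT_comp measurable_snd measurable_snd)).
Qed.

Let intH (j : X * Z -> R) : (Q < +oo)%E -> measurable_fun setT j ->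
  (forall x z, `|j (x, z)| <= B) -> (forall x z, ~ X0 x -> j (x, z) = 0) ->
  (sprod mu (sprod rho rho)).-integrable setT (EFin \o H j).
Proof.
move=> Qfin mj jB j0.
have [ig _] := integrable_tensor (intg Qfin) (intg Qfin).
have mg2 : measurable_fun setT (fun p : Z * Z => g p.1 * g p.2).
  by apply/measurable_EFinP; exact: measurable_int ig.
have [iX _] := integrable_tensor intX0 ig.
apply: (le_integrable _ _ _ (integrableZl measurableT (B ^+ 2) iX)) => //.
  by apply/measurable_EFinP; exact: mH.
move=> [x [z z']] _; rewrite /= lee_fin /H /= normrM [leRHS]normrM [`|B ^+ 2|]ger0_norm ?sqr_ge0//.
rewrite [`|_ * (g z * g z')|]normrM mulrA ler_wpM2r//.
have [Xx|nX] := pselect (X0 x); last by rewrite !j0// mul0r normr0 mulr_ge0 ?sqr_ge0.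
by rewrite indicE mem_set// normr1 mulr1 normrM expr2 ler_pM.
Qed.

Let square_tensor (j : X * Z -> R) x : (Q < +oo)%E -> measurable_fun setT j ->
  (forall x z, `|j (x, z)| <= B) ->
  (((\int[rho]_z (j (x, z) * g z)) ^+ 2)%:E = \int[sprod rho rho]_p (H j (x, p))%:E)%E.
Proof.
move=> Qfin mj jB.
have mjx : measurable_fun setT (fun z => j (x, z)) := @measurable_fun_pair2 _ _ _ _ _ _ j x mj.
have ij : rho.-integrable setT (EFin \o (fun z => j (x, z) * g z)).
  apply: (@le_integrable _ _ _ _ _ measurableT _ (fun z => (B * g z)%:E)).
  - by apply/measurable_EFinP; exact: measurable_funM.
  - move=> z _; rewrite /= lee_fin !normrM ler_wpM2r//.
    by rewrite (le_trans (jB x z))// ler_norm.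
  - under eq_fun do rewrite EFinM; exact: integrableZl (intg Qfin).
have [_ E] := integrable_tensor ij ij.
rewrite expr2 -E; apply: eq_integral => -[z z'] _ /=; congr EFin.
by rewrite /H /=; ring.
Qed.

Let kernel_integrable (j : X * Z -> R) z z' : measurable_fun setT j ->
  (forall x z, `|j (x, z)| <= B) -> (forall x z, ~ X0 x -> j (x, z) = 0) ->
  mu.-integrable setT (EFin \o (fun x => j (x, z) * j (x, z'))).
Proof.
move=> mj jB j0.
have m y : measurable_fun setT (fun x => j (x, y)) := @measurable_fun_pair1 _ _ _ _ _ _ j y mj.
apply: (@integrable_bounded_supp _ _ _ mu _ X0 (B * B)) => //.
- exact: measurable_funM.
- by move=> x; rewrite normrM ler_pM.
- by move=> x nX; rewrite j0// mul0r.
Qed.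

(** Expanding the squares and exchanging the integrals yields a quadratic form in [G] for the
    measure [tau] d[rho], whose kernel is the real part of k(x,z) times the conjugate of k(x,z'),
    with k = k1 + i k2. Then |G G'| <= (G^2 + G'^2) / 2 and the bound on the integrals of [W]
    conclude. If the right-hand integral is infinite there is nothing to prove, because [M] is
    positive. *)
Lemma schur_test :
  (\int[mu]_x ((S1 x) ^+ 2 + (S2 x) ^+ 2)%:E <= M%:E * Q)%E.
Proof.
have [Qfin|] := boolP (Q < +oo)%E; last first.
  by rewrite -leNgt leye_eq => /eqP ->; rewrite gt0_muley ?lte_fin// leey.
have kB1 x z : `|k1 (x, z)| <= B by have [] := kB x z.
have kB2 x z : `|k2 (x, z)| <= B by have [] := kB x z.
have k01 x z : ~ X0 x -> k1 (x, z) = 0 by move=> /(k0 z)[].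
have k02 x z : ~ X0 x -> k2 (x, z) = 0 by move=> /(k0 z)[].
have I1 := intH Qfin mk1 kB1 k01; have I2 := intH Qfin mk2 kB2 k02.
have E1 x := square_tensor x Qfin mk1 kB1; have E2 x := square_tensor x Qfin mk2 kB2.
have T z z' : (\int[mu]_x (H k1 (x, (z, z')) + H k2 (x, (z, z')))%:E =
    (g z * g z' * \int[mu]_x (k1 (x, z) * k1 (x, z') + k2 (x, z) * k2 (x, z')))%:E)%E.
  have i12 : mu.-integrable setT (EFin \o (fun x => k1 (x, z) * k1 (x, z') + k2 (x, z) * k2 (x, z'))).
    have := integrableD measurableT (kernel_integrable z z' mk1 kB1 k01) (kernel_integrable z z' mk2 kB2 k02).
    by apply: eq_integrable => // x _ /=; rewrite EFinD.
  rewrite -RintegralZl// /Rintegral fineK.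
    by apply: eq_integral => x _; rewrite /H /=; congr EFin; ring.
  apply: integrable_fin_num => //=.
  by under eq_fun do rewrite EFinM; exact: integrableZl i12.
have I : (sprod mu (sprod rho rho)).-integrable setT (EFin \o (fun p => H k1 p + H k2 p)).
  by apply: eq_integrable (integrableD measurableT I1 I2) => // p _ /=; rewrite EFinD.
under eq_integral do rewrite EFinD E1 E2.
rewrite (integralD measurableT (integrable_fubini_F I1) (integrable_fubini_F I2)).
rewrite (integral12_prod_meas1 I1) (integral12_prod_meas1 I2) -(integralD measurableT I1 I2).
have -> : (\int[sprod mu (sprod rho rho)]_p ((EFin \o H k1) p + (EFin \o H k2) p) =
  \int[sprod mu (sprod rho rho)]_p (EFin \o (fun p => H k1 p + H k2 p)%R) p)%E.
  by apply: eq_integral => p _; rewrite /= EFinD.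
rewrite -(integral21_prod_meas1 I).
have mI := measurable_fubini_G I.
(* [D] and [D'] exchange the roles of the two points; each has integral at most M Q, once by
   integrating over the second variable and once over the first, by symmetry of [W]. *)
pose D (p : Z * Z) := G p.1 ^+ 2 * tau p.1 * (W p * tau p.2).
pose D' (p : Z * Z) := G p.2 ^+ 2 * tau p.2 * (W (p.2, p.1) * tau p.1).
have mG1 : measurable_fun setT (fun p : Z * Z => G p.1) := measurableT_comp mG measurable_fst.
have mG2 : measurable_fun setT (fun p : Z * Z => G p.2) := measurableT_comp mG measurable_snd.
have mt1 : measurable_fun setT (fun p : Z * Z => tau p.1) := measurableT_comp mtau measurable_fst.
have mt2 : measurable_fun setT (fun p : Z * Z => tau p.2) := measurableT_comp mtau measurable_snd.
have mD : measurable_fun setT D.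
  by apply: measurable_funM; apply: measurable_funM => //; exact: measurable_funX.
have mD' : measurable_fun setT D'.
  apply: measurable_funM; apply: measurable_funM => //; first exact: measurable_funX.
  exact: (measurableT_comp mW (measurable_fun_pair measurable_snd measurable_fst)).
have tG z : 0 <= G z ^+ 2 * tau z by rewrite mulr_ge0 ?sqr_ge0.
have D0 p : 0 <= D p by apply: mulr_ge0 => //; exact: mulr_ge0.
have D'0 p : 0 <= D' p by apply: mulr_ge0 => //; exact: mulr_ge0.
apply: le_trans (lee_abs _) _.
apply: le_trans (le_abse_integral _ measurableT mI) _ => //.
apply: (@le_trans _ _ (\int[sprod rho rho]_p (2^-1%:E * ((D p)%:E + (D' p)%:E)))%E).
  apply: ge0_le_integral => //.
  - exact: measurableT_comp.
  - apply: measurable_funeM; apply: emeasurable_funD; exact/measurable_EFinP.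
  move=> [z z'] _; rewrite /fubini_G /= T; set K := Rintegral _ _ _.
  rewrite -EFinD -EFinM lee_fin /D /D' /g /=.
  have D0' := D0 (z, z'); have D'0' := D'0 (z, z').
  have [->|g1] := eqVneq (G z * tau z) 0.
    by rewrite !mul0r normr0 mulr_ge0// addr_ge0.
  have [->|g2] := eqVneq (G z' * tau z') 0.
    by rewrite mulr0 mul0r normr0 mulr_ge0// addr_ge0.
  have KW' : `|K| <= W (z, z') := KW g1 g2.
  rewrite W_sym /= -(W_sym z z').
  have -> : G z * tau z * (G z' * tau z') * K = (G z * G z') * (tau z * tau z') * K by ring.
  rewrite 2!normrM [`|tau z * _|]ger0_norm ?mulr_ge0//.
  have h1 : `|G z * G z'| <= 2^-1 * (G z ^+ 2 + G z' ^+ 2).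
    rewrite normrM -(real_normK (num_real (G z))) -(real_normK (num_real (G z'))).
    by have := sqr_ge0 (`|G z| - `|G z'|); lra.
  have h2 : `|G z * G z'| * (tau z * tau z') <= 2^-1 * (G z ^+ 2 + G z' ^+ 2) * (tau z * tau z').
    by rewrite ler_wpM2r// mulr_ge0.
  apply: le_trans (ler_pM _ _ h2 KW') _ => //; first by rewrite mulr_ge0// mulr_ge0.
  by apply: le_of_eq; ring.
have row z : (\int[rho]_z' (G z ^+ 2 * tau z * (W (z, z') * tau z'))%:E <= (G z ^+ 2 * tau z)%:E * M%:E)%E.
  have c0 : 0 <= G z ^+ 2 * tau z by rewrite mulr_ge0 ?sqr_ge0//.
  under eq_integral do rewrite EFinM.
  rewrite ge0_integralZl//; first by rewrite lee_wpmul2l ?lee_fin.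
  - apply/measurable_EFinP; apply: measurable_funM => //.
    exact: (@measurable_fun_pair2 _ _ _ _ _ _ W z mW).
  - by move=> z' _; rewrite lee_fin mulr_ge0.
have mGt : measurable_fun setT (fun z => (G z ^+ 2 * tau z)%:E).
  by apply/measurable_EFinP; apply: measurable_funM => //; exact: measurable_funX.
have total : (\int[rho]_z ((G z ^+ 2 * tau z)%:E * M%:E) = M%:E * Q)%E.
  rewrite ge0_integralZr//; first by rewrite muleC.
  - by move=> z _; rewrite lee_fin mulr_ge0 ?sqr_ge0//.
  - by rewrite lee_fin ltW.
have mEM : measurable_fun setT (fun z => (G z ^+ 2 * tau z)%:E * M%:E)%E.
  exact: emeasurable_funM.
have mED : measurable_fun setT (EFin \o D) by exact/measurable_EFinP.
have mED' : measurable_fun setT (EFin \o D') by exact/measurable_EFinP.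
have B1 : (\int[sprod rho rho]_p (D p)%:E <= M%:E * Q)%E.
  rewrite (@fubini_tonelli1 _ _ _ _ _ rho rho (EFin \o D))//.
  rewrite -total; apply: ge0_le_integral => //.
  - by move=> z _; apply: integral_ge0 => z' _; rewrite lee_fin; exact: (D0 (z, z')).
  - by apply: measurable_fun_fubini_tonelli_F => // p; rewrite lee_fin.
  - by move=> z _; exact: row.
have B2 : (\int[sprod rho rho]_p (D' p)%:E <= M%:E * Q)%E.
  rewrite (@fubini_tonelli2 _ _ _ _ _ rho rho (EFin \o D'))//.
  rewrite -total; apply: ge0_le_integral => //.
  - by move=> z _; apply: integral_ge0 => z' _; rewrite lee_fin; exact: (D'0 (z', z)).
  - by apply: measurable_fun_fubini_tonelli_G => // p; rewrite lee_fin.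
  - by move=> z _; exact: row.
rewrite ge0_integralZl//; last 2 first.
- by apply: emeasurable_funD.
- by move=> p _; rewrite adde_ge0// lee_fin.
rewrite ge0_integralD//; try by move=> p _; rewrite lee_fin.
apply: (@le_trans _ _ (2^-1%:E * (M%:E * Q + M%:E * Q)))%E.
  by rewrite lee_wpmul2l ?lee_fin ?invr_ge0//; exact: leeD.
have Q0 : (0 <= Q)%E by apply: integral_ge0 => z _; rewrite lee_fin mulr_ge0 ?sqr_ge0//.
have : (M%:E * Q)%E \is a fin_num by rewrite fin_numM// ge0_fin_numE.
move=> /fineK <-; rewrite -EFinD -EFinM lee_fin; lra.
Qed.

End Schur.

(** * Integrals of the weight 1 / (1 + x^2) *)

Section WeightIntegrals.
Context {R : realType}.
Notation mu := (@lebesgue_measure R).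
Notation MR := (measurableTypeR R).

Lemma measurable_oneDsqrV : measurable_fun [set: MR] (fun x : R => (oneDsqr x)^-1).
Proof.
by apply: measurable_realfun.continuous_measurable_fun => x; exact: continuous_oneDsqrV.
Qed.

Lemma integral_oneDsqrV_le : (\int[mu]_x ((oneDsqr x)^-1)%:E <= (@pi R)%:E)%E.
Proof.
have mf : measurable_fun [set: MR] (fun x : R => ((oneDsqr x)^-1)%:E).
  by apply/measurable_EFinP; exact: measurable_oneDsqrV.
have f0 (x : R) : (0 <= ((oneDsqr x)^-1)%:E)%E by rewrite lee_fin invr_ge0.
have -> : [set: MR] = `]-oo, 0[%classic `|` `[0, +oo[%classic.
  apply/seteqP; split => x // _; have [x0|x0] := ltP x 0.
    by left; rewrite /= in_itv /= x0.
  by right; rewrite /= in_itv /= x0.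
rewrite ge0_integral_setU//; last 2 first.
- exact: measurable_funTS.
- apply/disj_setPS => x [/=]; rewrite !in_itv /= andbT => x0.
  by rewrite leNgt x0.
rewrite integral0y_oneDsqr.
apply: (@le_trans _ _ ((pi / 2)%:E + (pi / 2)%:E)%E); last by rewrite -EFinD -splitr.
apply: leeD => //.
rewrite -integral0y_oneDsqr ge0_integration_by_substitution0//.
under [X in (_ <= X)%E]eq_integral do rewrite /oneDsqr sqrrN.
apply: ge0_subset_integral => //; first exact: measurable_funTS.
by move=> x /=; rewrite !in_itv /=; exact: ltW.
Qed.

Lemma integral_cauchy_le (k c : R) : 0 < k ->
  (\int[mu]_x ((oneDsqr (k * (x - c)))^-1)%:E <= (pi / k)%:E)%E.
Proof.
move=> k0.
have m : measurable_fun [set: MR] (fun x : R => ((oneDsqr (k * (x - c)))^-1)%:E).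
  apply/measurable_EFinP; apply: (measurableT_comp measurable_oneDsqrV).
  by apply: measurable_funM => //; exact: measurable_funB.
have kV0 : k^-1 != 0 by rewrite invr_eq0 gt_eqF.
rewrite (@ge0_integral_affine _ k^-1 c)//.
rewrite gtr0_norm ?invr_gt0// EFinM muleC [X in (_ <= _ * X)%E](_ : _ = k^-1%:E)//.
have k1 : (0 <= k^-1%:E)%E by rewrite lee_fin invr_ge0 ltW.
apply: lee_wpmul2r => //.
apply: le_trans integral_oneDsqrV_le; apply: le_of_eq.
apply: eq_integral => x _; congr ((oneDsqr _)^-1)%:E.
by rewrite addrK mulrA mulfV ?mul1r// gt_eqF.
Qed.

Definition pospart (t : R) : R := Num.max t 0.

Lemma pospart_ge0 t : 0 <= pospart t. Proof. by rewrite /pospart le_max lexx orbT. Qed.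

Lemma measurable_pospart : measurable_fun [set: MR] pospart.
Proof. exact: measurable_maxr. Qed.

(** The Jacobian t makes the integrand the exact derivative of atan (k (t^2 - c)) / (2 k), so the
    bound is uniform in [c]. *)
Lemma integral_radial_le (k c : R) : 0 < k ->
  (\int[mu]_t ((oneDsqr (k * (t ^+ 2 - c)))^-1 * pospart t)%:E <= (pi / (2 * k))%:E)%E.
Proof.
move=> k0.
pose f (t : R) := (oneDsqr (k * (t ^+ 2 - c)))^-1 * t.
pose F (t : R) := (2 * k)^-1 * atan (k * (t ^+ 2 - c)).
have -> : (\int[mu]_t ((oneDsqr (k * (t ^+ 2 - c)))^-1 * pospart t)%:E =
   \int[mu]_(t in `[0%R, +oo[) (f t)%:E)%E.
  rewrite [RHS]integral_mkcond; apply: eq_integral => t _; rewrite patchE.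
  rewrite /f /pospart; case: ifPn.
    by rewrite inE /= in_itv /= andbT => t0; rewrite max_l.
  rewrite notin_setE /= in_itv /= andbT => /negP; rewrite -ltNge => t0.
  by rewrite max_r ?mulr0// ltW.
have dg (t : R) : is_derive t 1 (fun t : R => k * (t ^+ 2 - c)) (k * (2 * t)).
  apply: is_derive_scale.
  have := is_deriveBf (is_deriveMf (is_derive_id t 1) (is_derive_id t 1)) (is_derive_cst c t 1).
  rewrite subr0 /= !mulr1 -mulr2n mulr_natl.
  by under [X in is_derive _ _ X _ -> _]eq_fun do rewrite -expr2.
have dF (t : R) : is_derive t 1 F (f t).
  have := is_derive_scale (2 * k)^-1 (@is_derive1_comp _ atan (fun t : R => k * (t ^+ 2 - c)) t _ _ (is_derive1_atan _) (dg t)).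
  suff -> : (2 * k)^-1 * ((1 + (k * (t ^+ 2 - c)) ^+ 2)^-1 * (k * (2 * t))) = f t by [].
  rewrite /f /oneDsqr; have := oneDsqr_ge1 (k * (t ^+ 2 - c)); rewrite /oneDsqr => h.
  by field; rewrite !gt_eqF//; lra.
have cF (t : R) : {for t, continuous F}.
  by apply: differentiable_continuous; apply/derivable1_diffP; exact: ex_derive.
have cf (t : R) : {for t, continuous f}.
  have cg : {for t, continuous (fun t : R => k * (t ^+ 2 - c))}.
    apply: differentiable_continuous; apply/derivable1_diffP.
    exact: (@ex_derive _ _ _ _ _ _ _ (dg t)).
  apply: continuousM; last exact: cvg_id.
  by apply: (@continuous_comp _ _ _ (fun t : R => k * (t ^+ 2 - c)) (fun x => (oneDsqr x)^-1)) => //; exact: continuous_oneDsqrV.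
have lim : F x @[x --> +oo] --> (2 * k)^-1 * (pi / 2).
  have lg : (fun t : R => k * (t ^+ 2 - c)) x @[x --> +oo] --> +oo; last first.
    have la : (atan \o (fun t : R => k * (t ^+ 2 - c))) x @[x --> +oo] --> pi / 2.
      exact: cvg_comp lg (@cvgy_atan R).
    have := @cvgM _ _ _ _ (cst (2 * k)^-1) _ _ _ (cvg_cst _) la.
    by apply; typeclasses eauto.
  apply/cvgryPge => A; near=> x.
  have x1 : 1 <= x by near: x; exact: nbhs_pinfty_ge.
  have x2 : A / k + c <= x by near: x; apply: nbhs_pinfty_ge; exact: num_real.
  rewrite mulrC -ler_pdivrMr// lerBrDr (le_trans x2)// expr2 ler_peMl//.
rewrite (ge0_continuous_FTC2y _ _ lim)//.
- rewrite -EFinB lee_fin /F.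
  have : - (pi / 2) < atan (k * (0 ^+ 2 - c)) by exact: atan_gtNpi2.
  move=> h; have h2 : 0 < (2 * k)^-1 by rewrite invr_gt0 mulr_gt0.
  have -> : pi / (2 * k) = (2 * k)^-1 * (pi / 2) - (2 * k)^-1 * (- (pi / 2)) :> R by field; lra.
  by rewrite lerD2l lerN2 ler_wpM2l// ltW.
- by move=> x x0; rewrite mulr_ge0// invr_ge0.
- apply/continuous_within_itvcyP; split; first by move=> x _; exact: cf.
  by apply: cvg_at_right_filter; exact: cf.
- by apply: cvg_at_right_filter; exact: cF.
- by move=> x _; rewrite derive1E; exact: derive_val.
Unshelve. all: by end_near.
Qed.

(** Cauchy-Schwarz against 1 / (1 + u^2), whose integral is at most pi. It is derived from the
    pointwise inequality 2 l |S| <= l^2 (1 + u^2) S^2 + 1 / (1 + u^2), integrated for a free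
    parameter l. *)
Lemma cauchy_schwarz_oneDsqr (S : R -> R) : mu.-integrable setT (EFin \o S) ->
  (((\int[mu]_u S u) ^+ 2)%:E <= pi%:E * \int[mu]_u (oneDsqr u * S u ^+ 2)%:E)%E.
Proof.
move=> iS.
have mS : measurable_fun [set: MR] S by apply/measurable_EFinP; exact: measurable_int iS.
have mD : measurable_fun [set: MR] (@oneDsqr R).
  by apply: measurable_realfun.continuous_measurable_fun => x; exact: continuous_oneDsqr.
have mS2 : measurable_fun [set: MR] (fun u => oneDsqr u * S u ^+ 2).
  by apply: measurable_funM => //; exact: measurable_funX.
have p0 : 0 < @pi R by exact: pi_gt0.
set A := (X in (_ <= _ * X)%E).
have S20 (u : R) : 0 <= oneDsqr u * S u ^+ 2 by rewrite mulr_ge0 ?sqr_ge0.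
have A0 : (0 <= A)%E by apply: integral_ge0 => u _; rewrite lee_fin.
have [Afin|] := boolP (A < +oo)%E; last first.
  by rewrite -leNgt leye_eq => /eqP ->; rewrite gt0_muley ?lte_fin// leey.
have Af : A = (fine A)%:E by rewrite fineK// ge0_fin_numE.
set a := fine A in Af; rewrite Af -EFinM lee_fin.
set I := \int[mu]_u S u.
have key (l : R) : 0 < l -> 2 * `|I| * l <= l ^+ 2 * a + pi.
  move=> l0.
  have h1 : (`|I|%:E <= \int[mu]_u (`|S u|)%:E)%E.
    rewrite (EFin_normr_Rintegral measurableT iS).
    by apply: le_trans (le_abse_integral _ _ _) _ => //; exact: measurable_int iS.
  have mnS : measurable_fun [set: MR] (fun u => `|S u|) by exact: measurableT_comp.
  have h2 : (\int[mu]_u (2 * l * `|S u|)%:E <= (l ^+ 2 * a + pi)%:E)%E.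
    apply: (@le_trans _ _ (\int[mu]_u ((l ^+ 2)%:E * (oneDsqr u * S u ^+ 2)%:E + ((oneDsqr u)^-1)%:E))%E).
      apply: ge0_le_integral => //.
      - by move=> u _; rewrite lee_fin mulr_ge0// mulr_ge0// ltW.
      - by apply/measurable_EFinP; exact: measurable_funM.
      - apply: emeasurable_funD; last by apply/measurable_EFinP; exact: measurable_oneDsqrV.
        by apply: measurable_funeM; exact/measurable_EFinP.
      move=> u _; rewrite -EFinM -EFinD lee_fin.
      have d1 := oneDsqr_ge1 u; have d0 : 0 < oneDsqr u by exact: lt_le_trans d1.
      rewrite -(real_normK (num_real (S u))) -subr_ge0.
      have -> : l ^+ 2 * (oneDsqr u * `|S u| ^+ 2) + (oneDsqr u)^-1 - 2 * l * `|S u| =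
         (oneDsqr u)^-1 * (l * oneDsqr u * `|S u| - 1) ^+ 2 by field; rewrite gt_eqF.
      by rewrite mulr_ge0 ?sqr_ge0// invr_ge0 ltW.
    have q1 (u : R) : (0 <= (l ^+ 2)%:E * (oneDsqr u * S u ^+ 2)%:E)%E.
      by rewrite mule_ge0// lee_fin// sqr_ge0.
    have q2 : measurable_fun [set: MR] (fun u => (l ^+ 2)%:E * (oneDsqr u * S u ^+ 2)%:E)%E.
      by apply: measurable_funeM; exact/measurable_EFinP.
    have q3 (u : R) : (0 <= ((oneDsqr u)^-1)%:E)%E by rewrite lee_fin invr_ge0.
    have q4 : measurable_fun [set: MR] (fun u : R => ((oneDsqr u)^-1)%:E).
      by apply/measurable_EFinP; exact: measurable_oneDsqrV.
    rewrite ge0_integralD//.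
    rewrite EFinD leeD//; last exact: integral_oneDsqrV_le.
    have q5 : measurable_fun [set: MR] (fun u => (oneDsqr u * S u ^+ 2)%:E) by exact/measurable_EFinP.
    have q6 : (0 <= (l ^+ 2)%:E)%E by rewrite lee_fin sqr_ge0.
    have q7 (u : MR) : [set: MR] u -> (0 <= (oneDsqr u * S u ^+ 2)%:E)%E by move=> _; rewrite lee_fin.
    rewrite ge0_integralZl//.
    by rewrite EFinM -/A Af.
  rewrite -lee_fin; apply: le_trans h2.
  under eq_integral do rewrite EFinM.
  have l2 : (0 <= (2 * l)%:E)%E by rewrite lee_fin mulr_ge0// ltW.
  have q8 : measurable_fun [set: MR] (fun u => (`|S u|)%:E) by exact/measurable_EFinP.
  rewrite ge0_integralZl//.
  by rewrite mulrAC EFinM; exact: lee_wpmul2l.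
have a0 : 0 <= a by rewrite -lee_fin -Af.
have [I0|I0] := eqVneq I 0; first by rewrite I0 expr0n mulr_ge0// ltW.
have Ip : 0 < `|I| by rewrite normr_gt0.
(* With l = pi / |I| the left side is 2 pi, and one pi is absorbed. *)
have := key (pi / `|I|) (divr_gt0 p0 Ip).
have -> : 2 * `|I| * (pi / `|I|) = 2 * pi by field; rewrite gt_eqF.
rewrite expr_div_n (real_normK (num_real I)) mulrAC => h.
have I2 : 0 < I ^+ 2 by rewrite -(real_normK (num_real I)) exprn_gt0.
have {}h : pi <= pi ^+ 2 * a / I ^+ 2 by lra.
rewrite ler_pdivlMr// expr2 -mulrA ler_pM2l// in h.
Qed.

End WeightIntegrals.

(** * Coordinates adapted to a pair of frequencies *)

Section PolarCoordinates.
Context {R : realType}.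
Notation mu := (@lebesgue_measure R).
Notation MR := (measurableTypeR R).
Notation M2 := (MR * MR)%type.
Notation M3 := (MR * MR * MR)%type.

Lemma ae_neq0 (f g : MR -> \bar R) : measurable_fun setT f -> measurable_fun setT g ->
  (forall v, v != 0 -> f v = g v) -> (\int[mu]_v f v = \int[mu]_v g v)%E.
Proof.
move=> mf mg fg; apply: ae_eq_integral => //.
exists [set 0]; split.
- exact: measurable_set1.
- exact: lebesgue_measure_set1.
by move=> v /= vn; apply: contrapT => /eqP v0; apply: vn => _; exact: fg.
Qed.

(** Here z = (eta, t). The relative position is described by its first coordinate t and its slope u
    rather than by length and angle, so t takes both signs; the first component is the frequency of
    f, the second that of g. *)
Definition polar_point (u : MR) (z : M3) : M2 * M2 :=
  ((z.1.1 + z.2, z.1.2 + z.2 * u), z.1).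

Lemma measurable_polar_point :
  measurable_fun setT (fun p : MR * M3 => polar_point p.1 p.2).
Proof.
have m1 : measurable_fun setT (fun p : MR * M3 => p.2.2).
  exact: (measurableT_comp measurable_snd measurable_snd).
have m2 : measurable_fun setT (fun p : MR * M3 => p.2.1).
  exact: (measurableT_comp measurable_fst measurable_snd).
have m3 := measurableT_comp measurable_fst m2.
have m4 := measurableT_comp measurable_snd m2.
apply: measurable_fun_pair => //; apply: measurable_fun_pair.
  exact: measurable_funD.
by apply: measurable_funD => //; apply: measurable_funM.
Qed.

(** After a translation, the second coordinate is substituted by t u for each t different from zero,
    with Jacobian |t|; the remaining t form a null set. *)
Lemma ge0_integral_polar2 (h : M2 -> \bar R) (e : M2) : measurable_fun setT h ->
  (forall p, 0 <= h p)%E ->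
  (\int[lam2]_p h p =
   \int[mu]_t \int[mu]_u (h (e.1 + t, e.2 + t * u)%R * `|t|%:E))%E.
Proof.
move=> mh h0.
have mF : measurable_fun setT (fubini_F mu h) by apply: measurable_fun_fubini_tonelli_F.
have F0 v : (0 <= fubini_F mu h v)%E by apply: integral_ge0.
rewrite [LHS](fubini_tonelli1 (m1 := mu) (m2 := mu) _ mh h0).
rewrite [LHS](@ge0_integral_affine _ 1 e.1)// normr1 mul1e.
have m1 : measurable_fun setT (fun p : M2 => h (e.1 + p.1, e.2 + p.1 * p.2)).
  apply: (measurableT_comp mh); apply: measurable_fun_pair; apply: measurable_funD => //.
  exact: measurable_funM.
have m2 : measurable_fun setT (fun p : M2 => h (e.1 + p.1, e.2 + p.1 * p.2)%R * `|p.1|%:E)%E.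
  apply: emeasurable_funM => //; apply/measurable_EFinP.
  by apply: measurableT_comp.
apply: ae_neq0.
- by apply: measurableT_comp => //; apply: measurable_funD.
- by apply: (measurable_fun_fubini_tonelli_F _ m2) => p; rewrite mule_ge0.
move=> v v0; rewrite /fubini_F.
have ms : measurable_fun setT (fun y : MR => h (1 * v + e.1, y)).
  exact: (@measurable_fun_pair2 _ _ _ _ _ _ h (1 * v + e.1)).
rewrite [LHS](@ge0_integral_affine _ v e.2)// ge0_integralZr//.
- by rewrite muleC; congr (_ * _)%E; apply: eq_integral => x _; rewrite mul1r [v + _]addrC [_ + e.2]addrC.
- exact: (@measurable_fun_pair2 _ _ _ _ _ _ (fun p : M2 => h (e.1 + p.1, e.2 + p.1 * p.2)) v).
Qed.

Lemma ge0_integral_polar (H : M2 * M2 -> \bar R) : measurable_fun setT H ->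
  (forall p, 0 <= H p)%E ->
  (\int[sprod lam2 lam2]_p H p =
   \int[mu]_u \int[lam3]_z (H (polar_point u z) * `|z.2|%:E))%E.
Proof.
move=> mH H0.
have mP : measurable_fun setT (fun p : MR * M3 => H (polar_point p.1 p.2) * `|p.2.2|%:E)%E.
  apply: emeasurable_funM; first exact: (measurableT_comp mH measurable_polar_point).
  apply/measurable_EFinP; apply: measurableT_comp => //.
  exact: (measurableT_comp measurable_snd measurable_snd).
have P0 (p : MR * M3) : (0 <= H (polar_point p.1 p.2) * `|p.2.2|%:E)%E by rewrite mule_ge0.
rewrite (fubini_tonelli (m1 := mu) (m2 := @lam3 R) _ mP P0).
have mG : measurable_fun setT (fubini_G mu (fun p : MR * M3 => H (polar_point p.1 p.2) * `|p.2.2|%:E)%E).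
  exact: measurable_fun_fubini_tonelli_G.
rewrite [RHS](fubini_tonelli1 (m1 := @lam2 R) (m2 := mu) _ mG); last first.
  by move=> p; exact: integral_ge0.
rewrite [LHS](fubini_tonelli2 (m1 := @lam2 R) (m2 := @lam2 R) _ mH H0).
apply: eq_integral => e _; rewrite /fubini_G.
rewrite (ge0_integral_polar2 e)//.
exact: (@measurable_fun_pair1 _ _ _ _ _ _ H e).
Qed.

Lemma integral_polar (H : M2 * M2 -> R) :
  (sprod lam2 lam2).-integrable setT (EFin \o H) ->
  (sprod mu lam3).-integrable setT
    (EFin \o (fun p : MR * M3 => H (polar_point p.1 p.2) * `|p.2.2|)) /\
  \int[sprod lam2 lam2]_p H p =
  \int[sprod mu lam3]_p (H (polar_point p.1 p.2) * `|p.2.2|).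
Proof.
move=> iH.
have mH : measurable_fun setT H by apply/measurable_EFinP; exact: measurable_int iH.
have mj : measurable_fun setT (fun p : MR * M3 => `|p.2.2|).
  apply: measurableT_comp => //.
  exact: (measurableT_comp measurable_snd measurable_snd).
have mP : measurable_fun setT (fun p : MR * M3 => H (polar_point p.1 p.2) * `|p.2.2|).
  by apply: measurable_funM => //; exact: (measurableT_comp mH measurable_polar_point).
have polar (K : M2 * M2 -> \bar R) : measurable_fun setT K -> (forall p, 0 <= K p)%E ->
    (\int[sprod lam2 lam2]_p K p =
     \int[sprod mu lam3]_p (K (polar_point p.1 p.2) * `|p.2.2|%:E))%E.
  move=> mK K0; rewrite ge0_integral_polar//.
  rewrite (fubini_tonelli1 (m1 := mu) (m2 := @lam3 R))//.
  - apply: emeasurable_funM; first exact: (measurableT_comp mK measurable_polar_point).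
    exact/measurable_EFinP.
  - by move=> p; rewrite mule_ge0.
split.
  apply/integrableP; split; first exact/measurable_EFinP.
  have /integrableP[_] := iH.
  rewrite polar//; last by apply: measurableT_comp => //; exact/measurable_EFinP.
  by under eq_integral do rewrite /= -EFinM -[X in _ * X]normr_id -normrM.
rewrite /Rintegral; congr fine.
rewrite [LHS]integralE [RHS]integralE; congr (_ - _)%E.
- rewrite polar//; last by apply: measurable_funepos; exact/measurable_EFinP.
  apply: eq_integral => p _; by rewrite !funeposE /= maxe_pMl// mul0e EFinM.
- rewrite polar//; last by apply: measurable_funeneg; exact/measurable_EFinP.
  apply: eq_integral => p _; by rewrite !funenegE /= maxe_pMl// mul0e -EFinM mulNr.
Qed.

End PolarCoordinates.

(** * From a weighted kernel bound to the bilinear estimate *)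

Section BilinearBound.
Context {R : realType}.
Notation mu := (@lebesgue_measure R).
Notation MR := (measurableTypeR R).
Notation M2 := (MR * MR)%type.
Notation M3 := (MR * MR * MR)%type.

Lemma oneDsqrN (x : R) : oneDsqr (- x) = oneDsqr x.
Proof. by rewrite /oneDsqr sqrrN. Qed.

Lemma measurable_oneDsqrV_comp d (T : measurableType d) (f : T -> R) :
  measurable_fun setT f -> measurable_fun setT (fun x => (oneDsqr (f x))^-1).
Proof. by move=> mf; exact: (measurableT_comp measurable_oneDsqrV mf). Qed.

Lemma integral_radial_sign_le (sg k c : R) : sg = 1 \/ sg = -1 -> 0 < k ->
  (\int[mu]_t ((oneDsqr (k * (t ^+ 2 - c)))^-1 * pospart (sg * t))%:E <= (pi / (2 * k))%:E)%E.
Proof.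
move=> sgE k0.
have sg0 : sg != 0 by case: sgE => ->; rewrite ?oppr_eq0 oner_eq0.
have sg1 : `|sg| = 1 by case: sgE => ->; rewrite ?normrN normr1.
have sg2 : sg ^+ 2 = 1 by case: sgE => ->; rewrite ?sqrrN expr1n.
have m : measurable_fun setT (fun t : MR => ((oneDsqr (k * (t ^+ 2 - c)))^-1 * pospart (sg * t))%:E).
  apply/measurable_EFinP; apply: measurable_funM; last first.
    by apply: (measurableT_comp measurable_pospart); exact: measurable_funM.
  apply: measurable_oneDsqrV_comp; apply: measurable_funM => //; exact: measurable_funB.
rewrite (ge0_integral_affine 0 sg0 m); last first.
  by move=> t; rewrite lee_fin mulr_ge0 ?pospart_ge0// invr_ge0.
rewrite sg1 mul1e; apply: le_trans (integral_radial_le c k0).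
apply: le_of_eq; apply: eq_integral => t _.
by rewrite addr0 exprMn sg2 mul1r mulrA -expr2 sg2 mul1r.
Qed.

(** The plane variables are integrated with t fixed: each contributes at most pi / s wherever its
    profile is centred, so [c1] and [c2] may depend on t. *)
Lemma integral_weight_le (s : R) (c1 c2 : MR -> R) (h : MR -> R) (e : R) : 0 < s ->
  measurable_fun setT c1 -> measurable_fun setT c2 -> measurable_fun setT h ->
  (forall t, 0 <= h t) -> (\int[mu]_t (h t)%:E <= e%:E)%E ->
  (\int[lam3]_z ((oneDsqr (s * (z.1.1 - c1 z.2)))^-1 *
     ((oneDsqr (s * (z.1.2 - c2 z.2)))^-1 * h z.2))%:E <= ((pi / s) ^+ 2 * e)%:E)%E.
Proof.
move=> s0 mc1 mc2 mh h0 he.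
have m1 : measurable_fun setT (fun z : M3 => z.1.1).
  exact: (measurableT_comp measurable_fst measurable_fst).
have m2 : measurable_fun setT (fun z : M3 => z.1.2).
  exact: (measurableT_comp measurable_snd measurable_fst).
have m3 : measurable_fun setT (fun z : M3 => z.2) by exact: measurable_snd.
have m4 : measurable_fun setT (fun z : M3 => (oneDsqr (s * (z.1.1 - c1 z.2)))^-1).
  apply: measurable_oneDsqrV_comp; apply: measurable_funM => //; apply: measurable_funB => //.
  exact: (measurableT_comp mc1 m3).
have m5 : measurable_fun setT (fun z : M3 => (oneDsqr (s * (z.1.2 - c2 z.2)))^-1).
  apply: measurable_oneDsqrV_comp; apply: measurable_funM => //; apply: measurable_funB => //.
  exact: (measurableT_comp mc2 m3).
have m6 : measurable_fun setT (fun z : M3 => h z.2) by exact: (measurableT_comp mh m3).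
have mW : measurable_fun setT (fun z : M3 => ((oneDsqr (s * (z.1.1 - c1 z.2)))^-1 *
     ((oneDsqr (s * (z.1.2 - c2 z.2)))^-1 * h z.2))%:E).
  apply/measurable_EFinP; apply: measurable_funM => //; exact: measurable_funM.
have W0 (z : M3) : (0 <= ((oneDsqr (s * (z.1.1 - c1 z.2)))^-1 *
     ((oneDsqr (s * (z.1.2 - c2 z.2)))^-1 * h z.2))%:E)%E.
  by rewrite lee_fin mulr_ge0 ?mulr_ge0// invr_ge0.
rewrite [X in (X <= _)%E](fubini_tonelli2 (m1 := @lam2 R) (m2 := mu) _ mW W0).
have mr (a : R) : measurable_fun setT (fun x : MR => (oneDsqr (s * (x - a)))^-1).
  by apply: measurable_oneDsqrV_comp; apply: measurable_funM => //; exact: measurable_funB.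
have mc (a : R) : measurable_fun setT (fun x : MR => ((oneDsqr (s * (x - a)))^-1)%:E).
  exact/measurable_EFinP.
have c0 (a x : R) : (0 <= ((oneDsqr (s * (x - a)))^-1)%:E)%E by rewrite lee_fin invr_ge0.
have inner (t : MR) : (fubini_G lam2 (fun z : M3 => ((oneDsqr (s * (z.1.1 - c1 z.2)))^-1 *
     ((oneDsqr (s * (z.1.2 - c2 z.2)))^-1 * h z.2))%:E) t <= ((pi / s) ^+ 2)%:E * (h t)%:E)%E.
  rewrite /fubini_G /=.
  have mt : measurable_fun setT (fun x : M2 => ((oneDsqr (s * (x.1 - c1 t)))^-1 *
     ((oneDsqr (s * (x.2 - c2 t)))^-1 * h t))%:E).
    exact: (@measurable_fun_pair1 _ _ _ _ _ _ _ t mW).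
  rewrite [X in (X <= _)%E](fubini_tonelli1 (m1 := mu) (m2 := mu) _ mt); last first.
    by move=> x; rewrite lee_fin mulr_ge0 ?mulr_ge0// invr_ge0.
  rewrite /fubini_F /=.
  have E (x : MR) : (\int[mu]_y ((oneDsqr (s * (x - c1 t)))^-1 *
       ((oneDsqr (s * (y - c2 t)))^-1 * h t))%:E =
      (h t * (oneDsqr (s * (x - c1 t)))^-1)%:E *
        \int[mu]_y ((oneDsqr (s * (y - c2 t)))^-1)%:E)%E.
    have q0 : (0 <= (h t * (oneDsqr (s * (x - c1 t)))^-1)%:E)%E.
      by rewrite lee_fin mulr_ge0// invr_ge0.
    rewrite -(ge0_integralZl mu measurableT (mc (c2 t)))//.
    by apply: eq_integral => y _; rewrite -EFinM; congr (_%:E); rewrite mulrA mulrC mulrA.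
  under eq_integral do rewrite E.
  have q1 : (0 <= \int[mu]_y ((oneDsqr (s * (y - c2 t)))^-1)%:E)%E by exact: integral_ge0.
  have q2 : (\int[mu]_y ((oneDsqr (s * (y - c2 t)))^-1)%:E <= (pi / s)%:E)%E.
    exact: integral_cauchy_le.
  have q3 : measurable_fun setT (fun x : MR => (h t * (oneDsqr (s * (x - c1 t)))^-1)%:E).
    apply/measurable_EFinP; apply: measurable_funM => //.
  have q4 (x : MR) : [set: MR] x -> (0 <= (h t * (oneDsqr (s * (x - c1 t)))^-1)%:E)%E.
    by move=> _; rewrite lee_fin mulr_ge0// invr_ge0.
  rewrite ge0_integralZr//.
  rewrite [X in (X * _ <= _)%E](_ : _ = (h t)%:E * \int[mu]_x ((oneDsqr (s * (x - c1 t)))^-1)%:E)%E; last first.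
    have q11 : (0 <= (h t)%:E)%E by rewrite lee_fin.
    rewrite -(ge0_integralZl mu measurableT (mc (c1 t)))//.
  have q5 : (\int[mu]_y ((oneDsqr (s * (y - c1 t)))^-1)%:E <= (pi / s)%:E)%E.
    exact: integral_cauchy_le.
  have q6 : (0 <= \int[mu]_y ((oneDsqr (s * (y - c1 t)))^-1)%:E)%E by exact: integral_ge0.
  have q7 : (0 <= (h t)%:E)%E by rewrite lee_fin.
  rewrite expr2 EFinM -muleA; rewrite muleC; apply: lee_pmul => //; first by rewrite mule_ge0.
  exact: lee_pmul.
have q8 : (0 <= ((pi / s) ^+ 2)%:E)%E by rewrite lee_fin sqr_ge0.
have q9 : measurable_fun setT (fun t : MR => (h t)%:E) by exact/measurable_EFinP.
have q10 (t : MR) : [set: MR] t -> (0 <= (h t)%:E)%E by rewrite lee_fin.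
apply: (@le_trans _ _ (\int[mu]_t (((pi / s) ^+ 2)%:E * (h t)%:E))%E).
  apply: ge0_le_integral => //.
  - by move=> t _; exact: integral_ge0.
  - exact: measurable_fun_fubini_tonelli_G.
  - exact: measurable_funeM.
by rewrite (ge0_integralZl mu measurableT q9)// EFinM; exact: lee_wpmul2l he.
Qed.

(* [p] pairs two points [z = (eta, t)] of the polar coordinates with direction
   [(1, u)]: the first two factors measure the increment of the centre of mass
   [eta + g t (1, u)]. *)
Definition weight (s g k u : R) (p : M3 * M3) : R :=
  (oneDsqr (s * (p.2.1.1 - p.1.1.1 + g * (p.2.2 - p.1.2))))^-1 *
  ((oneDsqr (s * (p.2.1.2 - p.1.1.2 + g * (p.2.2 - p.1.2) * u)))^-1 *
   (oneDsqr (k * (p.2.2 ^+ 2 - p.1.2 ^+ 2)))^-1).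

Lemma weight_ge0 s g k u p : 0 <= weight s g k u p.
Proof. by rewrite /weight mulr_ge0 ?mulr_ge0// invr_ge0. Qed.

Lemma weight_sym s g k u z z' : weight s g k u (z, z') = weight s g k u (z', z).
Proof.
rewrite /weight /=; congr (_^-1 * (_^-1 * _^-1)); rewrite -oneDsqrN; congr oneDsqr; ring.
Qed.

Lemma measurable_weight s g k u : measurable_fun setT (weight s g k u).
Proof.
have m1 : measurable_fun setT (fun p : M3 * M3 => p.1.1).
  exact: (measurableT_comp measurable_fst measurable_fst).
have m2 : measurable_fun setT (fun p : M3 * M3 => p.2.1).
  exact: (measurableT_comp measurable_fst measurable_snd).
have m3 : measurable_fun setT (fun p : M3 * M3 => p.1.2).
  exact: (measurableT_comp measurable_snd measurable_fst).
have m4 : measurable_fun setT (fun p : M3 * M3 => p.2.2).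
  exact: (measurableT_comp measurable_snd measurable_snd).
have m5 := measurableT_comp measurable_fst m1; have m6 := measurableT_comp measurable_fst m2.
have m7 := measurableT_comp measurable_snd m1; have m8 := measurableT_comp measurable_snd m2.
have m9 : measurable_fun setT (fun p : M3 * M3 => g * (p.2.2 - p.1.2)).
  by apply: measurable_funM => //; exact: measurable_funB.
apply: measurable_funM; first apply: measurable_oneDsqrV_comp.
  apply: measurable_funM => //; apply: measurable_funD => //; exact: measurable_funB.
apply: measurable_funM; apply: measurable_oneDsqrV_comp; apply: measurable_funM => //.
  apply: measurable_funD; [exact: measurable_funB | exact: measurable_funM].
by apply: measurable_funB; exact: measurable_funX.
Qed.

(** For fixed t' the first two factors are translated Cauchy profiles in eta'; the sign restriction
    together with the Jacobian leaves the radial integral. *)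
Lemma weight_schur (sg s g k u : R) (z : M3) : sg = 1 \/ sg = -1 -> 0 < s -> 0 < k ->
  (\int[lam3]_z' (weight s g k u (z, z') * pospart (sg * z'.2))%:E <=
   ((pi / s) ^+ 2 * (pi / (2 * k)))%:E)%E.
Proof.
move=> sgE s0 k0.
pose h (t : MR) := (oneDsqr (k * (t ^+ 2 - z.2 ^+ 2)))^-1 * pospart (sg * t).
pose c1 (t : MR) := z.1.1 - g * (t - z.2); pose c2 (t : MR) := z.1.2 - g * (t - z.2) * u.
have mc1 : measurable_fun setT c1.
  by apply: measurable_funB => //; apply: measurable_funM => //; exact: measurable_funB.
have mc2 : measurable_fun setT c2.
  apply: measurable_funB => //; apply: measurable_funM => //; apply: measurable_funM => //.
  exact: measurable_funB.
have mh : measurable_fun setT h.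
  apply: measurable_funM; last first.
    by apply: (measurableT_comp measurable_pospart); exact: measurable_funM.
  by apply: measurable_oneDsqrV_comp; apply: measurable_funM => //; exact: measurable_funB.
have h0 t : 0 <= h t by rewrite mulr_ge0 ?pospart_ge0// invr_ge0.
have := integral_weight_le s0 mc1 mc2 mh h0 (integral_radial_sign_le (z.2 ^+ 2) sgE k0).
apply: le_trans; apply: le_of_eq; apply: eq_integral => y _.
congr (_%:E); rewrite /weight /h /c1 /c2 /= !mulrA.
congr ((oneDsqr _)^-1 * (oneDsqr _)^-1 * _ * _); ring.
Qed.

Section Bilinear.
Context d (X : measurableType d) (nu : {sigma_finite_measure set X -> \bar R}).
Variables (k1 k2 : X * (M2 * M2) -> R) (f g : M2 -> R) (X0 : set X) (B L C s gm k : R).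
Hypotheses (mk1 : measurable_fun setT k1) (mk2 : measurable_fun setT k2)
  (mf : measurable_fun setT f) (mg : measurable_fun setT g)
  (mX0 : measurable X0) (X0fin : (nu X0 < +oo)%E)
  (L0 : 0 < L) (f_supp : forall e, f e != 0 -> `|e| <= L) (g_supp : forall e, g e != 0 -> `|e| <= L)
  (f_fin : (\int[lam2]_e ((f e) ^+ 2)%:E < +oo)%E)
  (g_fin : (\int[lam2]_e ((g e) ^+ 2)%:E < +oo)%E)
  (kB : forall x p, `|k1 (x, p)| <= B /\ `|k2 (x, p)| <= B)
  (kX0 : forall x p, ~ X0 x -> k1 (x, p) = 0 /\ k2 (x, p) = 0)
  (s0 : 0 < s) (k0 : 0 < k) (C0 : 0 < C)
  (KW : forall sg u z z', sg = 1 \/ sg = -1 -> 0 < sg * z.2 -> 0 < sg * z'.2 ->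
    f (polar_point u z).1 != 0 -> g (polar_point u z).2 != 0 ->
    f (polar_point u z').1 != 0 -> g (polar_point u z').2 != 0 ->
    `|\int[nu]_x (k1 (x, polar_point u z) * k1 (x, polar_point u z') +
                  k2 (x, polar_point u z) * k2 (x, polar_point u z'))| <=
    C * weight s gm (k * oneDsqr u) u (z, z')).

Let M0 := C * ((pi / s) ^+ 2 * (pi / (2 * k))).
Let G u z := f (polar_point u z).1 * g (polar_point u z).2.
Let S (kp : X * (M2 * M2) -> R) sg x u :=
  \int[lam3]_z (kp (x, polar_point u z) * (G u z * pospart (sg * z.2))).

Let mG : measurable_fun setT (fun p : MR * M3 => G p.1 p.2).
Proof.
apply: measurable_funM.
  exact: (measurableT_comp mf (measurableT_comp measurable_fst measurable_polar_point)).
exact: (measurableT_comp mg (measurableT_comp measurable_snd measurable_polar_point)).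
Qed.

Let mtau sg : measurable_fun setT (fun p : MR * M3 => pospart (sg * p.2.2)).
Proof.
apply: (measurableT_comp measurable_pospart); apply: measurable_funM => //.
exact: (measurableT_comp measurable_snd measurable_snd).
Qed.

Let mkp (kp : X * (M2 * M2) -> R) : measurable_fun setT kp ->
  measurable_fun setT (fun p : X * (MR * M3) => kp (p.1, polar_point p.2.1 p.2.2)).
Proof.
move=> mk; apply: (measurableT_comp mk); apply: measurable_fun_pair => //.
exact: (measurableT_comp measurable_polar_point measurable_snd).
Qed.

(** The coordinate t is the difference of the first coordinates of two points of norm at most L,
    hence the radius 2 L. *)
Let box : set M3 := box3 0 (2 * L).

Let L20 : 0 < 2 * L. Proof. exact: mulr_gt0. Qed.

Let G0 u z : G u z != 0 -> box z.
Proof.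
rewrite mulf_eq0 negb_or => /andP[/f_supp h1 /g_supp h2]; apply: box3P; rewrite subr0.
move: h1 h2; rewrite /polar_point !prod_normE !ge_max /= => /andP[h1 _] /andP[h2 h3].
have h4 := ler_normB (z.1.1 + z.2) z.1.1; rewrite addrAC subrr add0r in h4.
by have L0' := L0; apply/andP; split; [apply/andP; split|]; lra.
Qed.

Let mbox : measurable box. Proof. exact: measurable_box3. Qed.

Let box_fin : (lam3 box < +oo)%E. Proof. exact: box3_fin. Qed.

Let tau_fin sg : sg = 1 \/ sg = -1 -> (\int[lam3]_(z in box) (pospart (sg * z.2))%:E < +oo)%E.
Proof.
move=> sgE.
have h (z : M3) : box z -> ((pospart (sg * z.2))%:E <= `|2 * L|%:E)%E.
  move=> [_]; rewrite /seg /= in_itv /= => zI.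
  have zL : `|z.2| <= 2 * L by rewrite -[z.2]subr0 ler_distl.
  rewrite lee_fin /pospart ge_max normr_ge0 andbT; apply: le_trans (ler_norm _) _.
  rewrite normrM (_ : `|sg| = 1) ?mul1r; last by case: sgE => ->; rewrite ?normrN normr1.
  exact: le_trans zL (ler_norm _).
have m : measurable_fun box (fun z : M3 => (pospart (sg * z.2))%:E).
  apply/measurable_EFinP; apply: measurable_funTS.
  apply: (measurableT_comp measurable_pospart); exact: measurable_funM.
apply: (@le_lt_trans _ _ (\int[lam3]_(z in box) `|2 * L|%:E)%E).
  apply: ge0_le_integral => //.
  by move=> z _; rewrite lee_fin pospart_ge0.
rewrite integral_cst// ltey_eq fin_numM// ge0_fin_numE//.
Qed.

(** Schur's test at a fixed slope and sign. The radial factor of the weight has rate k (1 + u^2),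
    which is where the decay 1 / (1 + u^2) of the constant comes from. *)
Let schur sg u : sg = 1 \/ sg = -1 ->
  (\int[nu]_x (S k1 sg x u ^+ 2 + S k2 sg x u ^+ 2)%:E <=
   (M0 / oneDsqr u)%:E * \int[lam3]_z (G u z ^+ 2 * pospart (sg * z.2))%:E)%E.
Proof.
move=> sgE.
have D0 : 0 < oneDsqr u by exact: lt_le_trans (oneDsqr_ge1 u).
have kD0 : 0 < k * oneDsqr u by exact: mulr_gt0.
have p0 : 0 < @pi R by exact: pi_gt0.
have mS (kp : X * (M2 * M2) -> R) : measurable_fun setT kp ->
    measurable_fun setT (fun p : X * M3 => kp (p.1, polar_point u p.2)).
  move=> mk; apply: (measurableT_comp mk); apply: measurable_fun_pair => //.
  apply: (measurableT_comp _ measurable_snd).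
  exact: (@measurable_fun_pair2 _ _ _ _ _ _ _ u measurable_polar_point).
have mGu : measurable_fun setT (G u) by exact: (@measurable_fun_pair2 _ _ _ _ _ _ _ u mG).
have mtu : measurable_fun setT (fun z : M3 => pospart (sg * z.2)).
  apply: (measurableT_comp measurable_pospart); exact: measurable_funM.
have mW : measurable_fun setT (fun p => C * weight s gm (k * oneDsqr u) u p).
  by apply: measurable_funM => //; exact: measurable_weight.
have W0 p : 0 <= C * weight s gm (k * oneDsqr u) u p by rewrite mulr_ge0 ?weight_ge0// ltW.
have Wsym z z' : C * weight s gm (k * oneDsqr u) u (z, z') = C * weight s gm (k * oneDsqr u) u (z', z).
  by rewrite weight_sym.
have M0p : 0 < M0 / oneDsqr u.
  by rewrite divr_gt0// /M0 mulr_gt0// mulr_gt0 ?exprn_gt0 ?divr_gt0// mulr_gt0.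
have tp z : G u z * pospart (sg * z.2) != 0 ->
    [/\ 0 < sg * z.2, f (polar_point u z).1 != 0 & g (polar_point u z).2 != 0].
  rewrite mulf_eq0 negb_or mulf_eq0 negb_or => /andP[/andP[h1 h2] h3]; split => //.
  rewrite ltNge; apply: contra h3 => h3; rewrite /pospart max_r//.
apply: (@schur_test _ _ _ _ _ nu lam3 _ _ (G u) (fun z => pospart (sg * z.2)) X0 box _ B _
  (mS _ mk1) (mS _ mk2) mGu mtu mX0 mbox mW X0fin (fun z => pospart_ge0 _) (tau_fin sgE)
  (G0 (u := u)) _ _ W0 Wsym M0p).
- by move=> x z; exact: kB.
- by move=> x z; exact: kX0.
- by move=> z z' /tp[? ? ?] /tp[? ? ?]; exact: KW sgE _ _ _ _ _ _.
move=> z; under eq_integral do rewrite -mulrA EFinM.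
rewrite ge0_integralZl//.
- have -> : M0 / oneDsqr u = C * ((pi / s) ^+ 2 * (pi / (2 * (k * oneDsqr u)))).
    by rewrite /M0; field; rewrite !gt_eqF.
  rewrite EFinM; apply: lee_wpmul2l; first by rewrite lee_fin ltW.
  exact: weight_schur.
- apply/measurable_EFinP; apply: measurable_funM => //.
  exact: (@measurable_fun_pair2 _ _ _ _ _ _ _ z (measurable_weight s gm (k * oneDsqr u) u)).
- by move=> z' _; rewrite lee_fin mulr_ge0 ?weight_ge0 ?pospart_ge0.
by rewrite lee_fin ltW.
Qed.
Let intf : lam2.-integrable setT (EFin \o f).
Proof. by apply: (@box2_L2_integrable R 0 L L0) => // e; rewrite subr0; exact: f_supp. Qed.

Let intg : lam2.-integrable setT (EFin \o g).
Proof. by apply: (@box2_L2_integrable R 0 L L0) => // e; rewrite subr0; exact: g_supp. Qed.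

Let int_pair (kp : X * (M2 * M2) -> R) x : measurable_fun setT kp ->
  (forall p, `|kp (x, p)| <= B) ->
  (sprod lam2 lam2).-integrable setT (EFin \o (fun p => kp (x, p) * (f p.1 * g p.2))).
Proof.
move=> mk kpB; have [i _] := integrable_tensor intf intg.
have B0 : 0 <= B := le_trans (normr_ge0 _) (kpB point).
have mt := measurable_int _ i.
apply: (le_integrable _ _ _ (integrableZl measurableT B i)) => //.
  apply/measurable_EFinP; apply: measurable_funM; last exact/measurable_EFinP.
  exact: (@measurable_fun_pair2 _ _ _ _ _ _ _ x mk).
by move=> p _ /=; rewrite lee_fin !normrM (ger0_norm B0) ler_wpM2r.
Qed.

Let int_sign (kp : X * (M2 * M2) -> R) x sg : measurable_fun setT kp ->
  (forall p, `|kp (x, p)| <= B) -> sg = 1 \/ sg = -1 ->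
  (sprod mu lam3).-integrable setT (EFin \o (fun p : MR * M3 =>
    kp (x, polar_point p.1 p.2) * (G p.1 p.2 * pospart (sg * p.2.2)))).
Proof.
move=> mk kpB sgE.
have [i _] := integral_polar (int_pair mk kpB).
apply: (le_integrable _ _ _ i) => //.
  apply/measurable_EFinP; apply: measurable_funM; last exact: measurable_funM.
  exact: (@measurable_fun_pair2 _ _ _ _ _ _ _ x (mkp mk)).
move=> p _ /=; rewrite lee_fin mulrA !normrM ler_wpM2l// normr_id ger0_norm ?pospart_ge0//.
rewrite /pospart ge_max normr_ge0 andbT.
by case: sgE => ->; rewrite ?mul1r ?mulN1r ?ler_norm// -normrN ler_norm.
Qed.

(** For a null set of slopes the inner integral may fail to be finite; [fine] then returns zero, so
    the agreement with Fubini's iterated integral holds almost everywhere. *)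
Let S_int (kp : X * (M2 * M2) -> R) x sg : measurable_fun setT kp ->
  (forall p, `|kp (x, p)| <= B) -> sg = 1 \/ sg = -1 ->
  mu.-integrable setT (EFin \o S kp sg x) /\
  \int[mu]_u S kp sg x u = \int[sprod mu lam3]_p
    (kp (x, polar_point p.1 p.2) * (G p.1 p.2 * pospart (sg * p.2.2))).
Proof.
move=> mk kpB sgE; have i := int_sign mk kpB sgE.
have iF := integrable_fubini_F i.
have mS : measurable_fun setT (S kp sg x).
  apply: (@measurable_Rintegral _ _ _ _ _ lam3 (fun p : MR * M3 =>
    kp (x, polar_point p.1 p.2) * (G p.1 p.2 * pospart (sg * p.2.2)))).
  by apply/measurable_EFinP; exact: measurable_int i.
have SE u : S kp sg x u = fine (fubini_F lam3 (EFin \o (fun p : MR * M3 =>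
    kp (x, polar_point p.1 p.2) * (G p.1 p.2 * pospart (sg * p.2.2)))) u) by [].
split.
  apply: (le_integrable _ _ _ iF) => //; first exact/measurable_EFinP.
  move=> u _; rewrite [(EFin \o _) u]/= SE.
  by case: (fubini_F _ _ u) => [r| |] //=; rewrite normr0 leey.
rewrite /Rintegral -(integral12_prod_meas1 i); congr fine.
apply: ae_eq_integral => //.
- exact/measurable_EFinP.
- exact: measurable_int iF.
have := integrable_ae measurableT iF.
apply: filterS => u h _; have {}h := h I.
by rewrite /= SE fineK.
Qed.

Let mS (kp : X * (M2 * M2) -> R) sg : measurable_fun setT kp ->
  measurable_fun setT (fun q : X * MR => S kp sg q.1 q.2).
Proof.
move=> mk.
apply: (@measurable_Rintegral _ _ (X * MR)%type _ _ lam3 (fun q : (X * MR) * M3 =>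
  kp (q.1.1, polar_point q.1.2 q.2) * (G q.1.2 q.2 * pospart (sg * q.2.2)))).
have mq : measurable_fun setT (fun q : (X * MR) * M3 => (q.1.2, q.2)).
  by apply: measurable_fun_pair => //; exact: (measurableT_comp measurable_snd measurable_fst).
apply: measurable_funM; last apply: measurable_funM.
- apply: (measurableT_comp mk); apply: measurable_fun_pair.
    exact: (measurableT_comp measurable_fst measurable_fst).
  exact: (measurableT_comp measurable_polar_point mq).
- exact: (measurableT_comp mG mq).
- exact: (measurableT_comp (mtau sg) mq).
Qed.

Let M0_ge0 : 0 <= M0.
Proof.
have p0 := ltW (pi_gt0 R); have [s0' k0'] := (ltW s0, ltW k0).
apply: mulr_ge0; first exact: ltW.
by apply: mulr_ge0; [exact: sqr_ge0|apply: divr_ge0 => //; exact: mulr_ge0].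
Qed.

(** Cauchy-Schwarz in u for each x costs the weight 1 + u^2; after exchanging x and u, Schur's test
    at each slope gives it back exactly. *)
Let half sg : sg = 1 \/ sg = -1 ->
  (\int[nu]_x ((\int[mu]_u S k1 sg x u) ^+ 2 + (\int[mu]_u S k2 sg x u) ^+ 2)%:E <=
   (pi * M0)%:E * \int[mu]_u \int[lam3]_z (G u z ^+ 2 * pospart (sg * z.2))%:E)%E.
Proof.
move=> sgE.
have p0 : 0 < @pi R by exact: pi_gt0.
have mD : measurable_fun setT (@oneDsqr R : MR -> MR).
  by apply: measurable_realfun.continuous_measurable_fun => x; exact: continuous_oneDsqr.
have D0 (u : R) : 0 <= oneDsqr u by apply: le_trans (oneDsqr_ge1 u).
have mDS : measurable_fun setT (fun q : X * MR =>
    (oneDsqr q.2 * (S k1 sg q.1 q.2 ^+ 2 + S k2 sg q.1 q.2 ^+ 2))%:E).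
  apply/measurable_EFinP; apply: measurable_funM; first exact: (measurableT_comp mD measurable_snd).
  by apply: measurable_funD; apply: measurable_funX; exact: mS.
have DS0 (q : X * MR) : (0 <= (oneDsqr q.2 * (S k1 sg q.1 q.2 ^+ 2 + S k2 sg q.1 q.2 ^+ 2))%:E)%E.
  by rewrite lee_fin mulr_ge0// addr_ge0// sqr_ge0.
have mI (kp : X * (M2 * M2) -> R) : measurable_fun setT kp ->
    measurable_fun setT (fun x => \int[mu]_u S kp sg x u).
  by move=> mk; exact: (measurable_Rintegral mu (mS sg mk)).
apply: (@le_trans _ _ (\int[nu]_x (pi%:E * \int[mu]_u
   (oneDsqr u * (S k1 sg x u ^+ 2 + S k2 sg x u ^+ 2))%:E))%E).
  apply: ge0_le_integral => //.
  - by move=> x _; rewrite lee_fin addr_ge0// sqr_ge0.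
  - by apply/measurable_EFinP; apply: measurable_funD; apply: measurable_funX; exact: mI.
  - apply: measurable_funeM; exact: (measurable_fun_fubini_tonelli_F _ mDS).
  move=> x _.
  have [i1 _] := S_int mk1 (fun p => (kB x p).1) sgE.
  have [i2 _] := S_int mk2 (fun p => (kB x p).2) sgE.
  have s1 := measurable_int _ i1; have s2 := measurable_int _ i2.
  rewrite (_ : \int[mu]_u (oneDsqr u * (S k1 sg x u ^+ 2 + S k2 sg x u ^+ 2))%:E =
     \int[mu]_u (oneDsqr u * S k1 sg x u ^+ 2)%:E + \int[mu]_u (oneDsqr u * S k2 sg x u ^+ 2)%:E)%E; last first.
    under eq_integral do rewrite mulrDr EFinD.
    have b1 : measurable_fun setT (fun u : MR => (oneDsqr u * S k1 sg x u ^+ 2)%:E).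
      apply/measurable_EFinP; apply: measurable_funM => //; apply: measurable_funX.
      exact/measurable_EFinP.
    have b2 : measurable_fun setT (fun u : MR => (oneDsqr u * S k2 sg x u ^+ 2)%:E).
      apply/measurable_EFinP; apply: measurable_funM => //; apply: measurable_funX.
      exact/measurable_EFinP.
    rewrite (ge0_integralD _ _ _ b1 _ b2)//.
    - by move=> u _; rewrite lee_fin mulr_ge0 ?sqr_ge0.
    - by move=> u _; rewrite lee_fin mulr_ge0 ?sqr_ge0.
  rewrite ge0_muleDr ?integral_ge0//.
  - by rewrite EFinD leeD//; exact: cauchy_schwarz_oneDsqr.
  - by move=> u _; rewrite lee_fin mulr_ge0 ?sqr_ge0.
  - by move=> u _; rewrite lee_fin mulr_ge0 ?sqr_ge0.
have pe : (0 <= (@pi R)%:E)%E by rewrite lee_fin ltW.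
have mDF := measurable_fun_fubini_tonelli_F (m2 := mu) _ mDS DS0.
rewrite (ge0_integralZl _ _ mDF)//; last by move=> x _; exact: integral_ge0.
rewrite EFinM -muleA; apply: lee_wpmul2l => //.
rewrite (fubini_tonelli (m1 := nu) (m2 := mu) _ mDS DS0).
have mGt : measurable_fun setT (fun q : MR * M3 => (G q.1 q.2 ^+ 2 * pospart (sg * q.2.2))%:E).
  apply/measurable_EFinP; apply: measurable_funM => //; exact: measurable_funX.
have Gt0 (q : MR * M3) : (0 <= (G q.1 q.2 ^+ 2 * pospart (sg * q.2.2))%:E)%E.
  by rewrite lee_fin mulr_ge0 ?sqr_ge0 ?pospart_ge0.
have mGF := measurable_fun_fubini_tonelli_F (m2 := lam3) _ mGt Gt0.
rewrite -(ge0_integralZl _ _ mGF)//; last by move=> u _; exact: integral_ge0.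
apply: ge0_le_integral => //.
- by move=> u _; exact: integral_ge0.
- exact: (measurable_fun_fubini_tonelli_G (m1 := nu) _ mDS).
- exact: measurable_funeM.
move=> u _ /=.
have Du : 0 < oneDsqr u by exact: lt_le_trans (oneDsqr_ge1 u).
have ms : measurable_fun setT (fun x => (S k1 sg x u ^+ 2 + S k2 sg x u ^+ 2)%:E).
  apply/measurable_EFinP; apply: measurable_funD; apply: measurable_funX.
    exact: (@measurable_fun_pair1 _ _ _ _ _ _ _ u (mS sg mk1)).
  exact: (@measurable_fun_pair1 _ _ _ _ _ _ _ u (mS sg mk2)).
under eq_integral do rewrite EFinM.
rewrite (ge0_integralZl _ _ ms)//; last first.
  by move=> x _; rewrite lee_fin addr_ge0// sqr_ge0.
have := schur u sgE.
have De : (0 <= (oneDsqr u)%:E)%E by rewrite lee_fin.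
move=> /(lee_wpmul2l De); rewrite muleA -EFinM.
by rewrite (_ : oneDsqr u * (M0 / oneDsqr u) = M0)//; field; rewrite gt_eqF.
Qed.

(** The Jacobian |t| is the sum of its restrictions to the two signs of t. Each half is estimated
    separately, and recombining them by (p + q)^2 <= 2 (p^2 + q^2) accounts for the factor 2. *)
Theorem bilinear_bound :
  (\int[nu]_x ((\int[sprod lam2 lam2]_p (k1 (x, p) * (f p.1 * g p.2))) ^+ 2 +
               (\int[sprod lam2 lam2]_p (k2 (x, p) * (f p.1 * g p.2))) ^+ 2)%:E <=
   (2 * pi * M0)%:E * ((\int[lam2]_e ((f e) ^+ 2)%:E) * (\int[lam2]_e ((g e) ^+ 2)%:E)))%E.
Proof.
have o1 : (1 : R) = 1 \/ (1 : R) = -1 by left.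
have o2 : (-1 : R) = 1 \/ (-1 : R) = -1 by right.
have absE (t : R) : `|t| = pospart (1 * t) + pospart (-1 * t).
  rewrite /pospart mul1r mulN1r; have [t0|t0] := leP 0 t.
    by rewrite ger0_norm// max_r ?addr0// oppr_le0.
  by rewrite ltr0_norm// max_l ?add0r// oppr_ge0 ltW.
have F (kp : X * (M2 * M2) -> R) x : measurable_fun setT kp -> (forall p, `|kp (x, p)| <= B) ->
    \int[sprod lam2 lam2]_p (kp (x, p) * (f p.1 * g p.2)) =
    \int[mu]_u S kp 1 x u + \int[mu]_u S kp (-1) x u.
  move=> mk kpB; have [_ ->] := integral_polar (int_pair mk kpB).
  have [_ ->] := S_int mk kpB o1; have [_ ->] := S_int mk kpB o2.
  rewrite -RintegralD//; [|exact: int_sign..].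
  by apply: eq_Rintegral => p _; rewrite absE /G; ring.
pose I (kp : X * (M2 * M2) -> R) sg x := \int[mu]_u S kp sg x u.
have sq2 (a b a' b' : R) : (a + b) ^+ 2 + (a' + b') ^+ 2 <= 2 * (a ^+ 2 + a' ^+ 2 + (b ^+ 2 + b' ^+ 2)).
  by have := sqr_ge0 (a - b); have := sqr_ge0 (a' - b'); lra.
pose J sg x := (I k1 sg x ^+ 2 + I k2 sg x ^+ 2)%:E.
have p0 : 0 < @pi R by exact: pi_gt0.
have mF (kp : X * (M2 * M2) -> R) sg : measurable_fun setT kp -> measurable_fun setT (I kp sg).
  by move=> mk; exact: (measurable_Rintegral mu (mS sg mk)).
have mJ sg : measurable_fun setT (J sg).
  by apply/measurable_EFinP; apply: measurable_funD; apply: measurable_funX; exact: mF.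
have J0 sg x : (0 <= J sg x)%E by rewrite lee_fin addr_ge0// sqr_ge0.
apply: (@le_trans _ _ (2%:E * (\int[nu]_x J 1%R x + \int[nu]_x J (-1)%R x))%E).
  rewrite -ge0_integralD// -ge0_integralZl//.
  - apply: ge0_le_integral => //.
    + by move=> x _; rewrite lee_fin addr_ge0// sqr_ge0.
    + have mf' (kp : X * (M2 * M2) -> R) : measurable_fun setT kp -> (forall x p, `|kp (x, p)| <= B) ->
          measurable_fun setT (fun x => \int[sprod lam2 lam2]_p (kp (x, p) * (f p.1 * g p.2))).
        move=> mk kpB; under eq_fun => x do rewrite (F kp x mk (kpB x)).
        by apply: measurable_funD; exact: mF.
      apply/measurable_EFinP; apply: measurable_funD; apply: measurable_funX; apply: mf' => //.
        by move=> x p; exact: (kB x p).1.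
      by move=> x p; exact: (kB x p).2.
    + by apply: measurable_funeM; exact: emeasurable_funD.
    move=> x _.
    rewrite (F k1 x mk1 (fun p => (kB x p).1)) (F k2 x mk2 (fun p => (kB x p).2)).
    rewrite -EFinD -EFinM lee_fin -/(I k1 1 x) -/(I k1 (-1) x) -/(I k2 1 x) -/(I k2 (-1) x).
    exact: sq2.
  - exact: emeasurable_funD.
  - by move=> x _; rewrite adde_ge0.
have le := leeD (half o1) (half o2).
have e2 : (0 <= 2%:E :> \bar R)%E by rewrite lee_fin.
apply: (le_trans (lee_wpmul2l e2 le)).
have mGt sg : measurable_fun setT (fun q : MR * M3 => (G q.1 q.2 ^+ 2 * pospart (sg * q.2.2))%:E).
  apply/measurable_EFinP; apply: measurable_funM => //; exact: measurable_funX.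
have Gt0 sg (q : MR * M3) : (0 <= (G q.1 q.2 ^+ 2 * pospart (sg * q.2.2))%:E)%E.
  by rewrite lee_fin mulr_ge0 ?sqr_ge0 ?pospart_ge0.
have I0 sg u : (0 <= \int[lam3]_z (G u z ^+ 2 * pospart (sg * z.2))%:E)%E.
  by apply: integral_ge0 => z _; exact: (Gt0 sg (u, z)).
have II0 sg : (0 <= \int[mu]_u \int[lam3]_z (G u z ^+ 2 * pospart (sg * z.2))%:E)%E.
  by apply: integral_ge0 => u _; exact: I0.
rewrite -ge0_muleDr//.
rewrite -ge0_integralD//; last 2 first.
- exact: (measurable_fun_fubini_tonelli_F (m2 := lam3) _ (mGt 1) (Gt0 1)).
- exact: (measurable_fun_fubini_tonelli_F (m2 := lam3) _ (mGt (-1)) (Gt0 (-1))).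
have mH : measurable_fun setT (fun p : M2 * M2 => ((f p.1 * g p.2) ^+ 2)%:E).
  apply/measurable_EFinP; apply: measurable_funX; apply: measurable_funM.
    exact: (measurableT_comp mf measurable_fst).
  exact: (measurableT_comp mg measurable_snd).
have H0 (p : M2 * M2) : (0 <= ((f p.1 * g p.2) ^+ 2)%:E)%E by rewrite lee_fin sqr_ge0.
(* On the right the two signs add up to |t| again, so the change of variables is undone and the
   integral of (f g)^2 factors. *)
rewrite (_ : \int[mu]_u _ = \int[sprod lam2 lam2]_p ((f p.1 * g p.2) ^+ 2)%:E)%E; last first.
  rewrite (ge0_integral_polar mH H0); apply: eq_integral => u _.
  rewrite -ge0_integralD//.
  - by apply: eq_integral => z _; rewrite -EFinD -EFinM absE mulrDr.
  - by move=> z _; exact: (Gt0 1 (u, z)).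
  - exact: (@measurable_fun_pair2 _ _ _ _ _ _ _ u (mGt 1)).
  - by move=> z _; exact: (Gt0 (-1) (u, z)).
  - exact: (@measurable_fun_pair2 _ _ _ _ _ _ _ u (mGt (-1))).
rewrite (fubini_tonelli1 (m1 := lam2) (m2 := lam2) _ mH H0) /fubini_F /=.
have mf2 : measurable_fun setT (fun e => (f e ^+ 2)%:E).
  by apply/measurable_EFinP; exact: measurable_funX.
have mg2 : measurable_fun setT (fun e => (g e ^+ 2)%:E).
  by apply/measurable_EFinP; exact: measurable_funX.
have f2 (e : M2) : (0 <= (f e ^+ 2)%:E)%E by rewrite lee_fin sqr_ge0.
have g2 (e : M2) : (0 <= (g e ^+ 2)%:E)%E by rewrite lee_fin sqr_ge0.
have E (x : M2) : (\int[lam2]_y ((f x * g y) ^+ 2)%:E = (f x ^+ 2)%:E * \int[lam2]_y (g y ^+ 2)%:E)%E.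
  rewrite -(ge0_integralZl _ _ mg2)//.
  by apply: eq_integral => y _; rewrite exprMn EFinM.
under eq_integral do rewrite E.
rewrite ge0_integralZr//; last exact: integral_ge0.
by rewrite muleA -EFinM -mulrA.
Qed.

End Bilinear.
End BilinearBound.

(** * The gradient of the two-body phase *)

Section KernelEstimate.
Context {R : realType}.
Notation V := (R3 R * R2 R)%type.
Notation M3 := (measurableTypeR R * measurableTypeR R * measurableTypeR R)%type.
Notation M2 := (measurableTypeR R * measurableTypeR R)%type.
Definition ex (a : 'I_3) : V := (e3 R a, 0).
Definition ez (j : 'I_2) : V := (0, e2 R j).

Lemma ez0E : ez 0 = (0, (1, 0)). Proof. by rewrite /ez /e2. Qed.

Lemma ez1E : ez 1 = (0, (0, 1)). Proof. by rewrite /ez /e2. Qed.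

Lemma pairZ (S T : lmodType R) k (x : S) (y : T) : k *: (x, y) = (k *: x, k *: y).
Proof. by []. Qed.

Lemma lin_ez (x : R3 R) (e1 e2 c1 c2 : R) :
  ((x, (e1, e2)) : V) + c1 *: ez 0 + c2 *: ez 1 = (x, (e1 + c1, e2 + c2)).
Proof.
rewrite ez0E ez1E !pairZ !pairD !scaler0 !addr0.
by rewrite /= [c1 *: 1]mulr1 [c2 *: 1]mulr1; case: x => -[].
Qed.

Lemma lin_ez0 (x : R3 R) (e1 e2 c1 : R) :
  ((x, (e1, e2)) : V) + c1 *: ez 0 = (x, (e1 + c1, e2)).
Proof. by rewrite ez0E !pairZ !pairD !scaler0 !addr0 /= [c1 *: 1]mulr1; case: x => -[]. Qed.

Lemma pair_ball (p0 p : V) (r : R) : `|p.1 - p0.1| <= r -> `|p.2 - p0.2| <= r -> `|p - p0| <= r.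
Proof. by move=> h1 h2; rewrite prod_normE ge_max h1 h2. Qed.

(** With [Q] equal to [phi] this is the phase of the kernel between z and z'; with [Q] an
    x-derivative of [phi] it is the same derivative of that phase. *)
Definition two_body (Q : V -> R) (a b u : R) (z z' : M3) (x : R3 R) : R :=
  a * Q (x, (polar_point u z').1) + b * Q (x, (polar_point u z').2) -
  (a * Q (x, (polar_point u z).1) + b * Q (x, (polar_point u z).2)).

Definition shift1 (g : R) (z z' : M3) : R := z'.1.1 - z.1.1 + g * (z'.2 - z.2).
Definition shift2 (g u : R) (z z' : M3) : R := z'.1.2 - z.1.2 + g * (z'.2 - z.2) * u.

(** The large parameter of the integrations by parts: the sum of the absolute values of the three
    coefficients in the expansion. The factor 1 + u^2 is put into the last coefficient so that the
    vector it multiplies stays bounded in u. *)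
Definition separation (a b u : R) (z z' : M3) : R :=
  (a + b) * (`|shift1 (a / (a + b)) z z'| + `|shift2 (a / (a + b)) u z z'|) +
  a * b / (a + b) * `|z'.2 ^+ 2 - z.2 ^+ 2| * (1 + u ^+ 2).

(** The sign of t is absorbed into the direction [E], so that the expansion applies with the
    positive relative coordinates [sg * z.2] and [sg * z'.2]. *)
Lemma two_body_estimate U Q p0 (r e : R) (A1 A2 A11 A12 A21 A22 : R) (a b u sg : R) (z z' : M3) (x : R3 R) :
  open U -> smooth_on U Q ->
  (forall p, `|p - p0| <= 3 * r -> U p /\
    [/\ `|'D_(ez 0) Q p - A1| <= e, `|'D_(ez 1) Q p - A2| <= e,
        `|'D_(ez 0) ('D_(ez 0) Q) p - A11| <= e, `|'D_(ez 0) ('D_(ez 1) Q) p - A12| <= e &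
        `|'D_(ez 1) ('D_(ez 0) Q) p - A21| <= e /\ `|'D_(ez 1) ('D_(ez 1) Q) p - A22| <= e]) ->
  0 < a -> 0 < b -> sg = 1 \/ sg = -1 -> 0 < sg * z.2 -> 0 < sg * z'.2 ->
  `|x - p0.1| <= r ->
  `|(polar_point u z).1 - p0.2| <= r -> `|(polar_point u z).2 - p0.2| <= r ->
  `|(polar_point u z').1 - p0.2| <= r -> `|(polar_point u z').2 - p0.2| <= r ->
  `|two_body Q a b u z z' x -
    ((a + b) * (A1 * shift1 (a / (a + b)) z z' + A2 * shift2 (a / (a + b)) u z z') +
     a * b / (a + b) / 2 * (z'.2 ^+ 2 - z.2 ^+ 2) * (A11 + u * (A12 + A21) + u ^+ 2 * A22))|
  <= e * separation a b u z z'.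
Proof.
move=> oU sQ HB a0 b0 sgE t0 t'0 xb b1 b2 b3 b4.
have ab0 : a + b != 0 by rewrite gt_eqF ?addr_gt0.
have sg2 : sg ^+ 2 = 1 by case: sgE => ->; rewrite ?sqrrN expr1n.
pose g := a / (a + b).
pose w : V := (x, (z.1.1 + g * z.2, z.1.2 + g * z.2 * u)).
pose E : V := sg *: ez 0 + (sg * u) *: ez 1.
pose d1 := shift1 g z z'; pose d2 := shift2 g u z z'.
have addE (v : V) (k : R) : v + k *: E = v + (k * sg) *: ez 0 + (k * sg * u) *: ez 1.
  by rewrite /E scalerDr !scalerA addrA mulrA.
have subE (v : V) (k : R) : v - k *: E = v + (- (k * sg)) *: ez 0 + (- (k * sg * u)) *: ez 1.
  by rewrite -scaleNr addE !mulNr.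
have sgsg (x0 y0 : R) : x0 * (sg * y0) * sg = x0 * y0.
  by rewrite -mulrA [sg * y0]mulrC -mulrA -expr2 sg2 mulr1.
have W1 : w + (b / (a + b) * (sg * z.2)) *: E = (x, (polar_point u z).1).
  rewrite addE lin_ez !sgsg /polar_point /g; congr (_, (_, _)) => /=; field => //.
have W2 : w - (a / (a + b) * (sg * z.2)) *: E = (x, (polar_point u z).2).
  rewrite subE lin_ez !sgsg /polar_point /g; congr pair => /=.
  by rewrite [RHS]surjective_pairing; congr pair; field.
have wd : w + d1 *: ez 0 + d2 *: ez 1 = (x, (z'.1.1 + g * z'.2, z'.1.2 + g * z'.2 * u)).
  rewrite lin_ez /d1 /d2 /shift1 /shift2; congr (_, (_, _)); ring.
have W3 : w + d1 *: ez 0 + d2 *: ez 1 + (b / (a + b) * (sg * z'.2)) *: E = (x, (polar_point u z').1).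
  rewrite wd addE lin_ez !sgsg /polar_point /g; congr (_, (_, _)) => /=; field => //.
have W4 : w + d1 *: ez 0 + d2 *: ez 1 - (a / (a + b) * (sg * z'.2)) *: E = (x, (polar_point u z').2).
  rewrite wd subE lin_ez !sgsg /polar_point /g; congr pair => /=.
  by rewrite [RHS]surjective_pairing; congr pair; field.
have W5 : w + d1 *: ez 0 = (x, (z'.1.1 + g * z'.2, z.1.2 + g * z.2 * u)).
  rewrite lin_ez0 /d1 /shift1; congr (_, (_, _)); ring.
have sq (y : R) : (sg * y) ^+ 2 = y ^+ 2 by rewrite exprMn sg2 mul1r.
have := @two_body_expansion R V U Q p0 r e (ez 0) (ez 1) A1 A2 A11 A12 A21 A22 a b (sg * z.2) (sg * z'.2)
  sg u d1 d2 w E oU sQ a0 b0 t0 t'0 sg2 erefl HB.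
rewrite W1 W2 W3 W4 W5 !sq; apply.
- exact: pair_ball.
- exact: pair_ball.
- exact: pair_ball.
- exact: pair_ball.
have g01 : 0 <= g <= 1.
  have ab1 : 0 < a + b by exact: addr_gt0.
  apply/andP; split; first by apply: divr_ge0; exact: ltW.
  by rewrite ler_pdivrMr// mul1r lerDl ltW.
(* The corner of the path takes its first frequency coordinate from z' and its second from z. In the
   maximum norm each coordinate may be treated alone, and each is a convex combination of those of
   the two particles. *)
have conv (y q v : R) : `|y + q - v| <= r -> `|y - v| <= r -> `|y + g * q - v| <= r.
  rewrite !ler_norml => /andP[h1 h2] /andP[h3 h4]; case/andP: g01 => g0 g1.
  by apply/andP; split; nra.
apply: pair_ball => //=.
move: b1 b2 b3 b4; rewrite !prod_normE !ge_max /polar_point /=.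
move=> /andP[b11 b12] /andP[b21 b22] /andP[b31 b32] /andP[b41 b42].
by apply/andP; split; [exact: conv|rewrite -mulrA; exact: conv].
Qed.

Lemma bounded_family_line (W : normedModType R) (I : Type) (D : set R) (F : I -> W -> R)
    (U : set W) (q : I -> W) (e : W) (n : nat) :
  (forall i, smooth_on U (F i)) -> (forall i v, D v -> U (q i + v *: e)) ->
  (forall n, exists M, forall i v, D v -> `|Defs.iterD (nseq n e) (F i) (q i + v *: e)| <= M) ->
  bounded_family D n (fun i v => F i (q i + v *: e)).
Proof.
elim: n F => [|n IH] F sF qU FM.
  by split => //; have [M HM] := FM 0%N; exists M.
split; first by have [M HM] := FM 0%N; exists M.
exists (fun i v => 'D_e (F i) (q i + v *: e)).
  move=> i v Dv; apply: is_derive_line; exact: (smooth_on_derivable (v := e) (sF i) (qU i v Dv)).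
apply: (IH (fun i => 'D_e (F i))) => //.
- by move=> i; exact: smooth_on_derive.
- move=> m; have [M HM] := FM m.+1; exists M => i v Dv.
  have -> : Defs.iterD (nseq m e) ('D_e (F i)) = Defs.iterD (nseq m.+1 e) (F i).
    by rewrite /Defs.iterD -(foldr_rcons (fun v (g : W -> R) => 'D_v g)) -[rcons _ _]cats1 -(addn1 m) nseqD.
  exact: HM.
Qed.

(** [A1 a] and [A2 a] stand for the coordinate on axis [a] of d_1 P and d_2 P at the centre, and
    [A11 a] to [A22 a] for that of the second xi-derivatives of P. *)
Definition derivatives_close (phi : V -> R) (p0 : V) (s c : R)
    (A1 A2 A11 A12 A21 A22 : 'I_3 -> R) : Prop :=
  forall a p, `|p - p0| <= s -> let Q := 'D_(ex a) phi in
    [/\ `|'D_(ez 0) Q p - A1 a| <= c, `|'D_(ez 1) Q p - A2 a| <= c,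
      `|'D_(ez 0) ('D_(ez 0) Q) p - A11 a| <= c, `|'D_(ez 0) ('D_(ez 1) Q) p - A12 a| <= c &
      `|'D_(ez 1) ('D_(ez 0) Q) p - A21 a| <= c /\ `|'D_(ez 1) ('D_(ez 1) Q) p - A22 a| <= c].

(** Linear independence of d_1 P, d_2 P and (d_1 + u d_2)^2 P / (1 + u^2), made quantitative and
    uniform in u. The factor 2 leaves room for the tolerance [c] of [derivatives_close]. *)
Definition axis_dominates (c : R) (A1 A2 A11 A12 A21 A22 : 'I_3 -> R) : Prop :=
  forall u X Y Z : R, exists a, 2 * c * (`|X| + `|Y| + `|Z|) <=
    `|A1 a * X + A2 a * Y + (A11 a + u * (A12 a + A21 a) + u ^+ 2 * A22 a) / (2 * (1 + u ^+ 2)) * Z|.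

Lemma closed_ball_prod (V1 V2 : normedModType R) (p0 : V1 * V2) (s : R) :
  [set p : V1 * V2 | `|p - p0| <= s] = [set q | `|q - p0.1| <= s] `*` [set q | `|q - p0.2| <= s].
Proof.
apply/seteqP; split => p; rewrite /= prod_normE ge_max; first by move/andP.
by move=> h; apply/andP.
Qed.

Lemma compact_patch (p0 : V) (s : R) : compact [set p : V | `|p - p0| <= s].
Proof.
have c1 (y : R) : compact [set q : R | `|q - y| <= s].
  have -> : [set q : R | `|q - y| <= s] = `[y - s, y + s]%classic.
    by apply/seteqP; split => q; rewrite /= in_itv /= ler_distl.
  exact: segment_compact.
by rewrite !closed_ball_prod; do ! apply: compact_setX.
Qed.

Lemma bounded_on_patch (U : set V) (f : V -> R) p0 (s : R) : smooth_on U f ->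
  (forall p, `|p - p0| <= s -> U p) -> exists M, forall p, `|p - p0| <= s -> `|f p| <= M.
Proof.
move=> sf bU.
have cf : {within [set p : V | `|p - p0| <= s], continuous f}.
  by apply: continuous_in_subspaceT => p /set_mem/bU/(smooth_on_continuous sf).
have /compact_bounded[M [_ HM]] := continuous_compact cf (@compact_patch p0 s).
exists (M + 1) => p ps; apply: (HM (M + 1)); first by rewrite ltrDl.
by exists p.
Qed.

(** * Decay of the kernel on a patch, and the bilinear bound for real amplitudes *)

Section Patch.
Variables (U : set V) (phi : V -> R) (p0 : V) (r c : R) (A1 A2 A11 A12 A21 A22 : 'I_3 -> R).
Hypotheses (oU : open U) (sphi : smooth_on U phi) (r0 : 0 < r) (c0 : 0 < c)
  (ballU : forall p, `|p - p0| <= 12 * r -> U p)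
  (ball_close : derivatives_close phi p0 (12 * r) c A1 A2 A11 A12 A21 A22)
  (nondegenerate : axis_dominates c A1 A2 A11 A12 A21 A22).

(** All parameters of a one-dimensional oscillatory integral, gathered in one type so that it can
    serve as the index of bounded families. *)
Record datum := Datum { d_a : R; d_b : R; d_u : R; d_s : R; d_z : M3; d_z' : M3; d_y : R3 R }.
Implicit Types d : datum.

Definition d_sep d := separation (d_a d) (d_b d) (d_u d) (d_z d) (d_z' d).
Definition d_main d (a : 'I_3) : R :=
  let g := d_a d / (d_a d + d_b d) in
  (d_a d + d_b d) * (A1 a * shift1 g (d_z d) (d_z' d) + A2 a * shift2 g (d_u d) (d_z d) (d_z' d)) +
  d_a d * d_b d / (d_a d + d_b d) / 2 * ((d_z' d).2 ^+ 2 - (d_z d).2 ^+ 2) *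
    (A11 a + d_u d * (A12 a + A21 a) + d_u d ^+ 2 * A22 a).

Definition admissible d : Prop :=
  [/\ 1 <= d_a d, 1 <= d_b d, d_s d = 1 \/ d_s d = -1,
    0 < d_s d * (d_z d).2 /\ 0 < d_s d * (d_z' d).2 &
    [/\ `|(polar_point (d_u d) (d_z d)).1 - p0.2| <= r, `|(polar_point (d_u d) (d_z d)).2 - p0.2| <= r,
      `|(polar_point (d_u d) (d_z' d)).1 - p0.2| <= r & `|(polar_point (d_u d) (d_z' d)).2 - p0.2| <= r]].

(** [d_y d] is the point of the line with coordinate zero on the axis; in the maximum norm the
    second condition says that the line meets the ball of radius r. The last one says that the axis
    has been well chosen. *)
Definition axis_admissible a d : Prop :=
  [/\ admissible d /\ coord3 (d_y d) a = 0, `|d_y d + coord3 p0.1 a *: e3 R a - p0.1| <= r, 0 < d_sep d &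
    2 * c * d_sep d <= `|d_main d a|].

(** Amplitudes live within r of the centre, integrals run over radius 2 r, and this open interval of
    radius 3 r surrounds them. Points of an admissible line over it are within 4 r of the centre,
    and the two-body expansion triples that: hence 12 r. *)
Let Dx a : set R := `](coord3 p0.1 a - 3 * r), (coord3 p0.1 a + 3 * r)[.

Lemma line_ball a d v : axis_admissible a d -> Dx a v -> `|d_y d + v *: e3 R a - p0.1| <= 4 * r.
Proof.
move=> [_ h _ _]; rewrite /Dx /= in_itv /= => vI.
have -> : d_y d + v *: e3 R a - p0.1 =
    (d_y d + coord3 p0.1 a *: e3 R a - p0.1) + (v - coord3 p0.1 a) *: e3 R a.
  by rewrite scalerBl [d_y d + coord3 p0.1 a *: _ - _]addrAC -[RHS]addrA [coord3 _ _ *: _ + _]addrC subrK addrAC.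
apply: le_trans (ler_normD _ _) _.
have -> : 4 * r = r + 3 * r by ring.
apply: lerD => //; rewrite normrZ.
have vr : `|v - coord3 p0.1 a| <= 3 * r by rewrite ler_norml; apply/andP; split; lra.
by apply: le_trans (ler_wpM2l _ (norm_e3 a)) _; rewrite ?normr_ge0// mulr1.
Qed.

Lemma sep_ge0 a b u z z' : 0 < a -> 0 < b -> 0 <= separation a b u z z'.
Proof.
move=> a0 b0; have ab0 : 0 < a + b by exact: addr_gt0.
apply: addr_ge0; first by apply: mulr_ge0; [exact: ltW|exact: addr_ge0].
apply: mulr_ge0; last by rewrite addr_ge0// sqr_ge0.
by apply: mulr_ge0 => //; apply: divr_ge0; [apply: mulr_ge0|]; exact: ltW.
Qed.

Definition line_phase (Q : V -> R) a d v : R :=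
  two_body Q (d_a d) (d_b d) (d_u d) (d_z d) (d_z' d) (d_y d + v *: e3 R a).

Lemma line_pair (y : R3 R) a v (e : R2 R) : (y + v *: e3 R a, e) = ((y, e) : V) + v *: ex a.
Proof. by rewrite /ex pairZ pairD scaler0 addr0. Qed.

Lemma line_in_U a d v e : axis_admissible a d -> Dx a v -> `|e - p0.2| <= r ->
  U ((d_y d, e) + v *: ex a).
Proof.
move=> ad Dv er; rewrite -line_pair; apply: ballU; apply: pair_ball => /=.
  by apply: le_trans (line_ball ad Dv) _; have := r0; lra.
by apply: le_trans er _; have := r0; lra.
Qed.

Lemma line_phase_derive Q a d v : smooth_on U Q -> axis_admissible a d -> Dx a v ->
  is_derive v 1 (line_phase Q a d) (line_phase ('D_(ex a) Q) a d v).
Proof.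
move=> sQ ad Dv; have [[[_ _ _ _ [h1 h2 h3 h4]] _] _ _ _] := ad.
have L e : `|e - p0.2| <= r -> is_derive v 1 (fun v => Q (d_y d + v *: e3 R a, e))
    ('D_(ex a) Q (d_y d + v *: e3 R a, e)).
  move=> er; rewrite line_pair; under eq_fun do rewrite line_pair.
  apply: is_derive_line; exact: (smooth_on_derivable (v := ex a) sQ (line_in_U ad Dv er)).
apply: is_deriveBf; apply: is_deriveDf; apply: is_derive_scale; exact: L.
Qed.
Let rho (Q : V -> R) a (i : {d | axis_admissible a d}) v : R :=
  line_phase Q a (sval i) v / d_sep (sval i).

(** Differentiating along the line replaces [Q] by ['D_(ex a) Q], so all orders follow from one
    upper bound. That bound is the two-body estimate with every A equal to zero: the first and
    second xi-derivatives of [Q] are bounded on the patch, and the increment is at most that bound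
    times the separation. *)
Lemma rho_family Q a n : smooth_on U Q ->
  bounded_family (Dx a) n (rho Q (a := a)).
Proof.
have sb0 (x y z : R) : `|x| <= y -> y <= z -> `|x - 0| <= z by rewrite subr0; exact: le_trans.
have zero (s x y m q u : R) : s * (0 * x + 0 * y) + m * q * (0 + u * (0 + 0) + u ^+ 2 * 0) = 0.
  by ring.
have bd (Q' : V -> R) : smooth_on U Q' ->
    exists M : R, forall (i : {d | axis_admissible a d}) v, Dx a v -> `|rho Q' i v| <= M.
  move=> sQ.
  have s1 := smooth_on_derive (ez 0) sQ; have s2 := smooth_on_derive (ez 1) sQ.
  have [m1 H1] := bounded_on_patch s1 ballU; have [m2 H2] := bounded_on_patch s2 ballU.
  have [m3 H3] := bounded_on_patch (smooth_on_derive (ez 0) s1) ballU.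
  have [m4 H4] := bounded_on_patch (smooth_on_derive (ez 0) s2) ballU.
  have [m5 H5] := bounded_on_patch (smooth_on_derive (ez 1) s1) ballU.
  have [m6 H6] := bounded_on_patch (smooth_on_derive (ez 1) s2) ballU.
  pose M := `|m1| + `|m2| + `|m3| + `|m4| + `|m5| + `|m6|.
  have n1 := normr_ge0 m1; have n2 := normr_ge0 m2; have n3 := normr_ge0 m3.
  have n4 := normr_ge0 m4; have n5 := normr_ge0 m5; have n6 := normr_ge0 m6.
  have l1 := ler_norm m1; have l2 := ler_norm m2; have l3 := ler_norm m3.
  have l4 := ler_norm m4; have l5 := ler_norm m5; have l6 := ler_norm m6.
  have k1 : m1 <= M by rewrite /M; lra.
  have k2 : m2 <= M by rewrite /M; lra.
  have k3 : m3 <= M by rewrite /M; lra.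
  have k4 : m4 <= M by rewrite /M; lra.
  have k5 : m5 <= M by rewrite /M; lra.
  have k6 : m6 <= M by rewrite /M; lra.
  clearbody M; clear l1 l2 l3 l4 l5 l6 n1 n2 n3 n4 n5 n6.
  exists M => -[d ad] v Dv; rewrite /rho /=.
  have [[[a1 b1 sE [t0 t'0] [h1 h2 h3 h4]] _] _ s0 _] := ad.
  have a0 : 0 < d_a d by exact: lt_le_trans a1.
  have b0 : 0 < d_b d by exact: lt_le_trans b1.
  have r4 (e : R2 R) : `|e - p0.2| <= r -> `|e - p0.2| <= 4 * r by have := r0; lra.
  rewrite normrM normfV [`|d_sep d|]gtr0_norm// ler_pdivrMr//.
  have HB (p : V) : `|p - p0| <= 3 * (4 * r) -> U p /\
    [/\ `|'D_(ez 0) Q' p - 0| <= M, `|'D_(ez 1) Q' p - 0| <= M,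
        `|'D_(ez 0) ('D_(ez 0) Q') p - 0| <= M, `|'D_(ez 0) ('D_(ez 1) Q') p - 0| <= M &
        `|'D_(ez 1) ('D_(ez 0) Q') p - 0| <= M /\ `|'D_(ez 1) ('D_(ez 1) Q') p - 0| <= M].
    have -> : 3 * (4 * r) = 12 * r by ring.
    move=> pb; split; first exact: ballU.
    split; [exact: sb0 (H1 p pb) k1|exact: sb0 (H2 p pb) k2|exact: sb0 (H3 p pb) k3|
      exact: sb0 (H4 p pb) k4|split; [exact: sb0 (H5 p pb) k5|exact: sb0 (H6 p pb) k6]].
  have := two_body_estimate oU sQ HB a0 b0 sE t0 t'0 (line_ball ad Dv)
    (r4 _ h1) (r4 _ h2) (r4 _ h3) (r4 _ h4).
  by rewrite zero subr0.
elim: n Q => [|n IH] Q sQ; first by split => //; exact: bd.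
split; first exact: bd.
exists (rho ('D_(ex a) Q) (a := a)); last by apply: IH; exact: smooth_on_derive.
move=> [d ad] v Dv; rewrite /rho /=.
under eq_fun do rewrite mulrC.
rewrite mulrC; apply: is_derive_scale; exact: line_phase_derive.
Qed.

(** The main term is at least 2 c times the separation and the error at most c times it. *)
Lemma rho_ge a (i : {d | axis_admissible a d}) v : Dx a v ->
  c <= `|rho ('D_(ex a) phi) i v|.
Proof.
case: i => d ad Dv; rewrite /rho /=.
have [[[a1 b1 sE [t0 t'0] [h1 h2 h3 h4]] _] _ s0 dom] := ad.
have a0 : 0 < d_a d by exact: lt_le_trans a1.
have b0 : 0 < d_b d by exact: lt_le_trans b1.
have r4 (e : R2 R) : `|e - p0.2| <= r -> `|e - p0.2| <= 4 * r by have := r0; lra.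
rewrite normrM normfV [`|d_sep d|]gtr0_norm// ler_pdivlMr//.
have HB (p : V) : `|p - p0| <= 3 * (4 * r) -> let Q := 'D_(ex a) phi in U p /\
    [/\ `|'D_(ez 0) Q p - A1 a| <= c, `|'D_(ez 1) Q p - A2 a| <= c,
        `|'D_(ez 0) ('D_(ez 0) Q) p - A11 a| <= c, `|'D_(ez 0) ('D_(ez 1) Q) p - A12 a| <= c &
        `|'D_(ez 1) ('D_(ez 0) Q) p - A21 a| <= c /\ `|'D_(ez 1) ('D_(ez 1) Q) p - A22 a| <= c].
  have -> : 3 * (4 * r) = 12 * r by ring.
  by move=> pb; split; [exact: ballU|exact: ball_close].
have := two_body_estimate oU (smooth_on_derive (ex a) sphi) HB a0 b0 sE t0 t'0 (line_ball ad Dv)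
    (r4 _ h1) (r4 _ h2) (r4 _ h3) (r4 _ h4).
rewrite -/(d_main d a) -/(d_sep d) -/(line_phase _ a d v) => h.
have : `|d_main d a| <= `|line_phase ('D_(ex a) phi) a d v| + c * d_sep d.
  rewrite -lerBlDl; apply: (le_trans (lerB_dist _ _)); rewrite distrC; exact: h.
have num (x y C' S' : R) : 2 * C' * S' <= x -> x <= y + C' * S' -> C' * S' <= y by lra.
exact: num dom.
Qed.

Variables (b1 b2 : R -> V -> R).
Hypotheses (sb1 : forall nu, 1 <= nu -> smooth_on setT (b1 nu))
  (sb2 : forall nu, 1 <= nu -> smooth_on setT (b2 nu))
  (bb1 : forall vs, exists M : R, forall nu p, 1 <= nu -> `|Defs.iterD vs (b1 nu) p| <= M)
  (bb2 : forall vs, exists M : R, forall nu p, 1 <= nu -> `|Defs.iterD vs (b2 nu) p| <= M)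
  (b1_supp : forall nu p, 1 <= nu -> b1 nu p != 0 -> `|p - p0| <= r)
  (b2_supp : forall nu p, 1 <= nu -> b2 nu p != 0 -> `|p - p0| <= r).

Definition amplitude d (x : R3 R) : R :=
  b1 (d_a d) (x, (polar_point (d_u d) (d_z d)).1) * b2 (d_b d) (x, (polar_point (d_u d) (d_z d)).2) *
  (b1 (d_a d) (x, (polar_point (d_u d) (d_z' d)).1) * b2 (d_b d) (x, (polar_point (d_u d) (d_z' d)).2)).

Definition phase d x := two_body phi (d_a d) (d_b d) (d_u d) (d_z d) (d_z' d) x.

Lemma amplitude_family a n : bounded_family (Dx a) n
  (fun (i : {d | axis_admissible a d}) v => amplitude (sval i) (d_y (sval i) + v *: e3 R a)).
Proof.
have L (b : R -> V -> R) (nu : {d | axis_admissible a d} -> R) (e : {d | axis_admissible a d} -> R2 R) :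
   (forall i, 1 <= nu i) ->
   (forall nu, 1 <= nu -> smooth_on setT (b nu)) ->
   (forall vs, exists M : R, forall nu p, 1 <= nu -> `|Defs.iterD vs (b nu) p| <= M) ->
   bounded_family (Dx a) n (fun i v => b (nu i) (d_y (sval i) + v *: e3 R a, e i)).
  move=> nu1 sb bb.
  have := @bounded_family_line V _ (Dx a) (fun i => b (nu i)) setT
    (fun i => (d_y (sval i), e i)) (ex a) n.
  move=> H; have {}H : bounded_family (Dx a) n (fun i v => b (nu i) ((d_y (sval i), e i) + v *: ex a)).
    apply: H => //; first by move=> i; exact: sb.
    by move=> m; have [M HM] := bb (nseq m (ex a)); exists M => i v _; exact: HM.
  suff -> : (fun (i : {d | axis_admissible a d}) v => b (nu i) (d_y (sval i) + v *: e3 R a, e i)) =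
     (fun i v => b (nu i) ((d_y (sval i), e i) + v *: ex a)) by [].
  by apply/funext => i; apply/funext => v; rewrite line_pair.
have nu1 (i : {d | axis_admissible a d}) : 1 <= d_a (sval i) by case: i => d [[[]]].
have nu2 (i : {d | axis_admissible a d}) : 1 <= d_b (sval i) by case: i => d [[[]]].
by apply: bounded_familyM; apply: bounded_familyM; apply: L.
Qed.

Lemma axis_integral_le a N : exists C : R, forall d, axis_admissible a d ->
  `|\int[lebesgue_measure]_(v in `[coord3 p0.1 a - 2 * r, coord3 p0.1 a + 2 * r])
     (cos (phase d (d_y d + v *: e3 R a)) * amplitude d (d_y d + v *: e3 R a))| <=
  C * d_sep d ^- N.
Proof.
have r0' := r0.
have dth (i : {d | axis_admissible a d}) v : Dx a v ->
    is_derive v 1 (fun v => phase (sval i) (d_y (sval i) + v *: e3 R a))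
      (d_sep (sval i) * rho ('D_(ex a) phi) i v).
  case: i => d ad Dv /=; rewrite /rho /=; have [_ _ s0 _] := ad.
  rewrite mulrC divfK ?gt_eqF//; exact: line_phase_derive.
have l1 : coord3 p0.1 a - 3 * r < coord3 p0.1 a - 2 * r by lra.
have l2 : coord3 p0.1 a - 2 * r < coord3 p0.1 a + 2 * r by lra.
have l3 : coord3 p0.1 a + 2 * r < coord3 p0.1 a + 3 * r by lra.
have l4 : coord3 p0.1 a - 2 * r < coord3 p0.1 a - r by lra.
have l5 : coord3 p0.1 a + r < coord3 p0.1 a + 2 * r by lra.
have rf n := rho_family a n (smooth_on_derive (ex a) sphi).
have H := nonstationary_phase l1 l2 l3 l4 l5 c0 dth (@rho_ge a) rf (amplitude_family a N.+1).
have := H.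
case.
  move=> i x Dx'.
  apply: contraNeq; case: i => d ad; have [[adm y0] _ _ _] := ad; have [nu1 _ _ _ _] := adm.
  rewrite /amplitude /= mulf_eq0 negb_or mulf_eq0 negb_or => /andP[/andP[/(b1_supp nu1) h _] _].
  rewrite in_itv /=.
  have : `|coord3 (d_y d + x *: e3 R a - p0.1) a| <= r.
    apply: le_trans (coord3_le _ _) _; move: h; rewrite prod_normE ge_max => /andP[h _]; exact: h.
  rewrite -[- p0.1]scaleN1r !coord3D !coord3Z coord3_e3 eqxx y0 add0r mulr1 mulN1r ler_norml.
  by move=> /andP[q1 q2]; apply/andP; split; lra.
move=> C HC; exists C => d ad; have [_ _ s0 _] := ad.
by have [h _] := HC (exist _ d ad) s0.
Qed.

Definition osc_cos (b : R -> V -> R) nu (p : V) : R := cos (nu * phi p) * b nu p.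
Definition osc_sin (b : R -> V -> R) nu (p : V) : R := sin (nu * phi p) * b nu p.

(** The phase is smooth only on [U], but outside the patch the amplitude vanishes in a
    neighbourhood, so the product is continuous on the whole space. *)
Lemma osc_continuous b nu : 1 <= nu -> smooth_on setT (b nu) ->
  (forall p, b nu p != 0 -> `|p - p0| <= r) ->
  continuous (osc_cos b nu) /\ continuous (osc_sin b nu).
Proof.
move=> nu1 sb bs.
have L (tr : R -> R) : continuous tr -> continuous (fun p => tr (nu * phi p) * b nu p).
  move=> ctr p; have [pr|pr] := leP `|p - p0| (12 * r).
    apply: continuousM; last exact: (smooth_on_continuous sb).
    apply: (@continuous_comp _ _ _ (fun p => nu * phi p) tr); last exact: ctr.
    apply: continuousM; first exact: cvg_cst.
    exact: (smooth_on_continuous sphi (ballU pr)).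
  have E : \forall q \near p, tr (nu * phi q) * b nu q = 0.
    near=> q.
    have qr : r < `|q - p0|.
      have h1 : `|p - q| < r by near: q; exact: (@cvgr_dist_lt _ _ _ (nbhs p) _ id p (@cvg_id _ _) r r0).
      have := ler_distD q p p0; have := r0; lra.
    have -> : b nu q = 0 by apply/eqP; apply: contraTT qr => /bs; rewrite -leNgt.
    by rewrite mulr0.
  rewrite /continuous_at (nbhs_singleton E).
  by apply: cvg_near_cst.
by split; apply: L; [exact: continuous_cos|exact: continuous_sin].
Unshelve. all: by end_near.
Qed.

(** [kern1] and [kern2] are the real and imaginary parts of the product of the two oscillating
    kernels; the expanded form shows them as polynomials in functions known to be continuous. *)
Definition kern1 (a b : R) (q : M3 * (M2 * M2)) : R :=
  osc_cos b1 a (q.1, q.2.1) * osc_cos b2 b (q.1, q.2.2) -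
  osc_sin b1 a (q.1, q.2.1) * osc_sin b2 b (q.1, q.2.2).
Definition kern2 (a b : R) (q : M3 * (M2 * M2)) : R :=
  osc_sin b1 a (q.1, q.2.1) * osc_cos b2 b (q.1, q.2.2) +
  osc_cos b1 a (q.1, q.2.1) * osc_sin b2 b (q.1, q.2.2).

Lemma kern1E a b q : kern1 a b q =
  cos (a * phi (q.1, q.2.1) + b * phi (q.1, q.2.2)) * (b1 a (q.1, q.2.1) * b2 b (q.1, q.2.2)).
Proof. by rewrite /kern1 /osc_cos /osc_sin cosD; ring. Qed.

Lemma kern2E a b q : kern2 a b q =
  sin (a * phi (q.1, q.2.1) + b * phi (q.1, q.2.2)) * (b1 a (q.1, q.2.1) * b2 b (q.1, q.2.2)).
Proof. by rewrite /kern2 /osc_cos /osc_sin sinD; ring. Qed.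

(** The real part of a kernel value times the conjugate of another depends only on the difference of
    their phases. *)
Lemma kern_product d x : kern1 (d_a d) (d_b d) (x, polar_point (d_u d) (d_z d)) *
    kern1 (d_a d) (d_b d) (x, polar_point (d_u d) (d_z' d)) +
    kern2 (d_a d) (d_b d) (x, polar_point (d_u d) (d_z d)) *
    kern2 (d_a d) (d_b d) (x, polar_point (d_u d) (d_z' d)) =
  cos (phase d x) * amplitude d x.
Proof.
have num (u v B1 B2 : R) : cos (v - u) * (B1 * B2) =
    cos u * B1 * (cos v * B2) + sin u * B1 * (sin v * B2).
  by rewrite cosB; ring.
rewrite !kern1E !kern2E /phase /two_body /amplitude num; reflexivity.
Qed.

Lemma measurable_kern a b : 1 <= a -> 1 <= b ->
  measurable_fun setT (kern1 a b) /\ measurable_fun setT (kern2 a b).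
Proof.
move=> a1 b1'.
have [c1 s1] := osc_continuous a1 (sb1 a1) (fun p => @b1_supp a p a1).
have [c2 s2] := osc_continuous b1' (sb2 b1') (fun p => @b2_supp b p b1').
have m1 : measurable_fun setT (fun q : M3 * (M2 * M2) => (q.1, q.2.1)).
  by apply: measurable_fun_pair => //; exact: (measurableT_comp measurable_fst measurable_snd).
have m2 : measurable_fun setT (fun q : M3 * (M2 * M2) => (q.1, q.2.2)).
  by apply: measurable_fun_pair => //; exact: (measurableT_comp measurable_snd measurable_snd).
have mc1 := measurableT_comp (continuous_measurable_R3R2 c1) m1.
have ms1 := measurableT_comp (continuous_measurable_R3R2 s1) m1.
have mc2 := measurableT_comp (continuous_measurable_R3R2 c2) m2.
have ms2 := measurableT_comp (continuous_measurable_R3R2 s2) m2.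
split; first by apply: measurable_funB; exact: measurable_funM.
by apply: measurable_funD; exact: measurable_funM.
Qed.

Lemma kern_supp a b x e : 1 <= a -> ~ box3 p0.1 r x -> kern1 a b (x, e) = 0 /\ kern2 a b (x, e) = 0.
Proof.
move=> a1 nx.
have E : b1 a (x, e.1) = 0.
  apply: contra_notP nx => /eqP/(b1_supp a1); rewrite prod_normE ge_max => /andP[h _].
  exact: box3P.
by rewrite kern1E kern2E /= E mul0r !mulr0.
Qed.

Lemma kern_bounded : exists2 B, 0 < B & forall a b q, 1 <= a -> 1 <= b ->
  `|kern1 a b q| <= B /\ `|kern2 a b q| <= B.
Proof.
have [m1 H1] := bb1 [::]; have [m2 H2] := bb2 [::].
exists (`|m1| * `|m2| + 1); first by rewrite ltr_wpDl// mulr_ge0.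
move=> a b q a1 b1'.
have h : `|b1 a (q.1, q.2.1) * b2 b (q.1, q.2.2)| <= `|m1| * `|m2| + 1.
  rewrite normrM; apply: (@le_trans _ _ (`|m1| * `|m2|)); last by rewrite lerDl.
  apply: ler_pM => //.
    by apply: le_trans (H1 a (q.1, q.2.1) a1) (ler_norm _).
  by apply: le_trans (H2 b (q.1, q.2.2) b1') (ler_norm _).
rewrite kern1E kern2E.
split; rewrite normrM; apply: le_trans h; rewrite ler_piMl//.
  exact: cos_max.
exact: sin_max.
Qed.

(** With L the separation, each of the three arguments in the weight is at most L in absolute value,
    so the weight is at least (1 + L^2)^-3. This is compared with the trivial bound when L <= 1,
    where 1 + L^2 <= 2, and with the decay L^-6 when L > 1, where 1 + L^2 <= 2 L^2; the 8 is 2^3 in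
    both cases. *)
Lemma weight_ge_separation (K C0 C1 a b u : R) (z z' : M3) : 0 < a -> 0 < b -> 0 <= C0 -> 0 <= C1 ->
  K <= C0 -> (0 < separation a b u z z' -> K <= C1 * separation a b u z z' ^- 6) ->
  K <= 8 * (C0 + C1) * weight (a + b) (a / (a + b)) (a * b / (a + b) * oneDsqr u) u (z, z').
Proof.
move=> a0 b0 C00 C10 K0 K1.
have ab0 : 0 < a + b by exact: addr_gt0.
pose L := separation a b u z z'.
have L0 : 0 <= L by exact: sep_ge0.
pose X := (a + b) * shift1 (a / (a + b)) z z'.
pose Y := (a + b) * shift2 (a / (a + b)) u z z'.
pose Z := a * b / (a + b) * oneDsqr u * (z'.2 ^+ 2 - z.2 ^+ 2).
have m0 : 0 <= a * b / (a + b) by apply: divr_ge0; [apply: mulr_ge0|]; exact: ltW.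
have D0 : 0 <= oneDsqr u by exact: le_trans (oneDsqr_ge1 u).
have absX (q : R) : `|(a + b) * q| = (a + b) * `|q| by rewrite normrM gtr0_norm.
have absZ (q : R) : `|a * b / (a + b) * oneDsqr u * q| = a * b / (a + b) * oneDsqr u * `|q|.
  by rewrite normrM ger0_norm// mulr_ge0.
have LE : L = `|X| + `|Y| + `|Z|.
  rewrite /X /Y /Z !absX absZ /L /separation /oneDsqr.
  by ring.
have -> : weight (a + b) (a / (a + b)) (a * b / (a + b) * oneDsqr u) u (z, z') =
    (oneDsqr X)^-1 * ((oneDsqr Y)^-1 * (oneDsqr Z)^-1) by [].
have le1 (x : R) : `|x| <= L -> (oneDsqr L)^-1 <= (oneDsqr x)^-1.
  move=> xL; rewrite lef_pV2 ?posrE; [|exact: lt_le_trans (oneDsqr_ge1 _)..].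
  by rewrite /oneDsqr lerD2l -(real_normK (num_real x)) ler_pXn2r// nnegrE.
have nX := normr_ge0 X; have nY := normr_ge0 Y; have nZ := normr_ge0 Z.
have DL1 := oneDsqr_ge1 L.
have DL0 : 0 < oneDsqr L by exact: lt_le_trans DL1.
have DLn : 0 <= oneDsqr L by exact: ltW.
have L2 : 0 <= 2 * L ^+ 2 by rewrite mulr_ge0// sqr_ge0.
have i0 (x : R) : 0 <= (oneDsqr x)^-1 by rewrite invr_ge0.
have wge : (oneDsqr L) ^- 3 <= (oneDsqr X)^-1 * ((oneDsqr Y)^-1 * (oneDsqr Z)^-1).
  have h0 := mulr_ge0 (i0 L) (i0 L).
  rewrite -exprVn exprS expr2; apply: ler_pM => //.
    by apply: le1; rewrite LE; lra.
  by apply: ler_pM => //; apply: le1; rewrite LE; lra.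
have C80 : 0 <= 8 * (C0 + C1) by rewrite mulr_ge0// addr_ge0.
apply: (@le_trans _ _ (8 * (C0 + C1) * oneDsqr L ^- 3)); last by rewrite ler_wpM2l.
have [L1|L1] := leP L 1.
  apply: (le_trans K0); rewrite ler_pdivlMr ?exprn_gt0//.
  have h : oneDsqr L ^+ 3 <= 8.
    have -> : (8 : R) = 2 ^+ 3 by rewrite !exprS expr0; ring.
    rewrite ler_pXn2r ?nnegrE//.
    by rewrite /oneDsqr -[leRHS]/(1 + 1) lerD2l expr_le1.
  have : C0 * oneDsqr L ^+ 3 <= C0 * 8 by rewrite ler_wpM2l.
  by lra.
have L00 : 0 < L by exact: lt_trans L1.
apply: (le_trans (K1 L00)); rewrite ler_pdivlMr ?exprn_gt0// mulrAC ler_pdivrMr ?exprn_gt0//.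
have h : oneDsqr L ^+ 3 <= 8 * L ^+ 6.
  have -> : 8 * L ^+ 6 = (2 * L ^+ 2) ^+ 3 by ring.
  rewrite ler_pXn2r ?nnegrE//.
  by rewrite /oneDsqr; have : 1 <= L ^+ 2 by [rewrite expr_ge1// ltW|]; lra.
have L6 : 0 <= L ^+ 6 by rewrite exprn_ge0.
have : C1 * oneDsqr L ^+ 3 <= C1 * (8 * L ^+ 6) by rewrite ler_wpM2l.
have : 0 <= 8 * C0 * L ^+ 6 by rewrite !mulr_ge0.
by rewrite -/L; lra.
Qed.

(** [C0] is the trivial bound, by sup norm and volume of the box; [C1] is the constant of the six
    integrations by parts. The added 1 makes the final constant positive. *)
Lemma kernel_bound : exists2 C, 0 < C & forall a b sg u (z z' : M3), 1 <= a -> 1 <= b ->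
  sg = 1 \/ sg = -1 -> 0 < sg * z.2 -> 0 < sg * z'.2 ->
  `|(polar_point u z).1 - p0.2| <= r -> `|(polar_point u z).2 - p0.2| <= r ->
  `|(polar_point u z').1 - p0.2| <= r -> `|(polar_point u z').2 - p0.2| <= r ->
  `|\int[lam3]_x (kern1 a b (x, polar_point u z) * kern1 a b (x, polar_point u z') +
                  kern2 a b (x, polar_point u z) * kern2 a b (x, polar_point u z'))| <=
  C * weight (a + b) (a / (a + b)) (a * b / (a + b) * oneDsqr u) u (z, z').
Proof.
have [B B0 HB] := kern_bounded.
have /choice[Ca HCa] : forall i : 'I_3, exists C, forall d, axis_admissible i d ->
  `|\int[lebesgue_measure]_(v in `[coord3 p0.1 i - 2 * r, coord3 p0.1 i + 2 * r])
     (cos (phase d (d_y d + v *: e3 R i)) * amplitude d (d_y d + v *: e3 R i))| <=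
  C * d_sep d ^- 6 by move=> i; exact: axis_integral_le.
(* The axis will depend on the data, so the constants of all three axes are added up; the square is
   the cross-section of the box. *)
pose C1 := (\sum_i `|Ca i|) * ((2 * r) * (2 * r)).
pose C0 := (B * B + B * B) * ((2 * r) * (2 * r) * (2 * r)).
have C0p : 0 <= C0 by rewrite !mulr_ge0 ?addr_ge0 ?mulr_ge0// ltW.
have C1p : 0 <= C1 by rewrite !mulr_ge0 ?sumr_ge0// ltW.
exists (8 * (C0 + C1) + 1); first by rewrite ltr_wpDl// mulr_ge0// addr_ge0.
move=> a b sg u z z' a1 b1' sgE t0 t'0 h1 h2 h3 h4.
have a0 : 0 < a by exact: lt_le_trans a1.
have b0 : 0 < b by exact: lt_le_trans b1'.
pose dy y := Datum a b u sg z z' y.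
pose F x := kern1 a b (x, polar_point u z) * kern1 a b (x, polar_point u z') +
                  kern2 a b (x, polar_point u z) * kern2 a b (x, polar_point u z').
have FE x y : F x = cos (phase (dy y) x) * amplitude (dy y) x by exact: (kern_product (dy y) x).
have [mk1 mk2] := measurable_kern a1 b1'.
have mF : measurable_fun setT F.
  have s q := @measurable_fun_pair1 _ _ _ _ _ _ _ q mk1.
  have s' q := @measurable_fun_pair1 _ _ _ _ _ _ _ q mk2.
  by apply: measurable_funD; apply: measurable_funM.
have FB x : `|F x| <= B * B + B * B.
  have [q1 q2] := HB a b (x, polar_point u z) a1 b1'.
  have [q3 q4] := HB a b (x, polar_point u z') a1 b1'.
  by apply: le_trans (ler_normD _ _) _; rewrite !normrM; apply: lerD; apply: ler_pM.
have Fs x : F x != 0 -> `|x - p0.1| <= r.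
  rewrite (FE x 0) /amplitude !mulf_eq0 !negb_or => /andP[_ /andP[/andP[/(b1_supp a1) h _] _]].
  by move: h; rewrite prod_normE ge_max => /andP[].
apply: (@le_trans _ _ (8 * (C0 + C1) * weight (a + b) (a / (a + b)) (a * b / (a + b) * oneDsqr u) u (z, z'))); last first.
  by rewrite ler_wpM2r ?weight_ge0// lerDl.
apply: weight_ge_separation => //.
  apply: (@Rintegral_bounded_supp _ _ _ lam3 F (box3 p0.1 r)) => //.
  - by rewrite addr_ge0// mulr_ge0// ltW.
  - exact: measurable_box3.
  - exact: lam3_box3.
  - by move=> x nx; apply: contra_notP nx => /eqP/Fs/box3P.
move=> s0.
pose g := a / (a + b).
have ab0 : 0 < a + b by exact: addr_gt0.
(* The axis is determined by u and the three coefficients alone, not by x, so the same axis serves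
   every line. *)
have [i dom] := nondegenerate u ((a + b) * shift1 g z z') ((a + b) * shift2 g u z z')
  (a * b / (a + b) * oneDsqr u * (z'.2 ^+ 2 - z.2 ^+ 2)).
have D1 := oneDsqr_ge1 u.
have m0 : 0 <= a * b / (a + b) by apply: divr_ge0; [apply: mulr_ge0|]; exact: ltW.
have D0 : 0 <= oneDsqr u by exact: le_trans D1.
have absX (q : R) : `|(a + b) * q| = (a + b) * `|q| by rewrite normrM gtr0_norm.
have absZ (q : R) : `|a * b / (a + b) * oneDsqr u * q| = a * b / (a + b) * oneDsqr u * `|q|.
  by rewrite normrM ger0_norm// mulr_ge0.
have {}dom y : 2 * c * d_sep (dy y) <= `|d_main (dy y) i|.
  move: dom; rewrite !absX absZ.
  rewrite /d_sep /d_main /separation /= -/g => dom.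
  apply: le_trans (_ : _ <= _) (_ : _ <= _); first last.
  - apply: le_trans dom _; apply: le_of_eq; congr `|_|.
    rewrite /oneDsqr; field; rewrite !gt_eqF//; rewrite /oneDsqr in D1; lra.
  - by apply: le_of_eq; rewrite /oneDsqr; ring.
have C1ge : `|Ca i| <= \sum_i `|Ca i|.
  by rewrite (bigD1 i)//= lerDl sumr_ge0.
have s6 : 0 <= separation a b u z z' ^- 6 by rewrite invr_ge0 exprn_ge0// ltW.
apply: (@le_trans _ _ (`|Ca i| * separation a b u z z' ^- 6 * ((2 * r) * (2 * r)))); last first.
  rewrite /C1 mulrAC; apply: ler_wpM2r => //; apply: ler_wpM2r => //.
  by rewrite !mulr_ge0// ltW.
apply: (integral_axis_le (a := i) r0 mF FB Fs) => y yi.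
(* Lines that miss the patch carry no amplitude. *)
have [yr|yr] := leP `|y + coord3 p0.1 i *: e3 R i - p0.1| r; last first.
  rewrite (_ : \int[_]_v _ = 0) ?normr0 ?mulr_ge0//.
  rewrite /Rintegral (_ : (\int[_]_v _)%E = 0)//; apply: integral0_eq => v _.
  congr (_%:E); apply: contraTeq yr => /Fs vr; rewrite -leNgt; apply: norm3_le => j.
  have := le_trans (coord3_le _ j) vr.
  rewrite -[- p0.1]scaleN1r !coord3D !coord3Z coord3_e3.
  case: (eqVneq i j) => [<-|]; last by rewrite !mulr0.
  by rewrite yi !add0r !mulr1 mulN1r subrr normr0 => _; exact: ltW.
have ad : axis_admissible i (dy y) by split => //; split.
apply: (@le_trans _ _ (Ca i * separation a b u z z' ^- 6)); last first.
  by apply: ler_wpM2r => //; exact: ler_norm.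
apply: le_trans (HCa i _ ad); apply: le_of_eq; congr `|_|.
rewrite [RHS]Rintegral_mkcond; apply: eq_Rintegral => v _; rewrite patchE.
case: ifPn => [_|]; first exact: FE.
rewrite notin_setE /= in_itv /= => nv; apply/eqP; apply: contra_notT nv => /Fs vr.
have := le_trans (coord3_le _ i) vr.
rewrite -[- p0.1]scaleN1r !coord3D !coord3Z coord3_e3 eqxx yi add0r mulr1 mulN1r ler_norml.
by move=> /andP[q1 q2]; apply/andP; split; have := r0; lra.
Qed.

(** The functions f and g are truncated to the frequency square of the patch: the kernels vanish
    elsewhere, and bounded supports are what [bilinear_bound] requires. *)
Lemma bilinear_L2 : exists2 C, 0 <= C & forall a b, 1 <= a -> a <= b -> forall f g : M2 -> R,
  measurable_fun setT f -> measurable_fun setT g ->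
  (\int[lam2]_e ((f e) ^+ 2)%:E < +oo)%E -> (\int[lam2]_e ((g e) ^+ 2)%:E < +oo)%E ->
  (\int[lam3]_x ((\int[sprod lam2 lam2]_p (kern1 a b (x, p) * (f p.1 * g p.2))) ^+ 2 +
               (\int[sprod lam2 lam2]_p (kern2 a b (x, p) * (f p.1 * g p.2))) ^+ 2)%:E <=
   (C * a / (a * b) ^+ 2)%:E *
     ((\int[lam2]_e ((f e) ^+ 2)%:E) * (\int[lam2]_e ((g e) ^+ 2)%:E)))%E.
Proof.
have [C C0 HC] := kernel_bound; have [B B0 HB] := kern_bounded.
have p0' : 0 < @pi R by exact: pi_gt0.
exists (C * pi ^+ 4); first by rewrite mulr_ge0 ?exprn_ge0// ltW.
move=> a b a1 ab f g mf mg ff gf.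
have b1' : 1 <= b by exact: le_trans ab.
have a0 : 0 < a by exact: lt_le_trans a1.
have b0 : 0 < b by exact: lt_le_trans b1'.
have ab0 : 0 < a + b by exact: addr_gt0.
have [mk1 mk2] := measurable_kern a1 b1'.
(* The third coordinate 0 is a placeholder, since [box2] reads only the first two. *)
pose D := box2 (p0.2, 0) r.
have mD : measurable D by exact: measurable_box2.
have DP (e : M2) : `|e - p0.2| <= r <-> D e by exact: (box2P (p0.2, 0) r).
pose cut (h : M2 -> R) e := \1_D e * h e.
have mcut h : measurable_fun setT h -> measurable_fun setT (cut h).
  by move=> mh; apply: measurable_funM => //; exact: measurable_indic.
have cutE h e : D e -> cut h e = h e by move=> De; rewrite /cut indicE mem_set// mul1r.
have cut0 h e : cut h e != 0 -> D e.
  rewrite /cut indicE; have [/set_mem//|] := boolP (e \in D).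
  by rewrite mul0r eqxx.
have cut_le (h : M2 -> R) : measurable_fun setT h ->
    (\int[lam2]_e ((cut h e) ^+ 2)%:E <= \int[lam2]_e ((h e) ^+ 2)%:E)%E.
  move=> mh; apply: ge0_le_integral => //.
  - by move=> e _; rewrite lee_fin sqr_ge0.
  - by apply/measurable_EFinP; apply: measurable_funX; exact: mcut.
  - by apply/measurable_EFinP; exact: measurable_funX.
  move=> e _; rewrite lee_fin; have [->|/cut0/(cutE h)->//] := eqVneq (cut h e) 0.
  by rewrite expr0n sqr_ge0.
have kcut (kp : M3 * (M2 * M2) -> R) x : (forall e, kp (x, e) != 0 -> D e.1 /\ D e.2) ->
    \int[sprod lam2 lam2]_p (kp (x, p) * (f p.1 * g p.2)) =
    \int[sprod lam2 lam2]_p (kp (x, p) * (cut f p.1 * cut g p.2)).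
  move=> kD; apply: eq_Rintegral => p _.
  have [->|/kD[D1 D2]] := eqVneq (kp (x, p)) 0; first by rewrite !mul0r.
  by rewrite !cutE.
have kD x e : b1 a (x, e.1) * b2 b (x, e.2) != 0 -> D e.1 /\ D e.2.
  rewrite mulf_eq0 negb_or => /andP[/(b1_supp a1) h1 /(b2_supp b1') h2].
  have sndD (q : R2 R) : `|(x, q) - p0| <= r -> D q.
    by rewrite prod_normE ge_max => /andP[_ h]; apply/DP; exact: h.
  by split; apply: sndD.
have kD1 x e : kern1 a b (x, e) != 0 -> D e.1 /\ D e.2.
  by rewrite kern1E mulf_eq0 negb_or => /andP[_ /kD].
have kD2 x e : kern2 a b (x, e) != 0 -> D e.1 /\ D e.2.
  by rewrite kern2E mulf_eq0 negb_or => /andP[_ /kD].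
under eq_integral do rewrite (kcut _ _ (kD1 _)) (kcut _ _ (kD2 _)).
pose L := `|p0.2| + r.
have L0 : 0 < L by rewrite ltr_wpDl.
have hL h e : cut h e != 0 -> `|e| <= L.
  move=> /cut0/DP he; rewrite -[e](subrK p0.2) addrC.
  by apply: le_trans (ler_normD _ _) _; rewrite lerD2l.
have k0 : 0 < a * b / (a + b) by rewrite divr_gt0 ?mulr_gt0.
have := @bilinear_bound R _ M3 lam3 (kern1 a b) (kern2 a b) (cut f) (cut g) (box3 p0.1 r) B L C
  (a + b) (a / (a + b)) (a * b / (a + b)) mk1 mk2 (mcut f mf) (mcut g mg)
  (measurable_box3 p0.1 r) (box3_fin p0.1 r0) L0 (hL f) (hL g) (le_lt_trans (cut_le f mf) ff)
  (le_lt_trans (cut_le g mg) gf) (fun x p => HB a b (x, p) a1 b1')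
  (fun x p nx => kern_supp b p a1 nx) ab0 k0 C0.
move=> H; have {}H := H _; apply: le_trans (H _) _.
  move=> sg u z z' sE t0 t'0 /cut0/DP h1 /cut0/DP h2 /cut0/DP h3 /cut0/DP h4.
  exact: HC a1 b1' sE t0 t'0 h1 h2 h3 h4.
have i0 (h : M2 -> R) : (0 <= \int[lam2]_e ((h e) ^+ 2)%:E)%E.
  by apply: integral_ge0 => e _; rewrite lee_fin sqr_ge0.
apply: lee_pmul.
- rewrite lee_fin.
  by apply: ltW; rewrite !(exprn_gt0, mulr_gt0, invr_gt0, pi_gt0).
- by rewrite mule_ge0.
- rewrite lee_fin.
  (* The constant obtained is C pi^4 / ((a + b) a b); replacing a + b by b gives the target, as a /
     (a b)^2 = 1 / (b (a b)). *)
  have -> : 2 * pi * (C * ((pi / (a + b)) ^+ 2 * (pi / (2 * (a * b / (a + b)))))) =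
      C * pi ^+ 4 / ((a + b) * (a * b)) by field; rewrite !gt_eqF.
  have -> : C * pi ^+ 4 * a / (a * b) ^+ 2 = C * pi ^+ 4 / (b * (a * b)) by field; rewrite !gt_eqF.
  apply: ler_wpM2l; first by rewrite mulr_ge0 ?exprn_ge0// ltW.
  rewrite lef_pV2 ?posrE ?mulr_gt0//.
  by apply: ler_wpM2r; [rewrite mulr_ge0// ltW|rewrite lerDr ltW].
- by apply: lee_pmul => //; exact: cut_le.
Qed.

End Patch.
End KernelEstimate.

(** * Quantitative linear independence from a definite form *)

Section NonDegeneracy.
Context {R : realType}.

(* Discriminant bound: a definite binary form dominates [det / trace] times the
   Euclidean one. *)
Lemma definite_form_ge (B : 'M[R]_2) : definite_form B -> exists2 d, 0 < d &
  forall u, d * (1 + u ^+ 2) <= `|B 0 0 + u * (B 0 1 + B 1 0) + u ^+ 2 * B 1 1|.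
Proof.
have quad (v : 'rV[R]_2) : (v *m B *m v^T) 0 0 = v 0 0 ^+ 2 * B 0 0 +
    v 0 0 * v 0 1 * (B 0 1 + B 1 0) + v 0 1 ^+ 2 * B 1 1.
  rewrite !mxE !big_ord_recl !big_ord0 !mxE !big_ord_recl !big_ord0.
  have -> : lift ord0 (@ord0 0) = 1 :> 'I_2 by apply/val_inj.
  by rewrite !addr0 -[ord0]/(0 : 'I_2); ring.
have key (p q s : R) : 0 < p -> (forall x y : R, (x != 0) || (y != 0) ->
      0 < x ^+ 2 * p + x * y * s + y ^+ 2 * q) ->
    exists2 d, 0 < d & forall u, d * (1 + u ^+ 2) <= p + u * s + u ^+ 2 * q.
  move=> p0 H.
  have q0 : 0 < q by have := H 0 1; rewrite oner_eq0 orbT => /(_ isT); lra.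
  have disc : 0 < 4 * p * q - s ^+ 2.
    have pn : - 2 * p != 0 by rewrite mulf_neq0 ?oppr_eq0 ?pnatr_eq0// gt_eqF.
    (* The value of the form at (s, -2 p) is p times the discriminant 4 p q - s^2. *)
    have := H s (- 2 * p); rewrite pn orbT => /(_ isT).
    have -> : s ^+ 2 * p + s * (- 2 * p) * s + (- 2 * p) ^+ 2 * q = p * (4 * p * q - s ^+ 2) by ring.
    by rewrite pmulr_rgt0.
  pose d := (4 * p * q - s ^+ 2) / (4 * (p + q)).
  have pq0 : 0 < p + q by exact: addr_gt0.
  exists d; first by rewrite divr_gt0// mulr_gt0.
  move=> u; rewrite -subr_ge0.
  have -> : p + u * s + u ^+ 2 * q - d * (1 + u ^+ 2) = (p - d) + u * s + u ^+ 2 * (q - d) by ring.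
  have pd : p - d = (4 * p ^+ 2 + s ^+ 2) / (4 * (p + q)) by rewrite /d; field; rewrite gt_eqF.
  have qd : q - d = (4 * q ^+ 2 + s ^+ 2) / (4 * (p + q)) by rewrite /d; field; rewrite gt_eqF.
  (* Cayley-Hamilton for the symmetric matrix B with entries p, s/2, q: |B v|^2 = tr(B) v.Bv -
     det(B) |v|^2, so with d = det / trace the difference is |B v|^2 / trace at v = (1, u). *)
  have E : (p - d) + u * s + u ^+ 2 * (q - d) =
      ((2 * p + u * s) ^+ 2 + (s + 2 * q * u) ^+ 2) / (4 * (p + q)).
    by rewrite pd qd; field; rewrite gt_eqF.
  by rewrite E divr_ge0 ?addr_ge0 ?sqr_ge0// mulr_ge0// ltW.
have row (x y : R) : exists v : 'rV[R]_2, v 0 0 = x /\ v 0 1 = y.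
  by exists (\row_j (if j == 0 then x else y)); rewrite !mxE.
have nz (v : 'rV[R]_2) : (v 0 0 != 0) || (v 0 1 != 0) -> v != 0.
  by apply: contraTneq => ->; rewrite !mxE eqxx.
case=> def.
  have H (x y : R) : (x != 0) || (y != 0) -> 0 < x ^+ 2 * B 0 0 + x * y * (B 0 1 + B 1 0) + y ^+ 2 * B 1 1.
    by have [v [<- <-]] := row x y => /nz/def; rewrite quad.
  have p0 : 0 < B 0 0 by have := H 1 0; rewrite oner_eq0 => /(_ isT); lra.
  have [d d0 Hd] := key _ _ _ p0 H; exists d => // u.
  by apply: le_trans (Hd u) (ler_norm _).
have H (x y : R) : (x != 0) || (y != 0) -> 0 < x ^+ 2 * - B 0 0 + x * y * - (B 0 1 + B 1 0) + y ^+ 2 * - B 1 1.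
  by have [v [<- <-]] := row x y => /nz/def; rewrite quad; lra.
have p0 : 0 < - B 0 0 by have := H 1 0; rewrite oner_eq0 => /(_ isT); lra.
have [d d0 Hd] := key _ _ _ p0 H; exists d => // u.
apply: le_trans (Hd u) _; rewrite -normrN; apply: le_trans (ler_norm _).
by apply: le_of_eq; ring.
Qed.

(** Here n is the cross product of p and q. Pairing the combination with n removes X and Y and
    recovers Z, by the lower bound [hd]. Subtracting the Z-term leaves v = p X + q Y, from which X
    and Y are read off through triple products with n; n is nonzero because [hd] holds at u = 0. *)
Lemma triple_product_dominates (p q : 'I_3 -> R) (h : R -> 'I_3 -> R) (H d : R) :
  let n i := p (i + 1) * q (i + 2%:R) - p (i + 2%:R) * q (i + 1) in
  0 < d -> (forall u i, `|h u i| <= H * (1 + u ^+ 2)) ->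
  (forall u, d * (1 + u ^+ 2) <= `|\sum_i n i * h u i|) ->
  exists2 c, 0 < c & forall u X Y Z, exists i,
    2 * c * (`|X| + `|Y| + `|Z|) <= `|p i * X + q i * Y + h u i / (2 * (1 + u ^+ 2)) * Z|.
Proof.
move=> n d0 hH hd.
pose N := \sum_i `|n i|; pose P := \sum_i `|p i| + \sum_i `|q i|.
have N0 : 0 <= N by exact: sumr_ge0.
have P0 : 0 <= P by rewrite addr_ge0// sumr_ge0.
have sum3 (F : 'I_3 -> R) : \sum_i F i = F 0 + F 1 + F 2%:R.
  rewrite !big_ord_recl big_ord0 addr0 addrA.
  by congr (F _ + F _ + F _); apply/val_inj.
have [e01 e02 e11] : [/\ 0 + 1 = 1 :> 'I_3, 0 + 2%:R = 2%:R :> 'I_3 & 1 + 1 = 2%:R :> 'I_3].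
  by split; apply/val_inj.
have [e12 e21 e22] : [/\ 1 + 2%:R = 0 :> 'I_3, 2%:R + 1 = 0 :> 'I_3 & 2%:R + 2%:R = 1 :> 'I_3].
  by split; apply/val_inj.
have idx := (e01, e02, e11, e12, e21, e22).
pose S := \sum_i n i ^+ 2.
have dual (w : 'I_3 -> R) W : (forall i, `|w i| <= W) -> `|\sum_i n i * w i| <= N * W.
  move=> hw; apply: le_trans (ler_norm_sum _ _ _) _; rewrite mulr_suml.
  by apply: ler_sum => i _; rewrite normrM ler_wpM2l.
have S0 : 0 < S.
  have S0 : 0 <= S by apply: sumr_ge0 => i _; exact: sqr_ge0.
  rewrite lt_def S0 andbT; apply/negP => /eqP SE.
  have n0 i : n i = 0.
    apply/eqP; rewrite -sqrf_eq0; apply/eqP; move/eqP: SE.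
    by rewrite psumr_eq0 => [/allP/(_ i)|j _]; [rewrite mem_index_enum => /(_ isT)/eqP|exact: sqr_ge0].
  have := hd 0; rewrite expr0n addr0 mulr1 big1 ?normr0 => [|i _]; last by rewrite n0 mul0r.
  by rewrite leNgt d0.
have H0 : 0 <= H.
  by have := hH 0 0; rewrite expr0n addr0 mulr1; apply: le_trans.
(* The last summand bounds Z; the first is twice 2 N P / S, once for X and once for Y, times the
   loss made in subtracting the Z-term. *)
pose K := 4 * N * P / S * (1 + H * N / d) + 2 * N / d.
have K0 : 0 <= K.
  have d0' := ltW d0; have S0' := ltW S0.
  have N2 : 0 <= 2 * N by exact: mulr_ge0.
  have HN : 0 <= 1 + H * N / d by rewrite addr_ge0// divr_ge0// mulr_ge0.
  have NP : 0 <= 4 * N * P / S by rewrite divr_ge0// mulr_ge0// mulr_ge0.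
  by rewrite /K addr_ge0// ?mulr_ge0// invr_ge0.
(* The 6 is the factor 2 of the claim times the number of coordinates; K + 1 instead of K makes the
   final contradiction strict. *)
exists ((6 * (K + 1))^-1); first by rewrite invr_gt0 mulr_gt0// ltr_wpDl.
move=> u X Y Z.
pose D := 1 + u ^+ 2.
have D1 : 1 <= D by rewrite lerDl sqr_ge0.
have D0 : 0 < D by exact: lt_le_trans D1.
pose v i := p i * X + q i * Y.
pose m i := v i + h u i / (2 * D) * Z.
pose E := \sum_i `|m i|.
have mE i : `|m i| <= E by rewrite /E (bigD1 i)//= lerDl sumr_ge0.
have E0 : 0 <= E by exact: le_trans (mE 0).
have pP i : `|p i| <= P.
  by rewrite /P (bigD1 i)//= -addrA lerDl addr_ge0// sumr_ge0.
have qP i : `|q i| <= P.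
  by rewrite /P addrC (bigD1 i)//= -addrA lerDl addr_ge0// sumr_ge0.
have Zle : `|Z| <= 2 * N / d * E.
  have nm : \sum_i n i * m i = (\sum_i n i * h u i) / (2 * D) * Z.
    by rewrite !sum3 /m /v /n !idx; field; rewrite gt_eqF.
  have := dual m E mE; rewrite nm normrM normrM normfV (@gtr0_norm _ (2 * D)) ?mulr_gt0// => hN.
  have h1 : d / 2 <= `|\sum_i n i * h u i| / (2 * D).
    rewrite ler_pdivlMr ?mulr_gt0//; apply: le_trans (hd u).
    by rewrite -/D le_eqVlt; apply/orP; left; apply/eqP; field.
  have h2 : d / 2 * `|Z| <= N * E by apply: le_trans hN; rewrite ler_wpM2r.
  rewrite -(ler_pM2l (_ : 0 < d / 2)) ?divr_gt0//; apply: le_trans h2 _.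
  by apply: le_of_eq; field; rewrite gt_eqF.
pose W := E + H / 2 * `|Z|.
have W0 : 0 <= W by rewrite addr_ge0// mulr_ge0// divr_ge0.
have vW i : `|v i| <= W.
  have -> : v i = m i - h u i / (2 * D) * Z by rewrite /m addrK.
  apply: le_trans (ler_normB _ _) _; apply: lerD => //.
  rewrite normrM ler_wpM2r// normrM normfV (@gtr0_norm _ (2 * D)) ?mulr_gt0//.
  rewrite ler_pdivrMr ?mulr_gt0//; apply: le_trans (hH u i) _.
  by rewrite -/D le_eqVlt; apply/orP; left; apply/eqP; field.
have prodle (a b a' b' : R) : `|a| <= W -> `|b| <= P -> `|a'| <= W -> `|b'| <= P ->
    `|a * b - a' * b'| <= 2 * P * W.
  move=> h1 h2 h3 h4; apply: le_trans (ler_normB _ _) _; rewrite !normrM.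
  have : `|a| * `|b| <= W * P by apply: ler_pM.
  have : `|a'| * `|b'| <= W * P by apply: ler_pM.
  by lra.
have Xle : S * `|X| <= N * (2 * P * W).
  rewrite -[S]gtr0_norm// -normrM.
  (* n . (v x q) = X |n|^2, because v x q = X (p x q). *)
  have -> : S * X = \sum_i n i * (v (i + 1) * q (i + 2%:R) - v (i + 2%:R) * q (i + 1)).
    by rewrite /S !sum3 /v /n !idx; ring.
  by apply: dual => i; exact: prodle.
have Yle : S * `|Y| <= N * (2 * P * W).
  rewrite -[S]gtr0_norm// -normrM.
  have -> : S * Y = \sum_i n i * (v (i + 2%:R) * p (i + 1) - v (i + 1) * p (i + 2%:R)).
    by rewrite /S !sum3 /v /n !idx; ring.
  by apply: dual => i; exact: prodle.
have Wle : W <= (1 + H * N / d) * E.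
  have : H / 2 * `|Z| <= H / 2 * (2 * N / d * E) by rewrite ler_wpM2l// divr_ge0.
  rewrite (_ : H / 2 * (2 * N / d * E) = H * N / d * E); last by field; rewrite gt_eqF.
  by rewrite /W mulrDl mul1r lerD2l.
have total : `|X| + `|Y| + `|Z| <= K * E.
  have XYle (x : R) : S * `|x| <= N * (2 * P * W) -> `|x| <= 2 * N * P / S * ((1 + H * N / d) * E).
    move=> hx; have hx' : `|x| <= N * (2 * P * W) / S by rewrite ler_pdivlMr// mulrC.
    apply: (le_trans hx').
    rewrite (_ : N * (2 * P * W) / S = 2 * N * P / S * W); last by field; rewrite gt_eqF.
    by rewrite ler_wpM2l// divr_ge0 ?mulr_ge0// ltW.
  have := XYle X Xle; have := XYle Y Yle; move: Zle; rewrite /K.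
  set a := 2 * N / d; set b := 1 + _.
  rewrite (_ : 4 * N * P / S = 2 * (2 * N * P / S)); last by field; rewrite gt_eqF.
  set t := 2 * N * P / S; move=> h1 h2 h3.
  have -> : (2 * t * b + a) * E = t * (b * E) + t * (b * E) + a * E by ring.
  by rewrite lerD// lerD.
(* If every coordinate were small, their sum [E] would be below T / (K + 1), against T <= K E. *)
apply: contrapT => /forallNP no.
have {}no i : `|m i| < 2 * (6 * (K + 1))^-1 * (`|X| + `|Y| + `|Z|).
  by rewrite ltNge; apply/negP; exact: no.
set T := `|X| + `|Y| + `|Z| in total no.
have T0 : 0 <= T by rewrite !addr_ge0.
have K10 : 0 < K + 1 by rewrite ltr_wpDl.
have := no 0; have := no 1; have := no 2%:R.
rewrite (_ : 2 * (6 * (K + 1))^-1 * T = T / (K + 1) / 3); last by field; rewrite gt_eqF.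
move=> h1 h2 h3.
have EE : E < T / (K + 1) by rewrite /E sum3; lra.
have : K * E <= K * (T / (K + 1)) by rewrite ler_wpM2l// ltW.
have -> : K * (T / (K + 1)) = T - T / (K + 1) by field; rewrite gt_eqF.
by lra.
Qed.

End NonDegeneracy.

(** * Partial derivatives and the second fundamental form of the gradient surface *)

Section PartialDerivatives.
Context {R : realType}.
Notation V := (R3 R * R2 R)%type.

Lemma derive_fst (V1 V2 : normedModType R) (F : V1 * V2 -> R) (x e : V1) (y : V2) :
  'D_e (fun z => F (z, y)) x = 'D_(e, 0) F (x, y).
Proof.
have E : (fun h : R => h^-1 *: (((fun z => F (z, y)) \o shift x) (h *: e) - F (x, y))) =
   (fun h : R => h^-1 *: ((F \o shift (x, y)) (h *: ((e, 0) : V1 * V2)) - F (x, y))).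
  apply/funext => h /=; congr (_ *: (F _ - _)).
  by rewrite pairZ pairD scaler0 add0r.
by rewrite /derive E.
Qed.

Let quotient_snd (V1 V2 : normedModType R) (F : V1 * V2 -> R) (x : V1) (y e : V2) :
  (fun h : R => h^-1 *: (((fun z => F (x, z)) \o shift y) (h *: e) - F (x, y))) =
  (fun h : R => h^-1 *: ((F \o shift (x, y)) (h *: ((0, e) : V1 * V2)) - F (x, y))).
Proof.
apply/funext => h /=; congr (_ *: (F _ - _)).
by rewrite pairZ pairD scaler0 add0r.
Qed.

Lemma derive_snd (V1 V2 : normedModType R) (F : V1 * V2 -> R) (x : V1) (y e : V2) :
  'D_e (fun z => F (x, z)) y = 'D_(0, e) F (x, y).
Proof. by rewrite /derive quotient_snd. Qed.

Lemma derivable_snd (V1 V2 : normedModType R) (F : V1 * V2 -> R) (x : V1) (y e : V2) :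
  derivable F (x, y) (0, e) -> derivable (fun z => F (x, z)) y e.
Proof. by rewrite /derivable quotient_snd. Qed.

Lemma cross_row (p q : 'I_3 -> R) i : cross (\row_i p i) (\row_i q i) 0 i =
  p (i + 1) * q (i + 2%:R) - p (i + 2%:R) * q (i + 1).
Proof. by rewrite !mxE. Qed.

Lemma dot_row (p : 'I_3 -> R) (k : R) w :
  dot (\row_i p i) (k *: w) = k * \sum_i w 0 i * p i.
Proof. by rewrite /dot !mxE mulr_sumr; apply: eq_bigr => i _; rewrite !mxE; ring. Qed.

Lemma sum_quad (m p q v w : 'I_3 -> R) (k u : R) :
  k * (\sum_i m i * p i) + u * (k * (\sum_i m i * q i) + k * (\sum_i m i * v i)) +
    u ^+ 2 * (k * (\sum_i m i * w i)) =
  k * \sum_i m i * (p i + u * (q i + v i) + u ^+ 2 * w i).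
Proof.
rewrite !mulr_sumr -!big_split /= !mulr_sumr -!big_split /=.
by apply: eq_bigr => i _; ring.
Qed.

Lemma eq_row (p q : 'I_3 -> R) : (forall i, p i = q i) -> \row_i p i = \row_i q i.
Proof. by move=> pq; apply/rowP => i; rewrite !mxE. Qed.

Lemma gradxE (phi : V -> R) x : gradx phi x = fun xi => \row_i 'D_(ex i) phi (x, xi).
Proof. by apply/funext => xi; apply/rowP => i; rewrite !mxE derive_fst. Qed.

Lemma derive_row n (F : R2 R -> 'I_n -> R) (y e : R2 R) :
  (forall i, derivable (fun z => F z i) y e) ->
  'D_e (fun z => \row_i F z i) y = \row_i 'D_e (fun z => F z i) y.
Proof.
move=> dF; rewrite derive_mx.
  apply/rowP => i; rewrite !mxE; congr ('D_e _ y); apply/funext => z; by rewrite mxE.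
apply/derivable_mxP => i j; under eq_fun do rewrite mxE; exact: dF.
Qed.

Section SecondFundamentalForm.
Variables (Ox : set (R3 R)) (Oxi : set (R2 R)) (phi : V -> R) (x : R3 R) (xi : R2 R).
Hypotheses (oxi : open Oxi) (sphi : smooth_on (Ox `*` Oxi) phi) (Ox_x : Ox x) (Oxi_xi : Oxi xi).

Let Q (i : 'I_3) := 'D_(ex i) phi.

Lemma tangent_gradx j y : Oxi y ->
  tangent (gradx phi x) j y = \row_i 'D_(ez j) (Q i) (x, y).
Proof.
move=> Oy; rewrite /tangent gradxE (@derive_row 3 (fun y i => Q i (x, y)) y (e2 R j)); first last.
  move=> i; apply: derivable_snd.
  have Uy : (Ox `*` Oxi) (x, y) by split.
  exact: (smooth_on_derivable (v := ez j) (smooth_on_derive (ex i) sphi) Uy).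
by apply: eq_row => i; exact: derive_snd.
Qed.

Lemma derive_tangent_gradx j k :
  'D_(e2 R j) (tangent (gradx phi x) k) xi = \row_i 'D_(ez j) ('D_(ez k) (Q i)) (x, xi).
Proof.
rewrite (near_eq_derive (g := fun y => \row_i 'D_(ez k) (Q i) (x, y))).
  rewrite (@derive_row 3 (fun y i => 'D_(ez k) (Q i) (x, y)) xi (e2 R j)).
    by apply: eq_row => i; exact: derive_snd.
  move=> i; apply: (@derivable_snd (R3 R) (R2 R) ('D_(ez k) (Q i)) x xi (e2 R j)).
  have Uxi : (Ox `*` Oxi) (x, xi) by split.
  exact: (smooth_on_derivable (v := ez j) (smooth_on_derive (ez k) (smooth_on_derive (ex i) sphi)) Uxi).
near=> y; apply: tangent_gradx; near: y; exact: open_nbhs_nbhs.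
Unshelve. all: by end_near. Qed.

Let n (i : 'I_3) := 'D_(ez 0) (Q (i + 1)) (x, xi) * 'D_(ez 1) (Q (i + 2%:R)) (x, xi) -
  'D_(ez 0) (Q (i + 2%:R)) (x, xi) * 'D_(ez 1) (Q (i + 1)) (x, xi).

(** The entries of the second fundamental form are triple products of xi-derivatives of P, divided
    by the length of the normal. Clearing this length turns definiteness into the lower bound that
    [triple_product_dominates] expects. *)
Lemma definite_second_fundamental_form :
  definite_form (second_fundamental_form (gradx phi x) xi) ->
  exists2 d, 0 < d & forall u, d * (1 + u ^+ 2) <=
    `|\sum_i n i * ('D_(ez 0) ('D_(ez 0) (Q i)) (x, xi) +
       u * ('D_(ez 0) ('D_(ez 1) (Q i)) (x, xi) + 'D_(ez 1) ('D_(ez 0) (Q i)) (x, xi)) +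
       u ^+ 2 * 'D_(ez 1) ('D_(ez 1) (Q i)) (x, xi))|.
Proof.
move=> /definite_form_ge[d d0 Hd].
pose N := cross (tangent (gradx phi x) 0 xi) (tangent (gradx phi x) 1 xi).
pose s := (Num.sqrt (dot N N))^-1.
have nE i : N 0 i = n i.
  by rewrite /N (tangent_gradx 0 Oxi_xi) (tangent_gradx 1 Oxi_xi) cross_row.
have IIE j k : second_fundamental_form (gradx phi x) xi j k =
    s * \sum_i n i * 'D_(ez j) ('D_(ez k) (Q i)) (x, xi).
  rewrite mxE derive_tangent_gradx /unit_normal -/N -/s dot_row.
  by congr (_ * _); apply: eq_bigr => i _; rewrite nE.
have s0 : 0 <= s by rewrite invr_ge0 sqrtr_ge0.
have {}Hd u : d * (1 + u ^+ 2) <= s * `|\sum_i n i * ('D_(ez 0) ('D_(ez 0) (Q i)) (x, xi) +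
       u * ('D_(ez 0) ('D_(ez 1) (Q i)) (x, xi) + 'D_(ez 1) ('D_(ez 0) (Q i)) (x, xi)) +
       u ^+ 2 * 'D_(ez 1) ('D_(ez 1) (Q i)) (x, xi))|.
  apply: (le_trans (Hd u)); rewrite -{1}(ger0_norm s0) -normrM.
  apply: le_of_eq; congr `|_|.
  rewrite !IIE; exact: sum_quad.
(* A zero normal would make [s] zero, the inverse of zero being zero, and the bound at u = 0 would
   fail. *)
have s_gt0 : 0 < s.
  rewrite lt_def s0 andbT; apply: contraPneq (Hd 0) => ->.
  by rewrite mul0r expr0n addr0 mulr1 leNgt d0.
exists (d / s); first exact: divr_gt0.
by move=> u; rewrite mulrAC ler_pdivrMr// [leRHS]mulrC; exact: Hd.
Qed.

End SecondFundamentalForm.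
End PartialDerivatives.

(** * Choice of the patch *)

Section PatchExistence.
Context {R : realType}.
Notation V := (R3 R * R2 R)%type.

(** The constant [c] is fixed by the derivatives at the centre alone; only afterwards is the radius
    chosen, by continuity, so that these derivatives vary by at most [c]. *)
Lemma patch_exists (Ox : set (R3 R)) (Oxi : set (R2 R)) (phi : V -> R) x0 xi0 :
  open Ox -> open Oxi -> smooth_on (Ox `*` Oxi) phi -> Ox x0 -> Oxi xi0 ->
  definite_form (second_fundamental_form (gradx phi x0) xi0) ->
  let p0 := (x0, xi0) in
  exists r c (A1 A2 A11 A12 A21 A22 : 'I_3 -> R), [/\ 0 < r, 0 < c,
   forall p, `|p - p0| <= 12 * r -> (Ox `*` Oxi) p,
   derivatives_close phi p0 (12 * r) c A1 A2 A11 A12 A21 A22 &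
   axis_dominates c A1 A2 A11 A12 A21 A22].
Proof.
move=> oO oOxi sphi Ox0 Oxi0 /(definite_second_fundamental_form oOxi sphi Ox0 Oxi0)[d d0 Hd] p0.
have oU : open (Ox `*` Oxi).
  rewrite openE => -[x y] [/= Ox_x Oxi_y]; exists (Ox, Oxi) => //.
  by split; exact: open_nbhs_nbhs.
have Up0 : (Ox `*` Oxi) p0 by split.
pose A1 a := 'D_(ez 0) ('D_(ex a) phi) p0; pose A2 a := 'D_(ez 1) ('D_(ex a) phi) p0.
pose A11 a := 'D_(ez 0) ('D_(ez 0) ('D_(ex a) phi)) p0.
pose A12 a := 'D_(ez 0) ('D_(ez 1) ('D_(ex a) phi)) p0.
pose A21 a := 'D_(ez 1) ('D_(ez 0) ('D_(ex a) phi)) p0.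
pose A22 a := 'D_(ez 1) ('D_(ez 1) ('D_(ex a) phi)) p0.
pose h (u : R) a := A11 a + u * (A12 a + A21 a) + u ^+ 2 * A22 a.
pose H := \sum_a (`|A11 a| + `|A12 a + A21 a| + `|A22 a|).
have habs (x y z u : R) : `|x + u * y + u ^+ 2 * z| <= (`|x| + `|y| + `|z|) * (1 + u ^+ 2).
  apply: le_trans (ler_normD _ _) _; apply: le_trans (lerD (ler_normD _ _) (lexx _)) _.
  rewrite (normrM u) (normrM (u ^+ 2)) (ger0_norm (sqr_ge0 u)).
  have hx : `|x| <= `|x| * (1 + u ^+ 2) by rewrite ler_peMr// lerDl sqr_ge0.
  have hz : u ^+ 2 * `|z| <= `|z| * (1 + u ^+ 2) by rewrite mulrC ler_wpM2l// lerDr.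
  have hy : `|u| * `|y| <= `|y| * (1 + u ^+ 2).
    rewrite mulrC ler_wpM2l// -(real_normK (num_real u)).
    by have := sqr_ge0 (`|u| - 1); have := normr_ge0 u; lra.
  by rewrite !mulrDl; apply: lerD => //; exact: lerD.
have hH u a : `|h u a| <= H * (1 + u ^+ 2).
  apply: le_trans (habs _ _ _ _) _; apply: ler_wpM2r; first by rewrite addr_ge0// sqr_ge0.
  by rewrite /H (bigD1 a)//= lerDl sumr_ge0.
have [c c0 Hc] := @triple_product_dominates R A1 A2 h H d d0 hH Hd.
have close (f : V -> R) : smooth_on (Ox `*` Oxi) f -> \forall p \near p0, `|f p - f p0| <= c.
  move=> sf; have /cvgrPdist_le/(_ c c0) := smooth_on_continuous sf Up0.
  by apply: filterS => p; rewrite distrC.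
have s1 a := smooth_on_derive (ex a) sphi.
pose close_at (a : 'I_3) (p : V) := [/\ `|'D_(ez 0) ('D_(ex a) phi) p - A1 a| <= c, `|'D_(ez 1) ('D_(ex a) phi) p - A2 a| <= c,
        `|'D_(ez 0) ('D_(ez 0) ('D_(ex a) phi)) p - A11 a| <= c, `|'D_(ez 0) ('D_(ez 1) ('D_(ex a) phi)) p - A12 a| <= c &
        `|'D_(ez 1) ('D_(ez 0) ('D_(ex a) phi)) p - A21 a| <= c /\ `|'D_(ez 1) ('D_(ez 1) ('D_(ex a) phi)) p - A22 a| <= c].
have near_all : \forall p \near p0, forall a, close_at a p.
  have FF : Filter (nbhs p0) by exact: nbhs_filter.
  have := @filter_forall V 'I_3 close_at (nbhs p0) FF; apply => a.
  have q1 := close _ (smooth_on_derive (ez 0) (s1 a)).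
  have q2 := close _ (smooth_on_derive (ez 1) (s1 a)).
  have q3 := close _ (smooth_on_derive (ez 0) (smooth_on_derive (ez 0) (s1 a))).
  have q4 := close _ (smooth_on_derive (ez 0) (smooth_on_derive (ez 1) (s1 a))).
  have q5 := close _ (smooth_on_derive (ez 1) (smooth_on_derive (ez 0) (s1 a))).
  have q6 := close _ (smooth_on_derive (ez 1) (smooth_on_derive (ez 1) (s1 a))).
  apply: filterS (filterI q1 (filterI q2 (filterI q3 (filterI q4 (filterI q5 q6))))).
  move=> p [h1 [h2 [h3 [h4 [h5 h6]]]]].
  by split; [exact: h1|exact: h2|exact: h3|exact: h4|split; [exact: h5|exact: h6]].
have /nbhs_ballP[e /= e0 He] : nbhs p0 ((Ox `*` Oxi) `&` [set p | forall a, close_at a p]).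
  by apply: filterI => //; exact: open_nbhs_nbhs.
have eb p : `|p - p0| <= 12 * (e / 13) -> ball p0 e p.
  move=> pe; rewrite -ball_normE /ball_ /= distrC; apply: le_lt_trans pe _.
  by have := e0; lra.
(* 12/13 < 1, so the closed ball of radius 12 r fits into the open ball of radius e. *)
exists (e / 13), c, A1, A2, A11, A12, A21, A22; split => //.
- by rewrite divr_gt0.
- by move=> p /eb/He[].
- by move=> a p /eb/He[_ /(_ a)].
Qed.

End PatchExistence.

(** * Square norms of complex functions and their components *)

Section L2Norm.
Context {R : realType}.
Notation MR := (measurableTypeR R).

Definition sqn (z : R[i]) : R := complex.Re z ^+ 2 + complex.Im z ^+ 2.

Lemma sqn_ge0 z : 0 <= sqn z. Proof. by rewrite addr_ge0// sqr_ge0. Qed.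

Lemma sqnM z w : sqn (z * w) = sqn z * sqn w.
Proof. by case: z => a b; case: w => c d; rewrite /sqn /=; ring. Qed.

Lemma L2normE d (T : measurableType d) (mu : {measure set T -> \bar R}) (F : T -> R[i]) :
  (L2norm mu F = (\int[mu]_t (sqn (F t))%:E) `^ 2^-1)%E.
Proof.
rewrite /L2norm unlock; congr (_ `^ _)%E; apply: eq_integral => t _ /=.
have n0 : 0 <= Normc.normc (F t) by case: (F t) => a b; exact: sqrtr_ge0.
rewrite ger0_norm// powR_mulrn//; congr EFin.
by case: (F t) => a b; rewrite /sqn /= sqr_sqrtr// addr_ge0// sqr_ge0.
Qed.

Lemma inL2_component d (T : measurableType d) (mu : {measure set T -> \bar R}) (F : T -> R[i]) :
  inL2 mu F -> (\int[mu]_t (sqn (F t))%:E < +oo)%E.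
Proof.
by move=> [_ _]; rewrite L2normE; apply: lty_poweRy; rewrite invr_eq0 pnatr_eq0.
Qed.

Definition component (s : bool) (z : R[i]) : R := if s then complex.Re z else complex.Im z.

Lemma component_sqr_le s z : component s z ^+ 2 <= sqn z.
Proof. by case: s; rewrite /sqn ?lerDl ?lerDr sqr_ge0. Qed.

End L2Norm.

(** * Operators with real amplitudes and real inputs *)

Section RealAmplitudes.
Context {R : realType}.
Notation MR := (measurableTypeR R).
Notation M2 := (MR * MR)%type.
Notation M3 := (MR * MR * MR)%type.
Notation V := (R3 R * R2 R)%type.
Variables (U : set V) (phi : V -> R) (p0 : V) (r : R).
Hypotheses (sphi : smooth_on U phi) (r0 : 0 < r)
  (ballU : forall p, `|p - p0| <= 12 * r -> U p).

Definition real_amplitude (b : R -> V -> R) : Prop :=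
  [/\ forall nu, 1 <= nu -> smooth_on setT (b nu),
    forall vs, exists M : R, forall nu p, 1 <= nu -> `|Defs.iterD vs (b nu) p| <= M &
    forall nu p, 1 <= nu -> b nu p != 0 -> `|p - p0| <= r].

Definition Cpart b nu (h : M2 -> R) (x : M3) : R := \int[lam2]_e (osc_cos phi b nu (x, e) * h e).
Definition Spart b nu (h : M2 -> R) (x : M3) : R := \int[lam2]_e (osc_sin phi b nu (x, e) * h e).

Lemma osc_measurable b nu : real_amplitude b -> 1 <= nu ->
  measurable_fun [set: M3 * M2] (osc_cos phi b nu) /\
  measurable_fun [set: M3 * M2] (osc_sin phi b nu).
Proof.
move=> [sb _ bs] nu1.
have [c1 c2] := osc_continuous sphi r0 ballU nu1 (sb nu nu1) (fun p => @bs nu p nu1).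
by split; exact: continuous_measurable_R3R2.
Qed.

(** The input is only square integrable on the plane; the amplitude confines the frequency to a
    square, where square integrable functions are integrable. *)
Lemma osc_integrable b nu (h : M2 -> R) x : real_amplitude b -> 1 <= nu ->
  measurable_fun setT h -> (\int[lam2]_e ((h e) ^+ 2)%:E < +oo)%E ->
  lam2.-integrable setT (EFin \o (fun e => osc_cos phi b nu (x, e) * h e)) /\
  lam2.-integrable setT (EFin \o (fun e => osc_sin phi b nu (x, e) * h e)).
Proof.
move=> ab nu1 mh hfin; have [mc ms] := osc_measurable ab nu1.
have [sb bb bs] := ab; have [M HM] := bb [::].
pose D := box2 (p0.2, 0) r.
pose hD (e : M2) := \1_D e * h e.
have mhD : measurable_fun setT hD.
  by apply: measurable_funM => //; apply: measurable_indic; exact: measurable_box2.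
have ih : lam2.-integrable setT (EFin \o hD).
  apply: (@box2_L2_integrable R (p0.2, 0) r r0) => //.
    move=> e; rewrite /hD indicE; have [/set_mem De _|] := boolP (e \in D).
      exact/(box2P (p0.2, 0) r).
    by rewrite mul0r eqxx.
  apply: le_lt_trans hfin; apply: ge0_le_integral => //.
  - by move=> e _; rewrite lee_fin sqr_ge0.
  - by apply/measurable_EFinP; exact: measurable_funX.
  - by apply/measurable_EFinP; exact: measurable_funX.
  move=> e _; rewrite lee_fin /hD indicE.
  by case: (_ \in _); rewrite ?mul1r// mul0r expr0n sqr_ge0.
have main (tr : R -> R) : (forall t, `|tr t| <= 1) ->
    measurable_fun [set: M3 * M2] (fun p => tr (nu * phi p) * b nu p) ->
    lam2.-integrable setT (EFin \o (fun e => tr (nu * phi (x, e)) * b nu (x, e) * h e)).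
  move=> tr1 mt; apply: (le_integrable _ _ _ (integrableZl measurableT M ih)) => //.
    apply/measurable_EFinP; apply: measurable_funM => //.
    exact: (@measurable_fun_pair2 _ _ _ _ _ _ _ x mt).
  move=> e _ /=; rewrite lee_fin.
  have [b0|bn] := eqVneq (b nu (x, e)) 0; first by rewrite b0 mulr0 mul0r normr0.
  have De : D e.
    apply/(box2P (p0.2, 0) r); have := bs nu _ nu1 bn.
    by rewrite prod_normE ge_max => /andP[_ h']; exact: h'.
  rewrite /hD indicE mem_set// mul1r [leLHS]normrM [leRHS]normrM; apply: ler_wpM2r => //.
  rewrite normrM -[leRHS]mul1r; apply: ler_pM => //.
  exact: le_trans (HM nu _ nu1) (ler_norm _).
by split; apply: main => // t; [exact: cos_max|exact: sin_max].
Qed.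

Lemma parts_measurable b nu (h : M2 -> R) : real_amplitude b -> 1 <= nu ->
  measurable_fun setT h ->
  measurable_fun setT (Cpart b nu h) /\ measurable_fun setT (Spart b nu h).
Proof.
move=> ab nu1 mh; have [mc ms] := osc_measurable ab nu1.
have mh' : measurable_fun [set: M3 * M2] (fun p => h p.2) by exact: (measurableT_comp mh measurable_snd).
split.
  exact: (@measurable_Rintegral _ _ M3 M2 R lam2 (fun p => osc_cos phi b nu p * h p.2) (measurable_funM mc mh')).
exact: (@measurable_Rintegral _ _ M3 M2 R lam2 (fun p => osc_sin phi b nu p * h p.2) (measurable_funM ms mh')).
Qed.

Definition energy b nu h x : R := Cpart b nu h x ^+ 2 + Spart b nu h x ^+ 2.

(** |z|^2 |w|^2 = |z w|^2 for the complex integrals z of f and w of g, and a product of two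
    integrals is the integral of the tensor product. *)
Lemma energy_product (b1 b2 : R -> V -> R) a b (f g : M2 -> R) x :
  real_amplitude b1 -> real_amplitude b2 -> 1 <= a -> 1 <= b ->
  measurable_fun setT f -> measurable_fun setT g ->
  (\int[lam2]_e ((f e) ^+ 2)%:E < +oo)%E -> (\int[lam2]_e ((g e) ^+ 2)%:E < +oo)%E ->
  energy b1 a f x * energy b2 b g x =
  (\int[sprod lam2 lam2]_p (kern1 phi b1 b2 a b (x, p) * (f p.1 * g p.2))) ^+ 2 +
  (\int[sprod lam2 lam2]_p (kern2 phi b1 b2 a b (x, p) * (f p.1 * g p.2))) ^+ 2.
Proof.
move=> A1 A2 a1 b1' mf mg ff gf.
have [c1 s1] := osc_integrable x A1 a1 mf ff.
have [c2 s2] := osc_integrable x A2 b1' mg gf.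
have [icc Icc] := integrable_tensor c1 c2; have [iss Iss] := integrable_tensor s1 s2.
have [ics Ics] := integrable_tensor c1 s2; have [isc Isc] := integrable_tensor s1 c2.
have -> : \int[sprod lam2 lam2]_p (kern1 phi b1 b2 a b (x, p) * (f p.1 * g p.2)) =
    Cpart b1 a f x * Cpart b2 b g x - Spart b1 a f x * Spart b2 b g x.
  rewrite -[X in X - _]/(fine (_%:E)) -[X in _ - X]/(fine (_%:E)) -Icc -Iss.
  rewrite -(RintegralB measurableT icc iss); apply: eq_Rintegral => p _.
  by rewrite /kern1 /=; ring.
have -> : \int[sprod lam2 lam2]_p (kern2 phi b1 b2 a b (x, p) * (f p.1 * g p.2)) =
    Spart b1 a f x * Cpart b2 b g x + Cpart b1 a f x * Spart b2 b g x.
  rewrite -[X in X + _]/(fine (_%:E)) -[X in _ + X]/(fine (_%:E)) -Ics -Isc.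
  rewrite -(RintegralD measurableT isc ics); apply: eq_Rintegral => p _.
  by rewrite /kern2 /=; ring.
by rewrite /energy; ring.
Qed.

End RealAmplitudes.

(** * Reduction of complex amplitudes and inputs to real ones *)

Section ComplexAmplitudes.
Context {R : realType}.
Notation MR := (measurableTypeR R).
Notation M2 := (MR * MR)%type.
Notation M3 := (MR * MR * MR)%type.
Notation V := (R3 R * R2 R)%type.
Variables (U : set V) (phi : V -> R) (p0 : V) (r : R).
Hypotheses (sphi : smooth_on U phi) (r0 : 0 < r)
  (ballU : forall p, `|p - p0| <= 12 * r -> U p).

Lemma component_amplitude (b : R -> V -> R[i]) s : bounded_order_zero b ->
  supported_in [set p | `|p - p0| <= r] b ->
  real_amplitude p0 r (fun nu p => component s (b nu p)).
Proof.
move=> [sb bb] bs; split.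
- by move=> nu /sb[s1 s2]; case: s.
- by move=> vs; have [M HM] := bb vs; exists M => nu p /HM-/(_ p)[h1 h2]; case: s.
move=> nu p nu1 h; apply: (bs nu nu1); apply: subset_closure => /=.
by apply: contraNneq h => ->; case: s.
Qed.

Variables (b : R -> V -> R[i]) (nu : R) (h : M2 -> R[i]).
Hypotheses (bb : bounded_order_zero b) (bs : supported_in [set p | `|p - p0| <= r] b)
  (nu1 : 1 <= nu) (hL2 : inL2 (leb2 R) h).

Let bc s := fun nu p => component s (b nu p).
Let hc s := component s \o h.

Lemma component_measurable s : measurable_fun [set: M2] (hc s).
Proof. by have [m1 m2 _] := hL2; case: s. Qed.

Lemma component_L2_le s : (\int[lam2]_e ((hc s e) ^+ 2)%:E <= \int[lam2]_e (sqn (h e))%:E)%E.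
Proof.
apply: ge0_le_integral => //.
- by move=> e _; rewrite lee_fin sqr_ge0.
- by apply/measurable_EFinP; apply: measurable_funX; exact: component_measurable.
- apply/measurable_EFinP; apply: measurable_funD; apply: measurable_funX.
    exact: (component_measurable true).
  exact: (component_measurable false).
by move=> e _; rewrite lee_fin component_sqr_le.
Qed.

Lemma component_L2_fin s : (\int[lam2]_e ((hc s e) ^+ 2)%:E < +oo)%E.
Proof. exact: le_lt_trans (component_L2_le s) (inL2_component hL2). Qed.

Let ac s := component_amplitude s bb bs.

(** There are eight real integrals, according to cosine or sine, the part of [b] and the part of
    [h]; those with an even number of imaginary factors, sine counting as one, make up the real
    part. Each is integrable on its own, which allows the splitting. *)
Lemma osc_op_parts x :
  complex.Re (osc_op phi b nu h x) = nu *
    (Cpart phi (bc true) nu (hc true) x - Cpart phi (bc false) nu (hc false) x -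
     Spart phi (bc true) nu (hc false) x - Spart phi (bc false) nu (hc true) x) /\
  complex.Im (osc_op phi b nu h x) = nu *
    (Spart phi (bc true) nu (hc true) x - Spart phi (bc false) nu (hc false) x +
     Cpart phi (bc true) nu (hc false) x + Cpart phi (bc false) nu (hc true) x).
Proof.
have I s t := osc_integrable sphi r0 ballU x (ac s) nu1 (component_measurable t) (component_L2_fin t).
have [c11 s11] := I true true; have [c00 s00] := I false false.
have [c10 s10] := I true false; have [c01 s01] := I false true.
have d1 := integrableB measurableT c11 c00.
have d2 := integrableB measurableT d1 s10.
have d3 := integrableB measurableT s11 s00.
have d4 := integrableD measurableT d3 c10.
rewrite /osc_op /Cintegral /=; split; rewrite ?mul0r ?subr0 ?addr0; congr (_ * _).
- rewrite /Cpart /Spart -(RintegralB measurableT c11 c00) -(RintegralB measurableT d1 s10).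
  rewrite -(RintegralB measurableT d2 s01); apply: eq_Rintegral => e _.
  rewrite /osc_cos /osc_sin /bc /hc /component /cis /=.
  by case: (b nu (x, e)) => br bi; case: (h e) => hr hi /=; ring.
- rewrite /Cpart /Spart -(RintegralB measurableT s11 s00) -(RintegralD measurableT d3 c10).
  rewrite -(RintegralD measurableT d4 c01); apply: eq_Rintegral => e _.
  rewrite /osc_cos /osc_sin /bc /hc /component /cis /=.
  by case: (b nu (x, e)) => br bi; case: (h e) => hr hi /=; ring.
Qed.

Lemma osc_op_measurable :
  measurable_fun [set: M3] (fun x => complex.Re (osc_op phi b nu h x)) /\
  measurable_fun [set: M3] (fun x => complex.Im (osc_op phi b nu h x)).
Proof.
have I s t := parts_measurable sphi r0 ballU (ac s) nu1 (component_measurable t).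
have [c11 s11] := I true true; have [c00 s00] := I false false.
have [c10 s10] := I true false; have [c01 s01] := I false true.
split.
  under eq_fun do rewrite (osc_op_parts _).1.
  exact: (measurable_funM (measurable_cst _) (measurable_funB (measurable_funB (measurable_funB c11 c00) s10) s01)).
under eq_fun do rewrite (osc_op_parts _).2.
exact: (measurable_funM (measurable_cst _) (measurable_funD (measurable_funD (measurable_funB s11 s00) c10) c01)).
Qed.

(** Real and imaginary parts are sums of four terms each, whence the factor 4; their eight squares
    regroup into four energies. *)
Lemma osc_op_energy x : sqn (osc_op phi b nu h x) <=
  nu ^+ 2 * (4 * \sum_(q : bool * bool) energy phi (bc q.1) nu (hc q.2) x).
Proof.
rewrite /sqn (osc_op_parts x).1 (osc_op_parts x).2 !exprMn -mulrDr.
apply: ler_wpM2l; first exact: sqr_ge0.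
rewrite -(pair_big xpredT xpredT (fun s t => energy phi (bc s) nu (hc t) x)) /=.
rewrite !big_bool /= /energy.
have four (p q v w : R) : (p + q + v + w) ^+ 2 <= 4 * (p ^+ 2 + q ^+ 2 + v ^+ 2 + w ^+ 2).
  have := sqr_ge0 (p - q); have := sqr_ge0 (p - v); have := sqr_ge0 (p - w).
  have := sqr_ge0 (q - v); have := sqr_ge0 (q - w); have := sqr_ge0 (v - w).
  by lra.
set c11 := Cpart _ (bc true) _ (hc true) _; set s11 := Spart _ (bc true) _ (hc true) _.
set c10 := Cpart _ (bc true) _ (hc false) _; set s10 := Spart _ (bc true) _ (hc false) _.
set c01 := Cpart _ (bc false) _ (hc true) _; set s01 := Spart _ (bc false) _ (hc true) _.
set c00 := Cpart _ (bc false) _ (hc false) _; set s00 := Spart _ (bc false) _ (hc false) _.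
have := four c11 (- c00) (- s10) (- s01); have := four s11 (- s00) c10 c01.
rewrite !sqrrN => h1 h2; apply: le_trans (lerD h2 h1) _.
by apply: le_of_eq; ring.
Qed.

End ComplexAmplitudes.

(** * The squared estimate for complex amplitudes *)

Section ComplexBilinear.
Context {R : realType}.
Notation MR := (measurableTypeR R).
Notation M2 := (MR * MR)%type.
Notation M3 := (MR * MR * MR)%type.
Notation V := (R3 R * R2 R)%type.
Variables (U : set V) (phi : V -> R) (p0 : V) (r c : R) (A1 A2 A11 A12 A21 A22 : 'I_3 -> R).
Hypotheses (oU : open U) (sphi : smooth_on U phi) (r0 : 0 < r) (c0 : 0 < c)
  (ballU : forall p, `|p - p0| <= 12 * r -> U p)
  (ball_close : derivatives_close phi p0 (12 * r) c A1 A2 A11 A12 A21 A22)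
  (nondegenerate : axis_dominates c A1 A2 A11 A12 A21 A22).

Lemma energy_bound (b1 b2 : R -> V -> R) : real_amplitude p0 r b1 -> real_amplitude p0 r b2 ->
  exists2 C, 0 <= C & forall a b, 1 <= a -> a <= b -> forall f g : M2 -> R,
  measurable_fun setT f -> measurable_fun setT g ->
  (\int[lam2]_e ((f e) ^+ 2)%:E < +oo)%E -> (\int[lam2]_e ((g e) ^+ 2)%:E < +oo)%E ->
  (\int[lam3]_x (energy phi b1 a f x * energy phi b2 b g x)%:E <=
   (C * a / (a * b) ^+ 2)%:E *
     ((\int[lam2]_e ((f e) ^+ 2)%:E) * (\int[lam2]_e ((g e) ^+ 2)%:E)))%E.
Proof.
move=> A1' A2'; have [sb1 bb1 bs1] := A1'; have [sb2 bb2 bs2] := A2'.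
have [C C0 HC] := bilinear_L2 oU sphi r0 c0 ballU ball_close nondegenerate sb1 sb2 bb1 bb2 bs1 bs2.
exists C => // a b a1 ab f g mf mg ff gf.
have b1' : 1 <= b by exact: le_trans ab.
have := HC a b a1 ab f g mf mg ff gf; apply: le_trans.
apply: le_of_eq; apply: eq_integral => x _.
by rewrite (energy_product sphi r0 ballU x A1' A2' a1 b1' mf mg ff gf).
Qed.

Variables b1 b2 : R -> V -> R[i].
Hypotheses (bb1 : bounded_order_zero b1) (bb2 : bounded_order_zero b2)
  (bs1 : supported_in [set p | `|p - p0| <= r] b1)
  (bs2 : supported_in [set p | `|p - p0| <= r] b2).

(** The prefactors of the two operators contribute (a b)^2, which cancels the denominator in
    [energy_bound]; 16 is the product of the two factors 4, and the constants are summed over all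
    choices of parts of amplitudes and inputs. *)
Lemma osc_product_bound : exists2 C, 0 <= C & forall a b, 1 <= a -> a <= b ->
  forall f g : M2 -> R[i], inL2 (leb2 R) f -> inL2 (leb2 R) g ->
  (\int[lam3]_x (sqn (osc_op phi b1 a f x * osc_op phi b2 b g x))%:E <=
   (C * a)%:E * ((\int[lam2]_e (sqn (f e))%:E) * (\int[lam2]_e (sqn (g e))%:E)))%E.
Proof.
pose bc1 s := fun nu p => component s (b1 nu p); pose bc2 s := fun nu p => component s (b2 nu p).
have /choice[Cf HCf] : forall st : bool * bool, exists C, 0 <= C /\
  forall a b, 1 <= a -> a <= b -> forall f g : M2 -> R,
  measurable_fun setT f -> measurable_fun setT g ->
  (\int[lam2]_e ((f e) ^+ 2)%:E < +oo)%E -> (\int[lam2]_e ((g e) ^+ 2)%:E < +oo)%E ->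
  (\int[lam3]_x (energy phi (bc1 st.1) a f x * energy phi (bc2 st.2) b g x)%:E <=
   (C * a / (a * b) ^+ 2)%:E *
     ((\int[lam2]_e ((f e) ^+ 2)%:E) * (\int[lam2]_e ((g e) ^+ 2)%:E)))%E.
  move=> [s t]; have [C C0 HC] := energy_bound (component_amplitude s bb1 bs1) (component_amplitude t bb2 bs2).
  by exists C.
pose idx := ((bool * bool) * (bool * bool))%type.
pose K := \sum_(q : idx) Cf (q.1.1, q.2.1).
have K0 : 0 <= K by apply: sumr_ge0 => q _; have [] := HCf (q.1.1, q.2.1).
exists (16 * K); first by rewrite mulr_ge0.
move=> a b a1 ab f g fL2 gL2.
have b1' : 1 <= b by exact: le_trans ab.
have a0 : 0 < a by exact: lt_le_trans a1.
have b0 : 0 < b by exact: lt_le_trans b1'.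
pose hf s := component s \o f; pose hg s := component s \o g.
have mf s : measurable_fun [set: M2] (hf s) by exact: component_measurable.
have mg s : measurable_fun [set: M2] (hg s) by exact: component_measurable.
pose E1 (q : bool * bool) x := energy phi (bc1 q.1) a (hf q.2) x.
pose E2 (q : bool * bool) x := energy phi (bc2 q.1) b (hg q.2) x.
have En0 (bb : R -> V -> R) nu h x : 0 <= energy phi bb nu h x by rewrite addr_ge0// sqr_ge0.
have mE1 q : measurable_fun [set: M3] (E1 q).
  have [m1 m2] := parts_measurable sphi r0 ballU (component_amplitude q.1 bb1 bs1) a1 (mf q.2).
  by apply: measurable_funD; apply: measurable_funX.
have mE2 q : measurable_fun [set: M3] (E2 q).
  have [m1 m2] := parts_measurable sphi r0 ballU (component_amplitude q.1 bb2 bs2) b1' (mg q.2).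
  by apply: measurable_funD; apply: measurable_funX.
have mE q : measurable_fun [set: M3] (fun x => (E1 q.1 x * E2 q.2 x)%:E).
  by apply/measurable_EFinP; apply: measurable_funM.
have k0 : 0 <= 16 * (a * b) ^+ 2 by rewrite mulr_ge0// sqr_ge0.
have pt x : sqn (osc_op phi b1 a f x * osc_op phi b2 b g x) <=
    16 * (a * b) ^+ 2 * \sum_(q : idx) E1 q.1 x * E2 q.2 x.
  rewrite sqnM.
  have h1 := osc_op_energy sphi r0 ballU bb1 bs1 a1 fL2 x.
  have h2 := osc_op_energy sphi r0 ballU bb2 bs2 b1' gL2 x.
  apply: le_trans (ler_pM (sqn_ge0 _) (sqn_ge0 _) h1 h2) _.
  rewrite -(pair_big xpredT xpredT (fun p q => E1 p x * E2 q x)) /=.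
  rewrite -big_distrlr /= le_eqVlt; apply/orP; left; apply/eqP.
  by rewrite -/bc1 -/bc2; ring.
apply: (@le_trans _ _ (\int[lam3]_x ((16 * (a * b) ^+ 2)%:E * \sum_(q : idx) (E1 q.1 x * E2 q.2 x)%:E))%E).
  apply: ge0_le_integral => //.
  - by move=> x _; rewrite lee_fin sqn_ge0.
  - have [m1 m2] := osc_op_measurable sphi r0 ballU bb1 bs1 a1 fL2.
    have [m3 m4] := osc_op_measurable sphi r0 ballU bb2 bs2 b1' gL2.
    apply/measurable_EFinP; under eq_fun do rewrite sqnM.
    by apply: measurable_funM; apply: measurable_funD; apply: measurable_funX.
  - by apply: measurable_funeM; apply: emeasurable_sum.
  - by move=> x _; rewrite sumEFin -EFinM lee_fin.
rewrite ge0_integralZl//; last 2 first.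
- exact: emeasurable_sum.
- by move=> x _; apply: sume_ge0 => q _; rewrite lee_fin; apply: mulr_ge0; exact: En0.
rewrite ge0_integral_sum//; last by move=> q x _; rewrite lee_fin; apply: mulr_ge0; exact: En0.
set J := (X in (_ <= _ * X)%E).
have J0 : (0 <= J)%E.
  by apply: mule_ge0; apply: integral_ge0 => e _; rewrite lee_fin sqn_ge0.
have kab q : 0 <= Cf q * a / (a * b) ^+ 2.
  have [C0 _] := HCf q.
  by apply: divr_ge0; [apply: mulr_ge0 => //; exact: ltW|exact: sqr_ge0].
apply: (@le_trans _ _ ((16 * (a * b) ^+ 2)%:E * \sum_(q : idx) ((Cf (q.1.1, q.2.1) * a / (a * b) ^+ 2)%:E * J))%E).
  apply: lee_wpmul2l; first by rewrite lee_fin.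
  apply: lee_sum => q _; have [C0 H] := HCf (q.1.1, q.2.1).
  apply: le_trans (H a b a1 ab _ _ (mf q.1.2) (mg q.2.2) (component_L2_fin fL2 _) (component_L2_fin gL2 _)) _.
  apply: lee_wpmul2l; first by rewrite lee_fin.
  apply: lee_pmul.
  - by apply: integral_ge0 => e _; rewrite lee_fin sqr_ge0.
  - by apply: integral_ge0 => e _; rewrite lee_fin sqr_ge0.
  - exact: component_L2_le.
  - exact: component_L2_le.
rewrite -ge0_sume_distrl; last by move=> q _; rewrite lee_fin.
rewrite sumEFin muleA -EFinM le_eqVlt; apply/orP; left; apply/eqP; congr (_%:E * _)%E.
rewrite /K mulr_sumr [in RHS]mulr_sumr mulr_suml; apply: eq_bigr => q _.
by field; rewrite !gt_eqF.
Qed.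

End ComplexBilinear.

(** * The bilinear estimate on a patch around each point *)

Unset Implicit Arguments.

Theorem proposition3p2 (R : realType)
    (Omega_x : set (R3 R)) (Omega_xi : set (R2 R))
    (phi : R3 R * R2 R -> R)
    (open_x : open Omega_x) (open_xi : open Omega_xi)
    (phi_smooth : smooth_on (Omega_x `*` Omega_xi) phi)
    (rank_A : forall x xi, Omega_x x -> Omega_xi xi ->
       \rank (mixed_hessian phi x xi) = 2%N)
    (definite_II : forall x xi, Omega_x x -> Omega_xi xi ->
       definite_form (second_fundamental_form (gradx phi x) xi)) :
  forall (x0 : R3 R) (xi0 : R2 R), Omega_x x0 -> Omega_xi xi0 ->
  exists K : set (R3 R * R2 R),
    [/\ compact K, nbhs (x0, xi0) K, K `<=` Omega_x `*` Omega_xi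
      & forall b1 b2 : R -> R3 R * R2 R -> R[i],
        bounded_order_zero b1 -> supported_in K b1 ->
        bounded_order_zero b2 -> supported_in K b2 ->
        exists C : R,
          forall alpha beta : R, 1 <= alpha -> alpha <= beta ->
          forall f g : R2 R -> R[i],
            inL2 (leb2 R) f -> inL2 (leb2 R) g ->
            (L2norm (leb3 R)
               (fun x => osc_op phi b1 alpha f x * osc_op phi b2 beta g x)%R
             <= (C * alpha `^ (1 / 2))%:E
                * L2norm (leb2 R) f * L2norm (leb2 R) g)%E].
Proof.
move=> x0 xi0 Ox Oxi.
have [r [c [A1 [A2 [A11 [A12 [A21 [A22 [r0 c0 ballU close nondeg]]]]]]]]] :=
  patch_exists open_x open_xi phi_smooth Ox Oxi (definite_II _ _ Ox Oxi).
(* The patch has radius r only; the ball of radius 12 r is the room in which the phase is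
   controlled. *)
exists [set p | `|p - (x0, xi0)| <= r]; split.
- exact: compact_patch.
- apply/nbhs_ballP; exists r => //= p; rewrite -ball_normE /ball_ /= distrC; exact: ltW.
- by move=> p /= pr; apply: ballU; apply: le_trans pr _; rewrite ler_peMl ?ler1n// ltW.
have oU : open (Omega_x `*` Omega_xi).
  rewrite openE => -[x y] [/= Ox_x Oxi_y]; exists (Omega_x, Omega_xi) => //.
  by split; exact: open_nbhs_nbhs.
move=> b1 b2 bb1 bs1 bb2 bs2.
have [C C0 HC] := osc_product_bound oU phi_smooth r0 c0 ballU close nondeg bb1 bb2 bs1 bs2.
(* The estimate for squared norms has the factor C a; its square root splits into this constant and
   the power 1/2 of the smaller frequency. *)
exists (C `^ 2^-1) => a b a1 ab f g fL2 gL2.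
have a0 : 0 <= a by exact: le_trans a1.
have H := HC a b a1 ab f g fL2 gL2.
rewrite !L2normE div1r -powRM//.
have i0 (d : measure_display) (T : measurableType d) (m : {measure set T -> \bar R}) (h : T -> R[i]) :
    (0 <= \int[m]_t (sqn (h t))%:E)%E.
  by apply: integral_ge0 => t _; rewrite lee_fin sqn_ge0.
have Ca0 : (0 <= (C * a)%:E)%E by rewrite lee_fin mulr_ge0.
rewrite -poweR_EFin -muleA -poweRM// -poweRM ?mule_ge0//.
apply: gt0_ler_poweR => //.
- by rewrite in_itv /= leey i0.
- by rewrite in_itv /= leey andbT; apply: mule_ge0 => //; apply: mule_ge0; exact: i0.
Qed.
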